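(* Let $(M,g,J,\Omega)$ be an almost Kähler, non-Kähler manifold of real dimension 4 satisfying the second curvature condition of Gray $G_2$. Let $\mathcal D=\{X\in TM:\nabla_XJ=0\}$ be the Kähler nullity of $(g,J)$, which is a 2-dimensional distribution on $M$, let $\mathcal D^\perp$ be its $g$-orthogonal complement, let $\bar M$ be $M$ with the reversed orientation, let $\bar J$ be the $g$-orthogonal almost complex structure on $\bar M$ equal to $J$ on $\mathcal D$ and to $-J$ on $\mathcal D^\perp$, and let $\bar\Omega(X,Y)=g(\bar JX,Y)$. Then: (i) The traceless Ricci tensor $\mathrm{Ric}_0$ of $g$ is given by $$\mathrm{Ric}_0=\frac{\kappa}{4}\left[-g^{\mathcal D}+g^{\mathcal D^\perp}\right],$$ where $g^{\mathcal D}$ and $g^{\mathcal D^\perp}$ denote the restrictions of $g$ to $\mathcal D$ and $\mathcal D^\perp$, respectively, and $\kappa$ is the conformal scalar curvature of $(g,J)$. (ii) The triple $(g,\bar J,\bar\Omega)$ is an almost Kähler structure on $\bar M$, the Ricci tensor of $g$ is $\bar J$-invariant, and $W_2^-=0$. Moreover, $\mathcal D^\perp$ is contained in the Kähler nullity of $(g,\bar J,\bar\Omega)$, i.e. $\nabla_X\bar J=0$ for all $X\in\mathcal D^\perp$.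
   Context: Manifolds are smooth and connected, not assumed compact; $\nabla$ is the Levi-Civita connection. An almost Kähler structure is a triple $(g,J,\Omega)$ of a Riemannian metric $g$, a $g$-orthogonal almost complex structure $J$, and a symplectic form $\Omega$ with $\Omega(X,Y)=g(JX,Y)$; it is Kähler if $J$ is integrable. $M$ is oriented by $J$. Condition $G_2$: $R(X,Y,Z,W)-R(JX,JY,Z,W)=R(JX,Y,JZ,W)+R(JX,Y,Z,JW)$ for all $X,Y,Z,W$, where $R$ is the Riemannian curvature. $R$ is viewed as a symmetric endomorphism of $\Lambda^2M=\Lambda^+M\oplus\Lambda^-M$, $R=\frac{s}{12}\mathrm{id}+\widetilde{\mathrm{Ric}_0}+W^++W^-$, where $s$ is the scalar curvature (positive on round spheres), $\widetilde{\mathrm{Ric}_0}$ is the Kulkarni–Nomizu extension of the traceless Ricci tensor to an endomorphism of $\Lambda^2M$, and $W^\pm$ are the self-dual/anti-self-dual parts of the Weyl tensor, viewed as symmetric traceless endomorphisms of $\Lambda^\pm M$. The inner product $\langle\cdot,\cdot\rangle$ on $\Lambda^2M$ induces half of the usual tensor norm on $\Lambda^1M\otimes\Lambda^1M$ (so $|\Omega|^2=2$). The conformal scalar curvature of $(g,J)$ is $\kappa=3\langle W^+(\Omega),\Omega\rangle$. Relative to $\bar J$ one has $\Lambda^-M=\mathbb R\bar\Omega\oplus\bar\Lambda^{anti}M$, where $\bar\Lambda^{anti}M$ is the bundle of $\bar J$-anti-invariant 2-forms ($\phi(\bar JX,\bar JY)=-\phi(X,Y)$); $W_2^-$ denotes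 the component of $W^-$ exchanging the two summands, so $W_2^-=0$ means that $\bar\Omega$ is an eigenform of $W^-$ at each point. The Ricci tensor is $\bar J$-invariant if $\mathrm{Ric}(\bar JX,\bar JY)=\mathrm{Ric}(X,Y)$. *)

(* Defs.v *)
From mathcomp Require Import all_boot all_order all_algebra.
From mathcomp Require Import all_classical all_reals all_analysis.

Set Implicit Arguments.
Unset Strict Implicit.
Unset Printing Implicit Defensive.

Import Order.TTheory GRing.Theory Num.Theory.
Import numFieldNormedType.Exports.

Local Open Scope classical_set_scope.
Local Open Scope ring_scope.

(* Tensor calculus is done in charts.  Tangent vectors at a point of a chart
   are row vectors of components, so a linear map A acts by X |-> X *m A
   (row a of A is the image of the coordinate vector d_a), and a bilinear form
   B is evaluated by [bil]; 2-forms are skew-symmetric matrices. *)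

Section Calculus.
Variable R : realType.
Implicit Types (a : 'I_4) (x : 'rV[R]_4).

Definition partial a (f : 'rV[R]_4 -> R) x : R := 'D_(delta_mx 0 a) f x.

(* All iterated partial derivatives exist and are differentiable, i.e. f is
   C^oo when U is open; f may take arbitrary values outside U. *)
Definition smooth_on (U : set 'rV[R]_4) (f : 'rV[R]_4 -> R) : Prop :=
  forall (s : seq 'I_4) x, U x -> differentiable (foldr partial f s) x.

Definition smooth_on_mx m n (U : set 'rV[R]_4) (F : 'rV[R]_4 -> 'M[R]_(m, n)) :=
  forall i j, smooth_on U (fun x => F x i j).

Definition partial_mx a (F : 'rV[R]_4 -> 'M[R]_4) x : 'M[R]_4 :=
  \matrix_(i, j) partial a (fun y => F y i j) x.

Definition bil (B : 'M[R]_4) (X Y : 'rV[R]_4) : R := (X *m B *m Y^T) 0 0.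

End Calculus.

(* A smooth atlas modelled on R^4.  [chart_inv c] inverts [chart_map c] on
   [chart_dom c]. *)
Record atlas4 (R : realType) (M : topologicalType) := Atlas4 {
  chart : Type;
  chart_dom : chart -> set M;
  chart_map : chart -> M -> 'rV[R]_4;
  chart_inv : chart -> 'rV[R]_4 -> M;
  chart_dom_open : forall c, open (chart_dom c);
  chart_dom_cover : forall p, exists c, chart_dom c p;
  chart_img_open : forall c, open (chart_map c @` chart_dom c);
  chart_mapK : forall c p, chart_dom c p -> chart_inv c (chart_map c p) = p;
  chart_map_continuous :
    forall c, {within chart_dom c, continuous (chart_map c)};
  chart_inv_continuous :
    forall c, {within chart_map c @` chart_dom c, continuous (chart_inv c)};
  transition_smooth : forall c d,
    smooth_on_mx (chart_map c @` (chart_dom c `&` chart_dom d))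
      (chart_map d \o chart_inv c)
}.

Section Fields.
Variables (R : realType) (M : topologicalType) (A : atlas4 R M).
Implicit Types (c d : chart A) (p : M).

Definition chart_img c : set 'rV[R]_4 := chart_map c @` chart_dom c.

Definition transition c d : 'rV[R]_4 -> 'rV[R]_4 := chart_map d \o chart_inv c.

(* Components of a field in every chart; only the values on [chart_img c]
   matter. *)
Definition mxfield := chart A -> 'rV[R]_4 -> 'M[R]_4.

Definition smooth_field (T : mxfield) : Prop :=
  forall c, smooth_on_mx (chart_img c) (T c).

(* Row-vector convention: a tangent vector with components X in chart c has
   components X *m 'J (transition c d) (chart_map c p) in chart d. *)
Definition bilinear_field (T : mxfield) : Prop :=
  smooth_field T /\
  forall c d p, chart_dom c p -> chart_dom d p ->
    let K := 'J (transition c d) (chart_map c p) in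
    T c (chart_map c p) = K *m T d (chart_map d p) *m K^T.

Definition endo_field (T : mxfield) : Prop :=
  smooth_field T /\
  forall c d p, chart_dom c p -> chart_dom d p ->
    let K := 'J (transition c d) (chart_map c p) in
    T c (chart_map c p) *m K = K *m T d (chart_map d p).

(* Smooth subbundle of TM of rank k; the fibre at a point is the row space. *)
Definition smooth_distribution (k : nat) (V : mxfield) : Prop :=
  (forall c x, chart_img c x ->
     exists (U : set 'rV[R]_4) (B : 'rV[R]_4 -> 'M[R]_(k, 4)),
       [/\ open U, U x, U `<=` chart_img c, smooth_on_mx U B &
           forall y, U y -> row_free (B y) /\ (V c y == B y)%MS]) /\
  (forall c d p, chart_dom c p -> chart_dom d p ->
     (V c (chart_map c p) *m 'J (transition c d) (chart_map c p)
        == V d (chart_map d p))%MS).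

Definition riemannian_metric (g : mxfield) : Prop :=
  [/\ bilinear_field g,
      forall c x, chart_img c x -> (g c x)^T = g c x &
      forall c x, chart_img c x -> forall X, X != 0 -> 0 < bil (g c x) X X].

Definition almost_complex (J : mxfield) : Prop :=
  endo_field J /\ forall c x, chart_img c x -> J c x *m J c x = - 1%:M.

Definition closed_form (w : mxfield) : Prop :=
  forall c x, chart_img c x -> forall i j k : 'I_4,
    partial i (fun y => w c y j k) x + partial j (fun y => w c y k i) x
    + partial k (fun y => w c y i j) x = 0.

Definition symplectic (w : mxfield) : Prop :=
  [/\ bilinear_field w,
      forall c x, chart_img c x -> (w c x)^T = - w c x,
      forall c x, chart_img c x -> w c x \in unitmx &
      closed_form w].

Definition almost_kahler (g J w : mxfield) : Prop :=
  [/\ riemannian_metric g, almost_complex J, symplectic w,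
      forall c x, chart_img c x -> forall X Y,
        bil (g c x) (X *m J c x) (Y *m J c x) = bil (g c x) X Y &
      forall c x, chart_img c x -> forall X Y,
        bil (w c x) X Y = bil (g c x) (X *m J c x) Y].

(* Component k of [J d_i, J d_j] - J [J d_i, d_j] - J [d_i, J d_j]. *)
Definition nijenhuis (J : 'rV[R]_4 -> 'M[R]_4) x (i j k : 'I_4) : R :=
  \sum_l (J x i l * partial l (fun y => J y j k) x
          - J x j l * partial l (fun y => J y i k) x
          - J x l k * (partial i (fun y => J y j l) x
                       - partial j (fun y => J y i l) x)).

Definition integrable_acs (J : mxfield) : Prop :=
  forall c x, chart_img c x -> forall i j k, nijenhuis (J c) x i j k = 0.

Definition kahler (g J w : mxfield) : Prop :=
  almost_kahler g J w /\ integrable_acs J.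

End Fields.

Section Curvature.
Variable R : realType.
Implicit Types (g J : 'rV[R]_4 -> 'M[R]_4) (x X Y Z W : 'rV[R]_4).

(* Row i of [christoffel g x k] is the Levi-Civita derivative of d_i along
   d_k. *)
Definition christoffel g x (k : 'I_4) : 'M[R]_4 :=
  (\matrix_(i, l) (2^-1 * (partial k (fun y => g y i l) x
                           + partial i (fun y => g y k l) x
                           - partial l (fun y => g y k i) x)))
  *m invmx (g x).

(* Covariant derivative along X of the endomorphism field J. *)
Definition nabla_endo g J x X : 'M[R]_4 :=
  \sum_k X 0 k *: (partial_mx k J x
                   + J x *m christoffel g x k - christoffel g x k *m J x).

(* The endomorphism nabla_[d_k, d_l] - [nabla_(d_k), nabla_(d_l)]. *)
Definition curv_endo g x (k l : 'I_4) : 'M[R]_4 :=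
  partial_mx l (christoffel g ^~ k) x - partial_mx k (christoffel g ^~ l) x
  + christoffel g x k *m christoffel g x l
  - christoffel g x l *m christoffel g x k.

(* R(X, Y, Z, W) = g(R(X, Y) Z, W), signed so that R(X, Y, X, Y) > 0 on round
   spheres. *)
Definition riem g x X Y Z W : R :=
  \sum_k \sum_l X 0 k * Y 0 l * bil (curv_endo g x k l *m g x) Z W.

Definition riem_comp g x (i j k l : 'I_4) : R :=
  riem g x (delta_mx 0 i) (delta_mx 0 j) (delta_mx 0 k) (delta_mx 0 l).

Definition ricci g x : 'M[R]_4 :=
  \matrix_(j, l) \sum_i \sum_k invmx (g x) i k * riem_comp g x i j k l.

Definition scal g x : R := \tr (invmx (g x) *m ricci g x).

Definition ricci0 g x : 'M[R]_4 := ricci g x - (scal g x / 4) *: g x.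

End Curvature.

(* Pointwise algebra of 2-forms; G is the metric at the point. *)
Section TwoForms.
Variable R : realType.
Implicit Types (G J f h : 'M[R]_4) (X Y : 'rV[R]_4).

Definition raise2 G f : 'M[R]_4 := invmx G *m f *m invmx G.

(* Half of the tensor inner product. *)
Definition inner2 G f h : R := 2^-1 * \tr (raise2 G f *m h^T).

(* The sign, relative to the coordinate frame, of the orientation for which
   the frames (X, JX, Y, JY) are positive. *)
Definition orient J : R :=
  if `[< exists X Y, 0 < \det (\matrix_(i < 4)
           tnth [tuple X; X *m J; Y; Y *m J] i) >] then 1 else -1.

(* Riemannian volume form of the orientation of sign e. *)
Definition vol G (e : R) (i j k l : 'I_4) : R :=
  e * Num.sqrt (\det G)
  * \det (\matrix_(r < 4) (delta_mx 0 (tnth [tuple i; j; k; l] r) : 'rV[R]_4)).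

Definition hodge G e f : 'M[R]_4 :=
  \matrix_(k, l) (2^-1 * \sum_i \sum_j raise2 G f i j * vol G e i j k l).

Definition self_dual_part G e f : 'M[R]_4 := 2^-1 *: (f + hodge G e f).
Definition anti_self_dual_part G e f : 'M[R]_4 := 2^-1 *: (f - hodge G e f).

Definition antiinvariant_part J f : 'M[R]_4 := 2^-1 *: (f - J *m f *m J^T).

(* Orthogonal projection onto the line spanned by h. *)
Definition line_part G h f : 'M[R]_4 := (inner2 G f h / inner2 G h h) *: h.

End TwoForms.

Section CurvatureDecomposition.
Variable R : realType.
Implicit Types (g J : 'rV[R]_4 -> 'M[R]_4) (x : 'rV[R]_4) (f h : 'M[R]_4).

Definition curv_op g x f : 'M[R]_4 :=
  \matrix_(i, j)
    (2^-1 * \sum_k \sum_l riem_comp g x i j k l * raise2 (g x) f k l).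

(* X /\ Y |-> (Ric0 X /\ Y + X /\ Ric0 Y) / 2. *)
Definition ricci0_op g x f : 'M[R]_4 :=
  2^-1 *: (ricci0 g x *m invmx (g x) *m f + f *m invmx (g x) *m ricci0 g x).

Definition weyl_op g x f : 'M[R]_4 :=
  curv_op g x f - (scal g x / 12) *: f - ricci0_op g x f.

(* W^+ and W^-, extended by zero to all 2-forms, for the orientation of J. *)
Definition weyl_plus g J x f : 'M[R]_4 :=
  let P := self_dual_part (g x) (orient (J x)) in P (weyl_op g x (P f)).

Definition weyl_minus g J x f : 'M[R]_4 :=
  let P := anti_self_dual_part (g x) (orient (J x)) in P (weyl_op g x (P f)).

Definition conformal_scal g J w x : R :=
  3 * inner2 (g x) (weyl_plus g J x (w x)) (w x).

(* The component of W^- exchanging the line of w' and the J'-anti-invariant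
   forms, where w' is the form of J'. *)
Definition weyl_minus2 g J J' w' x f : 'M[R]_4 :=
  line_part (g x) (w' x) (weyl_minus g J x (antiinvariant_part (J' x) f))
  + antiinvariant_part (J' x) (weyl_minus g J x (line_part (g x) (w' x) f)).

End CurvatureDecomposition.

Section Nullity.
Variables (R : realType) (M : topologicalType) (A : atlas4 R M).
Implicit Types (g J D : mxfield A) (c : chart A) (x : 'rV[R]_4).

Definition condition_G2 g J : Prop :=
  forall c x, chart_img c x -> forall X Y Z W,
    let Rm := riem (g c) x in
    let j X := X *m J c x in
    Rm X Y Z W - Rm (j X) (j Y) Z W
    = Rm (j X) Y (j Z) W + Rm (j X) Y Z (j W).

Definition kahler_nullity g J : mxfield A := fun c x =>
  kermx (lin1_mx (mxvec \o nabla_endo (g c) (J c) x)).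

Lemma kahler_nullityP g J c x (X : 'rV[R]_4) :
  (X <= kahler_nullity g J c x)%MS <-> nabla_endo (g c) (J c) x X = 0.
Proof.
have E : X *m lin1_mx (mxvec \o nabla_endo (g c) (J c) x)
         = mxvec (nabla_endo (g c) (J c) x X).
  apply/rowP => j; rewrite !mxE /nabla_endo linear_sum /= summxE.
  apply: eq_bigr => k _; rewrite !mxE /= linearZ /= !mxE.
  rewrite linear_sum /= summxE (bigD1 k) //= big1 ?addr0 => [|l lk].
    by rewrite linearZ /= !mxE !eqxx mul1r.
  by rewrite linearZ /= !mxE eqxx (negbTE lk) mul0r.
split=> [/sub_kermxP|X0]; last by apply/sub_kermxP; rewrite E X0 linear0.
by rewrite E => /eqP; rewrite mxvec_eq0 => /eqP.
Qed.

Definition perp g D : mxfield A := fun c x =>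
  kermx (g c x *m (D c x)^T).

(* g restricted to D, extended by zero on the orthogonal complement of D. *)
Definition restriction g D : mxfield A := fun c x =>
  let P := proj_mx (D c x) (perp g D c x) in P *m g c x *m P^T.

Definition reversed g J D : mxfield A := fun c x =>
  let D' := perp g D c x in
  (proj_mx (D c x) D' - proj_mx D' (D c x)) *m J c x.

Lemma perp_capmx g D c x :
  (forall X : 'rV_4, X != 0 -> 0 < bil (g c x) X X) ->
  (D c x :&: perp g D c x)%MS = 0.
Proof.
move=> gpos; apply/eqP/rowV0P => X; rewrite sub_capmx => /andP[/submxP[Y XE]].
move=> /sub_kermxP; rewrite mulmxA => X0; apply/eqP; apply: contraT => /gpos.
by rewrite /bil {2}XE trmx_mul mulmxA X0 mul0mx mxE ltxx.
Qed.

Lemma reversedP g J D c x (X : 'rV_4) :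
  (forall Y : 'rV_4, Y != 0 -> 0 < bil (g c x) Y Y) ->
  ((X <= D c x)%MS -> X *m reversed g J D c x = X *m J c x) /\
  ((X <= perp g D c x)%MS -> X *m reversed g J D c x = - (X *m J c x)).
Proof.
move=> /(perp_capmx D) dx.
have dx' : (perp g D c x :&: D c x)%MS = 0 by rewrite capmxC.
split=> XD; rewrite /reversed mulmxA mulmxBr.
  by rewrite proj_mx_id // proj_mx_0 // subr0.
by rewrite proj_mx_0 // proj_mx_id // sub0r mulNmx.
Qed.

Definition fundamental_form g J : mxfield A := fun c x => J c x *m g c x.

End Nullity.

(* Main.v *)
Require Import Defs.
From mathcomp Require Import all_boot all_order all_algebra.
From mathcomp Require Import all_classical all_reals all_analysis.
From mathcomp Require Import ring lra.
From Stdlib Require Ncring Ncring_tac.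

(** Write P for the covariant derivative of J, a 1-form with values in skew
    endomorphisms that anticommute with J, and N for its squared norm, taken to
    be minus the trace of the 2-tensor tr (P X P Y). Where P does not vanish,
    closedness of Omega and a rotation in SU(2) give an orthonormal frame
    e0, e1 = Je0, e2, e3 = Je2 in which P is p phi0 along e0, p psi0 along e1 and zero
    along e2 and e3, where phi0 and psi0 = J0 phi0 are constant self-dual forms
    ([aligned_frame]). So the nullity D is spanned by e2 and e3, and N = 8 p^2.

    The condition G2 says that the curvature F has the same commutator with J as
    the tensor W of constant curvature 1 times a scalar mu ([G2_scalar]). The
    second derivatives of J are constrained by the derivatives of J^2 = -1 and
    of d Omega = 0, and by the Ricci identity, which involves only [F, J]; these
    constraints give mu = -N / 16 ([mu_frame]). The exterior derivative of
    [F, J] = mu [W, J] is algebraic in view of the second Bianchi identity: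
    [F - mu W, P] = dmu /\ [W, J] ([bianchi_commutator]). In the frame it forces
    dmu = 0, and makes the curvature map Omega to a multiple of e0 /\ e1, up to
    the contribution of W ([bianchi2_frame]). So N is locally constant, and as M
    is connected and J is not parallel somewhere, N vanishes nowhere
    ([dJ_norm_neq0]). Moreover F - mu W is a curvature tensor that commutes with
    J, so its Ricci tensor is determined by the image of Omega: it is a multiple
    of the metric of the plane orthogonal to D. This gives the formula for the
    traceless Ricci tensor, the same number being half of the conformal scalar
    curvature, and the invariance of the Ricci tensor under the reversed
    structure ([ricci_frame], [conformal_scalE], [ricci0_projector]).

    Since N is a constant, the projector Pi on the complement of D is a constant
    multiple of tr (P X P Y), and its derivative is expressed by the second
    derivatives of J. The reversed structure is J - 2 Pi J; the constraints on
    the second derivatives and dN = 0 show that it is parallel along the image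
    of Pi and that its fundamental form is closed ([dJbar_parallel],
    [dJbar_closed]). Differentiating the first fact once more shows that the
    curvature F (e0, e1) commutes with the reversed structure
    ([curvature_commutes_Jbar]); with the previous constraints this kills the
    components of the curvature that W^- could use to mix the line of the
    reversed fundamental form with its complement ([weyl_minus2_eq0]).

    Everything is computed in one chart, with an abstract torsion-free metric
    connection. The transformation law of the Christoffel symbols, which follows
    from the uniqueness of the Levi-Civita connection, makes P, N and the
    reversed structure tensorial ([covd_transition], [norm_transition],
    [Jbar_transition]). *)

Set Implicit Arguments.
Unset Strict Implicit.
Unset Printing Implicit Defensive.

Import Order.TTheory GRing.Theory Num.Theory.
Import numFieldNormedType.Exports.

Local Open Scope classical_set_scope.
Local Open Scope ring_scope.

(** * Smooth functions on coordinate domains *)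

Section PartialDerivatives.
Variable R : realType.
Local Notation V := 'rV[R]_4.
Implicit Types (f g : V -> R) (U : set V) (x : V) (a b : 'I_4) (s : seq 'I_4).

(** Both the little-o and the value at the point depend only on the germ. *)
Lemma near_eq_differentiable (W W' : normedModType R) (f g : W -> W') (x : W) :
  {near x, f =1 g} -> differentiable f x -> differentiable g x.
Proof.
move=> fg [[dfc /eqadd_some_oP df]].
have fgx : f x = g x by exact: (nbhs_singleton fg).
apply/diffP => /=.
apply: (@getPex _ (fun (df : {linear W -> W'}) => continuous df /\
  forall y, g y = g (lim (nbhs x)) + df (y - lim (nbhs x))
                  +o_(y \near x) (y - lim (nbhs x)))).
exists ('d f x); split => //.
have : g = cst (g (lim (nbhs x))) + ('d f x \o center (lim (nbhs x)))
     +o_x (center (lim (nbhs x))).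
  apply/eqaddoP => eps eps0.
  move: df => /(_ _ eps0).
  apply: filter_app; near=> y.
  by rewrite lim_id// !fctE fgx (near fg).
rewrite {1}funeqE => H y; exact: H.
Unshelve. all: by end_near. Qed.

Lemma eq_partial U f g a x : open U -> U x -> (forall y, U y -> f y = g y) ->
  partial a f x = partial a g x.
Proof.
move=> oU Ux fg; apply: near_eq_derive; near=> y; apply: fg; near: y.
exact: open_nbhs_nbhs.
Unshelve. all: by end_near. Qed.

Lemma eq_foldr_partial U f g s x : open U -> U x ->
  (forall y, U y -> f y = g y) -> foldr (@partial R) f s x = foldr (@partial R) g s x.
Proof.
move=> oU + fg; elim: s x => [|a s IH] x Ux /=; first exact: fg.
exact: eq_partial oU Ux IH.
Qed.

Lemma eq_differentiable U f g x : open U -> U x ->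
  (forall y, U y -> f y = g y) -> differentiable f x -> differentiable g x.
Proof.
move=> oU Ux fg; apply: near_eq_differentiable; near=> y; apply: fg; near: y.
exact: open_nbhs_nbhs.
Unshelve. all: by end_near. Qed.

(** Truncated smoothness, along which the closure properties are proved by
    induction: the product and quotient rules express a derivative of order
    n + 1 through derivatives of order n. *)
Definition class_on n U f :=
  forall s x, (size s <= n)%N -> U x -> differentiable (foldr (@partial R) f s) x.

Lemma class_onS n U f : class_on n.+1 U f <->
  (forall x, U x -> differentiable f x) /\
  (forall a, class_on n U (partial a f)).
Proof.
split=> [H|[H0 H] s x].
  split=> [x Ux|a s x sn Ux]; first exact: (H [::]).
  by have := H (rcons s a) x; rewrite foldr_rcons size_rcons; apply.
case/lastP: s => [_|s a]; first exact: H0.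
by rewrite size_rcons ltnS foldr_rcons; apply: H.
Qed.

Lemma class_onW n U f : class_on n.+1 U f -> class_on n U f.
Proof. by move=> H s x sn; apply: H; apply: leqW. Qed.

Lemma smooth_classP U f : smooth_on U f <-> forall n, class_on n U f.
Proof.
by split=> [H n s x _|H s x]; [exact: H | exact: (H (size s))].
Qed.

Lemma eq_class_on n U f g : open U -> (forall y, U y -> f y = g y) ->
  class_on n U f -> class_on n U g.
Proof.
move=> oU fg Hf s x sn Ux; apply: (@eq_differentiable U (foldr (@partial R) f s)) => //.
- by move=> y Uy; apply: eq_foldr_partial fg.
- exact: Hf.
Qed.

Lemma eq_smooth_on U f g : open U -> (forall y, U y -> f y = g y) ->
  smooth_on U f -> smooth_on U g.
Proof.
move=> oU fg /smooth_classP Hf; apply/smooth_classP => n.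
exact: eq_class_on (Hf n).
Qed.

Lemma smooth_on_differentiable U f x : smooth_on U f -> U x ->
  differentiable f x.
Proof. by move=> H; apply: (H [::]). Qed.

Lemma smooth_on_partial U f a : smooth_on U f -> smooth_on U (partial a f).
Proof. by move=> H s x Ux; have := H (rcons s a) x Ux; rewrite foldr_rcons. Qed.

Lemma sub_smooth_on U U' f : U `<=` U' -> smooth_on U' f -> smooth_on U f.
Proof. by move=> UU' H s x /UU'; apply: H. Qed.

Lemma partial_cst (c : R) a x : partial a (fun=> c) x = 0.
Proof. exact: derive_cst. Qed.

Lemma partialD f g a x : differentiable f x -> differentiable g x ->
  partial a (fun y => f y + g y) x = partial a f x + partial a g x.
Proof. by move=> df dg; apply: deriveD; apply: diff_derivable. Qed.

Lemma partialN f a x : differentiable f x ->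
  partial a (fun y => - f y) x = - partial a f x.
Proof. by move=> df; apply: deriveN; apply: diff_derivable. Qed.

Lemma partialM f g a x : differentiable f x -> differentiable g x ->
  partial a (fun y => f y * g y) x = partial a f x * g x + f x * partial a g x.
Proof.
move=> df dg; rewrite /partial.
rewrite (_ : (fun y => f y * g y) = f * g)//.
rewrite deriveM; [|exact: diff_derivable..].
by rewrite addrC /= /GRing.scale /= (mulrC (g x)).
Qed.

Lemma partialV f a x : f x != 0 -> differentiable f x ->
  partial a (fun y => (f y)^-1) x = - (f x)^-1 ^+ 2 * partial a f x.
Proof.
move=> f0 df; rewrite /partial deriveV//; last exact: diff_derivable.
by rewrite exprVn /GRing.scale /=.
Qed.

Lemma partialZ (c : R) f a x : differentiable f x ->
  partial a (fun y => c * f y) x = c * partial a f x.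
Proof.
move=> df; rewrite (partialM (f := fun=> c))// partial_cst mul0r add0r//.
Qed.

Lemma partial_sum (I : Type) (r : seq I) (P : pred I) (F : I -> V -> R) a x :
  (forall i, differentiable (F i) x) ->
  partial a (fun y => \sum_(i <- r | P i) F i y) x
    = \sum_(i <- r | P i) partial a (F i) x.
Proof.
move=> dF.
have H : differentiable (fun y => \sum_(i <- r | P i) F i y) x /\
  partial a (fun y => \sum_(i <- r | P i) F i y) x
    = \sum_(i <- r | P i) partial a (F i) x.
  elim: r => [|i r [IH1 IH2]].
    have -> : (fun y => \sum_(i <- [::] | P i) F i y) = fun=> 0.
      by apply/funext => y; rewrite big_nil.
    by rewrite big_nil partial_cst; split=> //; exact: differentiable_cst.
  have -> : (fun y => \sum_(i <- i :: r | P i) F i y) = fun y =>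
      (if P i then F i y else 0) + \sum_(i <- r | P i) F i y.
    by apply/funext => y; rewrite big_cons; case: ifP; rewrite ?add0r.
  rewrite big_cons; case: ifP => Pi.
    by rewrite partialD// IH2; split=> //; apply: differentiableD.
  by under eq_fun do rewrite add0r.
by case: H.
Qed.

Lemma class_on_cst n U (c : R) : class_on n U (fun=> c).
Proof.
elim: n c => [|n IH] c; last first.
  apply/class_onS; split=> [x _|a]; first exact: differentiable_cst.
  by rewrite (_ : partial a _ = fun=> 0)//; apply/funext => x; exact: partial_cst.
by move=> s x; rewrite leqn0 => /nilP -> _; apply: differentiable_cst.
Qed.

Lemma class_onD n U f g : open U -> class_on n U f -> class_on n U g ->
  class_on n U (fun y => f y + g y).
Proof.
move=> oU; elim: n f g => [|n IH] f g Hf Hg.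
  move=> s x; rewrite leqn0 => /nilP -> Ux.
  by apply: differentiableD; [exact: (Hf [::]) | exact: (Hg [::])].
case/class_onS: Hf => df Hf; case/class_onS: Hg => dg Hg.
apply/class_onS; split=> [x Ux|a]; first by apply: differentiableD; auto.
apply: (eq_class_on oU _ (IH _ _ (Hf a) (Hg a))) => y Uy.
by rewrite partialD; auto.
Qed.

Lemma class_onM n U f g : open U -> class_on n U f -> class_on n U g ->
  class_on n U (fun y => f y * g y).
Proof.
move=> oU; elim: n f g => [|n IH] f g Hf Hg.
  move=> s x; rewrite leqn0 => /nilP -> Ux.
  by apply: differentiableM; [exact: (Hf [::]) | exact: (Hg [::])].
have Wf := class_onW Hf; have Wg := class_onW Hg.
case/class_onS: Hf => df Hf; case/class_onS: Hg => dg Hg.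
apply/class_onS; split=> [x Ux|a]; first by apply: differentiableM; auto.
apply: (eq_class_on oU _ (class_onD oU (IH _ _ (Hf a) Wg) (IH _ _ Wf (Hg a)))).
by move=> y Uy; rewrite partialM; auto.
Qed.

Lemma class_onV n U f : open U -> (forall x, U x -> f x != 0) ->
  class_on n U f -> class_on n U (fun y => (f y)^-1).
Proof.
move=> oU f0; elim: n => [|n IH] Hf.
  move=> s x; rewrite leqn0 => /nilP -> Ux.
  by apply: differentiableV; [exact: (Hf [::]) | exact: f0].
have Wf := IH (class_onW Hf).
case/class_onS: Hf => df Hf.
apply/class_onS; split=> [x Ux|a]; first by apply: differentiableV; auto.
have := class_onM oU (class_onM oU (@class_on_cst n U (-1)) (class_onM oU Wf Wf)) (Hf a).
apply: eq_class_on => //.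
by move=> y Uy; rewrite partialV; auto; rewrite mulN1r expr2.
Qed.

Lemma smooth_on_cst U (c : R) : smooth_on U (fun=> c).
Proof. by apply/smooth_classP => n; apply: class_on_cst. Qed.

Lemma smooth_onD U f g : open U -> smooth_on U f -> smooth_on U g ->
  smooth_on U (fun y => f y + g y).
Proof.
move=> oU /smooth_classP Hf /smooth_classP Hg; apply/smooth_classP => n.
exact: class_onD.
Qed.

Lemma smooth_onM U f g : open U -> smooth_on U f -> smooth_on U g ->
  smooth_on U (fun y => f y * g y).
Proof.
move=> oU /smooth_classP Hf /smooth_classP Hg; apply/smooth_classP => n.
exact: class_onM.
Qed.

Lemma smooth_onV U f : open U -> (forall x, U x -> f x != 0) ->
  smooth_on U f -> smooth_on U (fun y => (f y)^-1).
Proof.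
move=> oU f0 /smooth_classP Hf; apply/smooth_classP => n; exact: class_onV.
Qed.

Lemma smooth_onZ U (c : R) f : open U -> smooth_on U f ->
  smooth_on U (fun y => c * f y).
Proof. by move=> oU Hf; apply: (smooth_onM (f := fun=> c)) => //; apply: smooth_on_cst. Qed.

Lemma smooth_onN U f : open U -> smooth_on U f -> smooth_on U (fun y => - f y).
Proof.
move=> oU Hf; rewrite (_ : (fun y => _) = fun y => -1 * f y).
  exact: smooth_onZ.
by apply/funext => y; rewrite mulN1r.
Qed.

Lemma smooth_on_sum U (I : Type) (r : seq I) (P : pred I) (F : I -> V -> R) :
  open U -> (forall i, smooth_on U (F i)) ->
  smooth_on U (fun y => \sum_(i <- r | P i) F i y).
Proof.
move=> oU HF; elim: r => [|i r IH].
  rewrite (_ : (fun y => _) = fun=> 0); first exact: smooth_on_cst.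
  by apply/funext => y; rewrite big_nil.
case Pi : (P i).
  rewrite (_ : (fun y => _) = fun y => F i y + \sum_(i <- r | P i) F i y).
    exact: smooth_onD.
  by apply/funext => y; rewrite big_cons Pi.
rewrite (_ : (fun y => _) = fun y => \sum_(i <- r | P i) F i y)//.
by apply/funext => y; rewrite big_cons Pi.
Qed.

Lemma smooth_on_prod U (I : Type) (r : seq I) (P : pred I) (F : I -> V -> R) :
  open U -> (forall i, smooth_on U (F i)) ->
  smooth_on U (fun y => \prod_(i <- r | P i) F i y).
Proof.
move=> oU HF; elim: r => [|i r IH].
  rewrite (_ : (fun y => _) = fun=> 1); first exact: smooth_on_cst.
  by apply/funext => y; rewrite big_nil.
case Pi : (P i).
  rewrite (_ : (fun y => _) = fun y => F i y * \prod_(i <- r | P i) F i y).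
    exact: smooth_onM.
  by apply/funext => y; rewrite big_cons Pi.
rewrite (_ : (fun y => _) = fun y => \prod_(i <- r | P i) F i y)//.
by apply/funext => y; rewrite big_cons Pi.
Qed.

End PartialDerivatives.

Section MixedPartials.
Variable R : realType.
Local Notation V := 'rV[R]_4.
Implicit Types (f g : V -> R) (U : set V) (x y v : V) (a b : 'I_4).

Lemma is_derive_line f y v (t : R) : differentiable f (y + t *: v) ->
  is_derive t 1 (fun s : R => f (y + s *: v)) ('D_v f (y + t *: v)).
Proof.
move=> df; have dv : derivable f (y + t *: v) v by exact: diff_derivable.
have E : (fun h : R => h^-1 *: (((fun s : R => f (y + s *: v)) \o shift t) (h *: 1)
            - f (y + t *: v)))
       = (fun h : R => h^-1 *: ((f \o shift (y + t *: v)) (h *: v) - f (y + t *: v))).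
  apply/funext => h /=; congr (_ *: (f _ - _)).
  by rewrite [h *: 1]mulr1 scalerDl addrCA.
by apply: DeriveDef; [rewrite /derivable E | rewrite /derive E].
Qed.

Lemma mean_value_line f y v (h : R) : 0 < h ->
  (forall t, 0 <= t <= h -> differentiable f (y + t *: v)) ->
  exists2 t, 0 < t < h & f (y + h *: v) - f y = h * 'D_v f (y + t *: v).
Proof.
move=> h0 df.
have [||t] := @MVT R (fun s : R => f (y + s *: v)) (fun t => 'D_v f (y + t *: v)) 0 h h0.
- by move=> t; rewrite in_itv/= => /andP[t0 th]; apply/is_derive_line/df; rewrite !ltW.
- apply: derivable_within_continuous => t; rewrite in_itv/= => th.
  by have [] := is_derive_line (df _ th).
- rewrite in_itv/= => th; rewrite scale0r addr0 subr0 => ->.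
  by exists t => //; rewrite mulrC.
Qed.

Lemma derive_translate f x v w : 'D_v (fun y => f (y + w)) x = 'D_v f (x + w).
Proof.
rewrite /derive.
have -> // : (fun h : R => h^-1 *: (((fun y => f (y + w)) \o shift x) (h *: v) - f (x + w)))
   = (fun h : R => h^-1 *: ((f \o shift (x + w)) (h *: v) - f (x + w))).
by apply/funext => h /=; rewrite addrA.
Qed.

(** The mean value theorem along v, for the increment of f in the direction w. *)
Lemma second_difference f x v w (h : R) : 0 < h ->
  (forall s t, 0 <= s <= h -> 0 <= t <= h ->
     differentiable f (x + s *: v + t *: w)) ->
  exists2 t, 0 < t < h &
    f (x + h *: v + h *: w) - f (x + h *: w) - (f (x + h *: v) - f x)
      = h * ('D_v f (x + t *: v + h *: w) - 'D_v f (x + t *: v)).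
Proof.
move=> h0 df.
pose F y := f (y + h *: w) - f y.
have dF t : 0 <= t <= h -> differentiable F (x + t *: v).
  move=> th; apply: differentiableB; last first.
    by have := df t 0 th; rewrite scale0r addr0 lexx (ltW h0); apply.
  have := df t h th; rewrite lexx (ltW h0) => /(_ isT) D.
  apply: (differentiable_comp (f := fun y => y + h *: w)) => //.
have [t th E] := mean_value_line h0 dF.
exists t => //; rewrite -/(F (x + h *: v)).
have -> : f (x + h *: v + h *: w) - f (x + h *: w) - (f (x + h *: v) - f x)
  = F (x + h *: v) - F x by rewrite /F; ring.
rewrite E; congr (_ * _).
have th' : 0 <= t <= h by case/andP: th => ? ?; rewrite !ltW.
have D1 := df t h th'; rewrite lexx (ltW h0) in D1.
have D0 : differentiable f (x + t *: v).
  by have := df t 0 th'; rewrite scale0r addr0 lexx (ltW h0); apply.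
rewrite /F deriveB.
- congr (_ - _).
  exact: derive_translate.
- apply: diff_derivable; apply: (differentiable_comp (f := fun y => y + h *: w)) => //.
  exact: D1.
- exact: diff_derivable.
Qed.

Lemma differentiable_eps f x : differentiable f x -> forall eps : R, 0 < eps ->
  exists2 d : R, 0 < d & forall v, `|v| < d ->
    `|f (x + v) - f x - 'd f x v| <= eps * `|v|.
Proof.
move=> /diff_locallyP [_ /eqaddoP H] eps e0.
have := H _ e0; rewrite /= => /nbhs_ballP [d d0 Hd]; exists d => // v vd.
have := Hd v; rewrite -ball_normE /= sub0r normrN => /(_ vd) /=.
by rewrite !fctE /= opprD addrA (addrC x).
Qed.

(** The two values of the first derivative left by [second_difference] are
    compared through its differential at x, with an error o(h) each. *)
Lemma mixed_second_difference f x v w : `|v| <= 1 -> `|w| <= 1 ->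
  (\near x, differentiable f x) -> differentiable ('D_v f) x ->
  forall eps : R, 0 < eps -> exists2 d : R, 0 < d & forall h, 0 < h < d ->
    `|f (x + h *: v + h *: w) - f (x + h *: w) - (f (x + h *: v) - f x)
       - h ^+ 2 * 'D_w ('D_v f) x| <= eps * h ^+ 2.
Proof.
move=> v1 w1 /nbhs_ballP [r /= r0 Hr] dDf eps e0.
have e4 : 0 < eps / 4 by apply: divr_gt0.
have [d d0 Hd] := differentiable_eps dDf e4.
exists (Num.min (d / 2) (r / 2)); first by rewrite lt_min !divr_gt0.
move=> h /andP[h0]; rewrite lt_min => /andP[hd hr].
have norm2 s t : 0 <= s <= h -> 0 <= t <= h -> `|s *: v + t *: w| <= 2 * h.
  move=> /andP[s0 sh] /andP[t0 th].
  rewrite (le_trans (ler_normD _ _))// !normrZ !ger0_norm// mulrDl mul1r.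
  rewrite lerD//.
    by rewrite (le_trans _ sh)// ler_piMr.
  by rewrite (le_trans _ th)// ler_piMr.
have [|t th ->] := @second_difference f x v w h h0.
  move=> s t sh th; apply: Hr; rewrite -ball_normE /=.
  rewrite -addrA opprD addNKr normrN (le_lt_trans (norm2 _ _ sh th))//.
  by rewrite mulrC -ltr_pdivlMr.
have th' : 0 <= t <= h by case/andP: th => ? ?; rewrite !ltW.
have hh : 0 <= h <= h by rewrite lexx ltW.
have zh : 0 <= (0:R) <= h by rewrite lexx ltW.
have n1 := norm2 t h th' hh.
have n2 := norm2 t 0 th' zh.
rewrite scale0r addr0 in n2.
have hd2 : 2 * h < d by rewrite mulrC -ltr_pdivlMr.
have H1 := Hd _ (le_lt_trans n1 hd2).
have H2 := Hd _ (le_lt_trans n2 hd2).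
rewrite addrA in H1.
rewrite [in X in `|X|](deriveE _ dDf).
have L : 'd ('D_v f) x (t *: v + h *: w) = 'd ('D_v f) x (t *: v) + h * 'd ('D_v f) x w.
  rewrite linearD; congr (_ + _); exact: linearZ.
rewrite L in H1.
set A := 'D_v f (x + t *: v + h *: w) in H1 *.
set B := 'D_v f (x + t *: v) in H2 *.
set l := 'd _ _ w in H1 *; set k := 'd _ _ _ in H1 H2.
have -> : h * (A - B) - h ^+ 2 * l =
  h * ((A - 'D_v f x - (k + h * l)) - (B - 'D_v f x - k)) by ring.
rewrite normrM (gtr0_norm h0) expr2 mulrCA ler_pM2l//.
rewrite (le_trans (ler_normB _ _))//.
have -> : eps * h = eps / 4 * (2 * h) + eps / 4 * (2 * h) by field.
by apply: lerD; [apply: le_trans H1 _ | apply: le_trans H2 _];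
  apply: ler_wpM2l => //; exact: ltW.
Qed.

(** Symmetry of second derivatives: both mixed derivatives are the limit of
    the same second difference quotient. *)
Lemma derive_comm f x v w : `|v| <= 1 -> `|w| <= 1 ->
  (\near x, differentiable f x) ->
  differentiable ('D_v f) x -> differentiable ('D_w f) x ->
  'D_w ('D_v f) x = 'D_v ('D_w f) x.
Proof.
move=> v1 w1 df dv dw; apply/eqP/negPn/negP => neq.
set A := 'D_w _ _ in neq *; set B := 'D_v _ x in neq *.
have e0 : 0 < `|A - B| / 4 by rewrite divr_gt0// normr_gt0 subr_eq0.
have [d d0 Hd] := mixed_second_difference v1 w1 df dv e0.
have [c c0 Hc] := mixed_second_difference w1 v1 df dw e0.
pose h := Num.min d c / 2.
have h0 : 0 < h by rewrite divr_gt0// lt_min d0.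
have hm : h < Num.min d c by rewrite /h ltr_pdivrMr// mulr2n mulrDr mulr1 ltrDl lt_min d0.
have := hm; rewrite lt_min => /andP[hd hc].
have := Hd h; rewrite h0 hd => /(_ isT) H1.
have := Hc h; rewrite h0 hc => /(_ isT) H2.
have := le_trans (ler_normB _ _) (lerD H2 H1).
rewrite -/A -/B.
rewrite (addrAC x (h *: w)).
set a := f (x + h *: v + h *: w); set b := f (x + h *: v).
set c' := f (x + h *: w); set e := f x.
have -> : a - b - (c' - e) - h ^+ 2 * B - (a - c' - (b - e) - h ^+ 2 * A)
  = h ^+ 2 * (A - B) by ring.
rewrite normrM (ger0_norm (sqr_ge0 h)) -mulrDl mulrC ler_pM2r ?exprn_gt0//.
have : 0 < `|A - B| by rewrite normr_gt0 subr_eq0.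
by move: `|A - B|; clear => r; lra.
Qed.

Lemma norm_delta_le1 a : `|delta_mx 0 a : V| <= 1.
Proof.
rewrite /Num.Def.normr/= mx_normrE; apply: bigmax_le => [|[i j] _] //=.
by rewrite mxE; case: (_ && _); rewrite ?normr1 ?normr0.
Qed.

Lemma partial_comm U f a b x : open U -> U x -> smooth_on U f ->
  partial a (partial b f) x = partial b (partial a f) x.
Proof.
move=> oU Ux sf; apply: derive_comm; try exact: norm_delta_le1.
- near=> y; apply: (smooth_on_differentiable sf); near: y.
  exact: open_nbhs_nbhs.
- exact: (smooth_on_differentiable (smooth_on_partial b sf)).
- exact: (smooth_on_differentiable (smooth_on_partial a sf)).
Unshelve. all: by end_near. Qed.

(** The mean value theorem along the segments of a ball around x. *)
Lemma partial_eq0_locally_constant U f x : open U -> U x ->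
  (forall y, U y -> differentiable f y) ->
  (forall y a, U y -> partial a f y = 0) ->
  \forall y \near x, f y = f x.
Proof.
move=> oU Ux df pf.
have /nbhs_ballP [r /= r0 Hr] : nbhs x U by exact: open_nbhs_nbhs.
apply/nbhs_ballP; exists r => //= y; rewrite -ball_normE /= => xy.
have UL t : 0 <= t <= 1 -> U (x + t *: (y - x)).
  move=> /andP[t0 t1]; apply: Hr; rewrite -ball_normE /=.
  rewrite opprD addNKr normrN normrZ ger0_norm// distrC.
  by rewrite (le_lt_trans _ xy)// ler_piMl.
have [t th] := @mean_value_line f x (y - x) 1 ltr01 (fun t th => df _ (UL t th)).
have Ut : U (x + t *: (y - x)).
  by apply: UL; case/andP: th => ? ?; rewrite !ltW.
have D0 : 'D_(y - x) f (x + t *: (y - x)) = 0.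
  move: (x + t *: _) Ut => z Uz; rewrite deriveE; last exact: df.
  rewrite [y - x]row_sum_delta linear_sum big1// => a _.
  rewrite linearZ/= -deriveE; last exact: df.
  by have := pf _ a Uz; rewrite /partial => ->; rewrite scaler0.
by rewrite D0 mulr0 scale1r => /eqP; rewrite subr_eq0 [x + _]addrC subrK => /eqP.
Qed.

Lemma differentiable_components (tau : V -> V) x :
  (forall j, differentiable (fun y => tau y 0 j) x) -> differentiable tau x.
Proof.
move=> dtau; have -> : tau = \sum_j (fun y => (tau y 0 j) *: (delta_mx 0 j : V)).
  by apply/funext => y; rewrite fct_sumE -row_sum_delta.
by apply: differentiable_sum => j; apply: differentiableZl; exact: dtau.
Qed.

Lemma jacobianE (tau : V -> V) x a i :
  (forall j, differentiable (fun y => tau y 0 j) x) ->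
  'J tau x a i = partial a (fun y => tau y 0 i) x.
Proof.
move=> /differentiable_components dT.
transitivity (('D_(delta_mx 0 a) tau x) 0 i).
  by rewrite deriveEjacobian// -rowE [RHS]mxE.
by rewrite derive_mx ?[LHS]mxE//; exact: diff_derivable.
Qed.

(** The chain rule, in the form in which a change of charts uses it. *)
Lemma partial_comp (tau : V -> V) f a x :
  (forall j, differentiable (fun y => tau y 0 j) x) ->
  differentiable f (tau x) ->
  differentiable (fun y => f (tau y)) x /\
  partial a (fun y => f (tau y)) x
    = \sum_b partial a (fun y => tau y 0 b) x * partial b f (tau x).
Proof.
move=> dtau df; have dtaux := differentiable_components dtau.
split; first exact: differentiable_comp.
rewrite /partial deriveE; last exact: differentiable_comp.
rewrite diff_comp//=.
have -> : 'd tau x (delta_mx 0 a) = row a ('J tau x).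
  by rewrite -deriveE// deriveEjacobian// -rowE.
rewrite [row a _]row_sum_delta linear_sum; apply: eq_bigr => b _.
by rewrite linearZ/= mxE jacobianE// -deriveE.
Qed.

End MixedPartials.

(** * Matrix-valued functions *)

(** Square matrices of any size carry the operations of a ring; declaring them
    as one decides identities between non-commutative polynomials. *)
Section MatrixRing.
Variables (R : realType) (n : nat).
Let M := 'M[R]_n.

#[export] Instance matrix_ring_ops : @Ncring.Ring_ops M 0 1%:M
  (@GRing.add M) (@mulmx R n n n) (fun x y => x - y) (@GRing.opp M) (@eq M).
Proof. Defined.

#[export] Instance matrix_ring : @Ncring.Ring M 0 1%:M
  (@GRing.add M) (@mulmx R n n n) (fun x y => x - y) (@GRing.opp M) (@eq M)
  matrix_ring_ops.
Proof.
constructor; try (by move=> *; subst); try typeclasses eauto.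
all: try (by move=> ? ? -> ? ? ->).
- exact: add0r.
- exact: addrC.
- exact: addrA.
- exact: mul1mx.
- exact: mulmx1.
- exact: mulmxA.
- exact: mulmxDl.
- by move=> x y z; exact: mulmxDr.
- exact: addrN.
Qed.
End MatrixRing.

(* Atoms are generalized before reification, which compares them up to
   conversion. *)
Ltac generalize_atoms T t :=
  lazymatch t with
  | @GRing.add _ ?a ?b => generalize_atoms T a; generalize_atoms T b
  | @GRing.opp _ ?a => generalize_atoms T a
  | @mulmx _ _ _ _ ?a ?b => generalize_atoms T a; generalize_atoms T b
  | @GRing.zero _ => idtac
  | @scalar_mx _ _ _ => idtac
  | _ => tryif is_var t then idtac else
      (generalize t; let y := fresh "y" in intro y; change T in y)
  end.

Ltac mxring :=
  match goal with |- @eq ?U ?a ?b =>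
    let T := eval hnf in U in
    change (@eq T a b);
    generalize_atoms T a; generalize_atoms T b end;
  Ncring_tac.non_commutative_ring.

(* Unification would otherwise compare matrix entries by unfolding the
   derivatives that they contain. *)
Opaque partial.

Section MatrixCalculus.
Variable R : realType.
Local Notation V := 'rV[R]_4.
Local Notation M4 := 'M[R]_4.
Implicit Types (f g : V -> R) (F G : V -> M4) (U : set V) (x : V) (a b : 'I_4).

Definition differentiable_mx F x :=
  forall i j, differentiable (fun y => F y i j) x.

Lemma smooth_differentiable_mx U F x : smooth_on_mx U F -> U x ->
  differentiable_mx F x.
Proof. by move=> H Ux i j; apply: smooth_on_differentiable (H i j) Ux. Qed.

Lemma eq_smooth_on_mx U F G : open U -> (forall y, U y -> F y = G y) ->
  smooth_on_mx U F -> smooth_on_mx U G.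
Proof.
by move=> oU FG H i j; apply: eq_smooth_on (H i j) => // y Uy; rewrite FG.
Qed.

Lemma partial_ext f g a x : f =1 g -> partial a f x = partial a g x.
Proof. by move=> /funext ->. Qed.

Lemma partial_mxE a F x i j :
  partial_mx a F x i j = partial a (fun y => F y i j) x.
Proof. by rewrite mxE. Qed.

Lemma eq_partial_mx U F G a x : open U -> U x -> (forall y, U y -> F y = G y) ->
  partial_mx a F x = partial_mx a G x.
Proof.
move=> oU Ux FG; apply/matrixP => i j; rewrite !mxE.
by apply: eq_partial oU Ux _ => y Uy; rewrite FG.
Qed.

Lemma partial_mx_cst a x (A : M4) : partial_mx a (fun=> A) x = 0.
Proof. by apply/matrixP => i j; rewrite !mxE partial_cst. Qed.

Lemma partial_mxD F G a x : differentiable_mx F x -> differentiable_mx G x ->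
  partial_mx a (fun y => F y + G y) x = partial_mx a F x + partial_mx a G x.
Proof.
move=> dF dG; apply/matrixP => i j; rewrite !mxE -partialD//.
by apply: partial_ext => y; rewrite mxE.
Qed.

Lemma partial_mxN F a x : differentiable_mx F x ->
  partial_mx a (fun y => - F y) x = - partial_mx a F x.
Proof.
move=> dF; apply/matrixP => i j; rewrite !mxE -partialN//.
by apply: partial_ext => y; rewrite mxE.
Qed.

Lemma differentiable_mxD F G x : differentiable_mx F x -> differentiable_mx G x ->
  differentiable_mx (fun y => F y + G y) x.
Proof.
move=> dF dG i j; under eq_fun do rewrite mxE.
by apply: differentiableD.
Qed.

Lemma differentiable_mxN F x : differentiable_mx F x ->
  differentiable_mx (fun y => - F y) x.
Proof. by move=> dF i j; under eq_fun do rewrite mxE; apply: differentiableN. Qed.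

Lemma partial_mxB F G a x : differentiable_mx F x -> differentiable_mx G x ->
  partial_mx a (fun y => F y - G y) x = partial_mx a F x - partial_mx a G x.
Proof.
move=> dF dG; rewrite (partial_mxD (G := fun y => - G y)) ?partial_mxN//.
exact: differentiable_mxN.
Qed.

Lemma differentiable_mxB F G x : differentiable_mx F x -> differentiable_mx G x ->
  differentiable_mx (fun y => F y - G y) x.
Proof. by move=> dF dG; apply: differentiable_mxD => //; apply: differentiable_mxN. Qed.

Lemma mulmx_entry F G i j :
  (fun y => (F y *m G y) i j) = \sum_k (fun y => F y i k * G y k j).
Proof. by apply/funext => y; rewrite mxE fct_sumE. Qed.

Lemma differentiable_mxM F G x : differentiable_mx F x -> differentiable_mx G x ->
  differentiable_mx (fun y => F y *m G y) x.
Proof.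
move=> dF dG i j; rewrite mulmx_entry; apply: differentiable_sum => k.
exact: differentiableM.
Qed.

Lemma partial_mxM F G a x : differentiable_mx F x -> differentiable_mx G x ->
  partial_mx a (fun y => F y *m G y) x
    = partial_mx a F x *m G x + F x *m partial_mx a G x.
Proof.
move=> dF dG; apply/matrixP => i j; rewrite !mxE -big_split/=.
under [RHS]eq_bigr do rewrite !mxE -partialM//.
rewrite -partial_sum; last by move=> k; apply: differentiableM.
by apply: partial_ext => y; rewrite mxE.
Qed.

Lemma differentiable_mxZ f F x : differentiable f x -> differentiable_mx F x ->
  differentiable_mx (fun y => f y *: F y) x.
Proof. by move=> df dF i j; under eq_fun do rewrite mxE; apply: differentiableM. Qed.

Lemma partial_mxZ f F a x : differentiable f x -> differentiable_mx F x ->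
  partial_mx a (fun y => f y *: F y) x
    = partial a f x *: F x + f x *: partial_mx a F x.
Proof.
move=> df dF; apply/matrixP => i j; rewrite !mxE -partialM//.
by apply: partial_ext => y; rewrite mxE.
Qed.

Lemma partial_mx_sum (I : Type) (r : seq I) (F : I -> V -> M4) a x :
  (forall i, differentiable_mx (F i) x) ->
  partial_mx a (fun y => \sum_(i <- r) F i y) x
    = \sum_(i <- r) partial_mx a (F i) x.
Proof.
move=> dF; apply/matrixP => i j; rewrite summxE !mxE.
under [RHS]eq_bigr do rewrite mxE.
rewrite -partial_sum; last by move=> k; apply: dF.
by apply: partial_ext => y; rewrite summxE.
Qed.

Lemma partial_mx_tr F a x : partial_mx a (fun y => (F y)^T) x = (partial_mx a F x)^T.
Proof.
apply/matrixP => i j; rewrite !mxE.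
by apply: partial_ext => y; rewrite mxE.
Qed.

Lemma differentiable_mx_tr F x : differentiable_mx F x ->
  differentiable_mx (fun y => (F y)^T) x.
Proof. by move=> dF i j; under eq_fun do rewrite mxE; exact: dF. Qed.

Lemma partial_tr F a x : differentiable_mx F x ->
  partial a (fun y => \tr (F y)) x = \tr (partial_mx a F x).
Proof.
move=> dF; rewrite /mxtrace partial_sum//.
by apply: eq_bigr => i _; rewrite mxE.
Qed.

Lemma smooth_on_mx_cst U (A : M4) : smooth_on_mx U (fun=> A).
Proof. by move=> i j; exact: smooth_on_cst. Qed.

Lemma smooth_on_mxD U F G : open U -> smooth_on_mx U F -> smooth_on_mx U G ->
  smooth_on_mx U (fun y => F y + G y).
Proof. by move=> oU sF sG i j; under eq_fun do rewrite mxE; exact: smooth_onD. Qed.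

Lemma smooth_on_mxN U F : open U -> smooth_on_mx U F ->
  smooth_on_mx U (fun y => - F y).
Proof. by move=> oU sF i j; under eq_fun do rewrite mxE; exact: smooth_onN. Qed.

Lemma smooth_on_mxB U F G : open U -> smooth_on_mx U F -> smooth_on_mx U G ->
  smooth_on_mx U (fun y => F y - G y).
Proof. by move=> oU sF sG; apply: smooth_on_mxD => //; exact: smooth_on_mxN. Qed.

Lemma smooth_on_mxM m n p U (F : V -> 'M[R]_(m, n)) (G : V -> 'M[R]_(n, p)) :
  open U -> smooth_on_mx U F -> smooth_on_mx U G ->
  smooth_on_mx U (fun y => F y *m G y).
Proof.
move=> oU sF sG i j; under eq_fun do rewrite mxE.
by apply: smooth_on_sum => // k; exact: smooth_onM.
Qed.

Lemma smooth_on_mxZ U f F : open U -> smooth_on U f -> smooth_on_mx U F ->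
  smooth_on_mx U (fun y => f y *: F y).
Proof. by move=> oU sf sF i j; under eq_fun do rewrite mxE; exact: smooth_onM. Qed.

Lemma smooth_on_tr U F : open U -> smooth_on_mx U F -> smooth_on U (fun y => \tr (F y)).
Proof. by move=> oU sF; apply: smooth_on_sum => // i; exact: sF. Qed.

Lemma smooth_on_partial_mx U F a : smooth_on_mx U F -> smooth_on_mx U (partial_mx a F).
Proof. by move=> sF i j; under eq_fun do rewrite mxE; apply: smooth_on_partial. Qed.

Lemma sub_smooth_on_mx U U' F : U `<=` U' -> smooth_on_mx U' F -> smooth_on_mx U F.
Proof. by move=> UU' sF i j; apply: sub_smooth_on (sF i j). Qed.

Lemma smooth_on_det n U (F : V -> 'M[R]_n) : open U -> smooth_on_mx U F ->
  smooth_on U (fun y => \det (F y)).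
Proof.
move=> oU sF; apply: smooth_on_sum => // s; apply: smooth_onZ => //.
by apply: smooth_on_prod => // i; exact: sF.
Qed.

Lemma smooth_on_invmx U F : open U -> (forall x, U x -> F x \in unitmx) ->
  smooth_on_mx U F -> smooth_on_mx U (fun y => invmx (F y)).
Proof.
move=> oU uF sF.
apply: (@eq_smooth_on_mx U (fun y => (\det (F y))^-1 *: \adj (F y))) => //.
  by move=> y Uy; rewrite /invmx uF.
apply: smooth_on_mxZ => //.
  apply: smooth_onV => //; last exact: smooth_on_det.
  by move=> y /uF; rewrite unitmxE unitfE.
move=> i j; under eq_fun do rewrite !mxE.
apply: smooth_onZ => //; apply: smooth_on_det => // k l.
by under eq_fun do rewrite !mxE; exact: sF.
Qed.

Lemma partial_mx_comm U F a b x : open U -> U x -> smooth_on_mx U F ->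
  partial_mx a (partial_mx b F) x = partial_mx b (partial_mx a F) x.
Proof.
move=> oU Ux sF; apply/matrixP => i j.
have E c d : partial_mx c (partial_mx d F) x i j
    = partial c (partial d (fun y => F y i j)) x.
  by rewrite partial_mxE; apply: partial_ext => y; rewrite partial_mxE.
exact: etrans (E a b) (etrans (partial_comm _ _ oU Ux (sF i j)) (esym (E b a))).
Qed.

End MatrixCalculus.

(** * The Levi-Civita connection in a chart *)

Section LeviCivita.
Variable R : realType.
Local Notation V := 'rV[R]_4.
Local Notation M4 := 'M[R]_4.

Lemma positive_unitmx (G : M4) : (forall X : V, X != 0 -> 0 < bil G X X) ->
  G \in unitmx.
Proof.
move=> pos; rewrite -row_free_unit -kermx_eq0; apply/rowV0P => X /sub_kermxP XG.
by apply/eqP; apply: contraT => /pos; rewrite /bil XG mul0mx mxE ltxx.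
Qed.

Lemma mulmx_ijE (A B : M4) i j : (A *m B) i j = \sum_k A i k * B k j.
Proof. by rewrite mxE. Qed.

Lemma mulmx_deltaE (A : M4) (b c i j : 'I_4) : (A *m delta_mx b c) i j = A i b * (j == c)%:R.
Proof.
rewrite mxE (bigD1 b)//= big1 => [|k /negPf kb].
  by rewrite mxE eqxx addr0.
by rewrite mxE kb mulr0.
Qed.

Lemma delta_mulmx_ijE (A : M4) (b c i j : 'I_4) : (delta_mx b c *m A) i j = (i == b)%:R * A c j.
Proof.
rewrite mxE (bigD1 c)//= big1 => [|k /negPf kc].
  by rewrite mxE eqxx andbT addr0.
by rewrite mxE kc andbF mul0r.
Qed.

Variables (U : set V) (g : V -> M4).
Hypotheses (oU : open U) (sg : smooth_on_mx U g).
Hypothesis gT : forall x, U x -> (g x)^T = g x.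
Hypothesis gu : forall x, U x -> g x \in unitmx.
Implicit Types (x : V) (A : V -> M4) (i k l m : 'I_4).

Let S x k : M4 := \matrix_(i, l) (2^-1 * (partial k (fun y => g y i l) x
                           + partial i (fun y => g y k l) x
                           - partial l (fun y => g y k i) x)).

Lemma christoffel_metric0 x k : U x -> christoffel g x k *m g x = S x k.
Proof. by move=> Ux; rewrite /christoffel mulmxKV ?gu. Qed.

Lemma partial_metricC x k i l : U x ->
  partial k (fun y => g y i l) x = partial k (fun y => g y l i) x.
Proof.
move=> Ux; apply: (eq_partial _ oU Ux) => y Uy.
by rewrite -{1}(gT Uy) mxE.
Qed.

Lemma christoffel_metric x k : U x ->
  partial_mx k g x = christoffel g x k *m g x + g x *m (christoffel g x k)^T.
Proof.
move=> Ux; rewrite -{2}(gT Ux) -trmx_mul christoffel_metric0//.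
apply/matrixP => i l; rewrite partial_mxE !mxE.
rewrite (partial_metricC k l i Ux) (partial_metricC i k l Ux).
by rewrite (partial_metricC l k i Ux); field.
Qed.

Lemma christoffelC x i k l : U x -> christoffel g x k i l = christoffel g x i k l.
Proof.
move=> Ux; rewrite /christoffel !mxE; apply: eq_bigr => j _; congr (_ * _).
by rewrite !mxE (partial_metricC j k i Ux) (addrC (partial k _ _)).
Qed.

(** Koszul's argument: the three cyclic permutations of metric compatibility,
    with the symmetry of the symbols, leave a single term. *)
Lemma christoffel_unique x (C : 'I_4 -> M4) : U x ->
  (forall k, partial_mx k g x = C k *m g x + g x *m (C k)^T) ->
  (forall i k l, C k i l = C i k l) -> forall k, christoffel g x k = C k.
Proof.
move=> Ux Cg Cs k; apply: (can_inj (mulmxK (gu Ux))).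
rewrite christoffel_metric0//.
have CC a b c : (C a *m g x) b c = (C b *m g x) a c.
  by rewrite !mxE; apply: eq_bigr => j _; rewrite Cs.
have E a b c : partial a (fun y => g y b c) x = (C a *m g x) b c + (C a *m g x) c b.
  by rewrite -partial_mxE Cg -{2}(gT Ux) -trmx_mul !mxE.
apply/matrixP => i l; rewrite [LHS]mxE !E.
by rewrite (CC i k l) (CC l k i) (CC l i k) (CC i l k); field.
Qed.

Lemma smooth_christoffel k : smooth_on_mx U (fun y => christoffel g y k).
Proof.
apply: smooth_on_mxM => //; last exact: smooth_on_invmx.
move=> i l; under eq_fun do rewrite mxE.
apply: smooth_onZ => //; apply: smooth_onD => //.
  by apply: smooth_onD => //; apply: smooth_on_partial; exact: sg.
by apply: smooth_onN => //; apply: smooth_on_partial; exact: sg.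
Qed.

End LeviCivita.

(** * Torsion-free metric connections *)

Section Connection.
Variable R : realType.
Local Notation V := 'rV[R]_4.
Local Notation M4 := 'M[R]_4.

(** Covariant derivative of an endomorphism field along a coordinate vector.
    Applied to endomorphism-valued forms it is the exterior covariant
    derivative before skew-symmetrization: for a torsion-free connection the
    form indices need no correction. *)
Definition covd (Gam : V -> 'I_4 -> M4) (k : 'I_4) (A : V -> M4) (x : V) : M4 :=
  partial_mx k A x + A x *m Gam x k - Gam x k *m A x.

(** [curv_endo] for arbitrary symbols: the identities below only need a
    symmetric connection that is compatible with g, and leaving the symbols
    abstract keeps their formula out of the computations. *)
Definition curvature (Gam : V -> 'I_4 -> M4) (x : V) (k l : 'I_4) : M4 :=
  partial_mx l (Gam ^~ k) x - partial_mx k (Gam ^~ l) x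
  + Gam x k *m Gam x l - Gam x l *m Gam x k.

(** The curvature endomorphism of a metric of constant curvature 1 *)
Definition wedge_endo (G : M4) (k l : 'I_4) : M4 :=
  G *m (delta_mx k l - delta_mx l k).

Variables (U : set V) (g : V -> M4) (Gam : V -> 'I_4 -> M4).
Hypotheses (oU : open U) (sg : smooth_on_mx U g).
Hypothesis smooth_Gam : forall k, smooth_on_mx U (Gam ^~ k).
Hypothesis Gam_metric : forall x k, U x ->
  partial_mx k g x = Gam x k *m g x + g x *m (Gam x k)^T.
Hypothesis GamC : forall x i k l, U x -> Gam x k i l = Gam x i k l.
Implicit Types (x : V) (A : V -> M4) (i k l m : 'I_4).

Let dGam k x (Ux : U x) := smooth_differentiable_mx (smooth_Gam k) Ux.

Lemma smooth_covd k A : smooth_on_mx U A -> smooth_on_mx U (covd Gam k A).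
Proof.
move=> sA; apply: smooth_on_mxB => //.
  apply: smooth_on_mxD => //; first exact: smooth_on_partial_mx.
  by apply: smooth_on_mxM => //; exact: smooth_Gam.
by apply: smooth_on_mxM => //; exact: smooth_Gam.
Qed.

Lemma eq_covd k A A' x : U x -> (forall y, U y -> A y = A' y) ->
  covd Gam k A x = covd Gam k A' x.
Proof. by move=> Ux AA'; rewrite /covd (eq_partial_mx _ oU Ux AA') AA'. Qed.

Lemma covdD k A A' x : differentiable_mx A x -> differentiable_mx A' x ->
  covd Gam k (fun y => A y + A' y) x = covd Gam k A x + covd Gam k A' x.
Proof. by move=> dA dA'; rewrite /covd partial_mxD//; mxring. Qed.

Lemma covdB k A A' x : differentiable_mx A x -> differentiable_mx A' x ->
  covd Gam k (fun y => A y - A' y) x = covd Gam k A x - covd Gam k A' x.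
Proof. by move=> dA dA'; rewrite /covd partial_mxB//; mxring. Qed.

Lemma covdM k A A' x : differentiable_mx A x -> differentiable_mx A' x ->
  covd Gam k (fun y => A y *m A' y) x
    = covd Gam k A x *m A' x + A x *m covd Gam k A' x.
Proof. by move=> dA dA'; rewrite /covd partial_mxM//; mxring. Qed.

Lemma covdZ k (f : V -> R) A x : differentiable f x -> differentiable_mx A x ->
  covd Gam k (fun y => f y *: A y) x = partial k f x *: A x + f x *: covd Gam k A x.
Proof.
move=> df dA; rewrite /covd partial_mxZ// !scalerBr !scalerDr.
by rewrite -!scalemxAl -!scalemxAr !addrA.
Qed.

Lemma covd_sumZ k (f : 'I_4 -> V -> R) (A : 'I_4 -> V -> M4) x :
  (forall a, differentiable (f a) x) -> (forall a, differentiable_mx (A a) x) ->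
  covd Gam k (fun y => \sum_a f a y *: A a y) x
    = \sum_a (partial k (f a) x *: A a x + f a x *: covd Gam k (A a) x).
Proof.
move=> df dA.
under [RHS]eq_bigr => a _ do rewrite -(covdZ k (df a) (dA a)).
rewrite {1}/covd partial_mx_sum => [|a]; last exact: differentiable_mxZ.
by rewrite mulmx_suml mulmx_sumr -sumrN -!big_split.
Qed.

Lemma covd_cst_scalar k (c : R) x : covd Gam k (fun=> c%:M) x = 0.
Proof. by rewrite /covd partial_mx_cst add0r mul_scalar_mx mul_mx_scalar subrr. Qed.

(** The connection enters through a commutator, which has no trace. *)
Lemma partial_trE k A x : differentiable_mx A x ->
  partial k (fun y => \tr (A y)) x = \tr (covd Gam k A x).
Proof.
move=> dA; rewrite partial_tr// /covd raddfB raddfD/=.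
by rewrite (mxtrace_mulC (A x)) addrK.
Qed.

Lemma smooth_curvature k l : smooth_on_mx U (fun y => curvature Gam y k l).
Proof.
have sG j := smooth_Gam j.
apply: smooth_on_mxB => //; last exact: smooth_on_mxM.
apply: smooth_on_mxD => //; last exact: smooth_on_mxM.
by apply: smooth_on_mxB => //; apply: smooth_on_partial_mx.
Qed.

Lemma curvatureN x k l : curvature Gam x k l = - curvature Gam x l k.
Proof. by rewrite /curvature; mxring. Qed.

(** Ricci identity: the second partial derivatives of A commute, and the terms
    that remain make up the curvature. *)
Lemma covd_comm k l A x : U x -> smooth_on_mx U A ->
  covd Gam k (covd Gam l A) x - covd Gam l (covd Gam k A) x
    = curvature Gam x k l *m A x - A x *m curvature Gam x k l.
Proof.
move=> Ux sA.
have dA := smooth_differentiable_mx sA Ux.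
have dpA j := smooth_differentiable_mx (smooth_on_partial_mx j sA) Ux.
have dG j := @dGam j x Ux.
have dAG j := differentiable_mxM dA (dG j).
have dGA j := differentiable_mxM (dG j) dA.
have E j j' : partial_mx j (covd Gam j' A) x =
  partial_mx j (partial_mx j' A) x
  + (partial_mx j A x *m Gam x j' + A x *m partial_mx j (Gam ^~ j') x)
  - (partial_mx j (Gam ^~ j') x *m A x + Gam x j' *m partial_mx j A x).
  rewrite /covd partial_mxB//; last exact: differentiable_mxD.
  by rewrite partial_mxD// (partial_mxM j dA (dG j')) (partial_mxM j (dG j') dA).
rewrite [covd Gam k _ x]/covd [covd Gam l (covd Gam k A) x]/covd !E.
rewrite (partial_mx_comm l k oU Ux sA) /covd /curvature.
by mxring.
Qed.

(** The symmetry of the symbols and of their derivatives cancels the cyclic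
    sum in pairs. *)
Lemma curvature_bianchi1 x k l m p : U x ->
  curvature Gam x k l m p + curvature Gam x l m k p + curvature Gam x m k l p = 0.
Proof.
move=> Ux.
have dC a b c d : partial a (fun y => Gam y b c d) x
    = partial a (fun y => Gam y c b d) x.
  by apply: (eq_partial _ oU Ux) => y Uy; exact: GamC.
have mC a b c d : (Gam x a *m Gam x b) c d
    = (Gam x c *m Gam x b) a d.
  apply: etrans (mulmx_ijE _ _ _ _) (etrans _ (esym (mulmx_ijE _ _ _ _))).
  by apply: eq_bigr => j _; rewrite (GamC c a j Ux).
have E a b c d : curvature Gam x a b c d =
  partial b (fun y => Gam y a c d) x
  - partial a (fun y => Gam y b c d) x
  + (Gam x a *m Gam x b) c d
  - (Gam x b *m Gam x a) c d.
  have e4 (A B C D : M4) (r s : R) : A c d = r -> B c d = s ->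
      (A - B + C - D) c d = r - s + C c d - D c d.
    by move=> <- <-; rewrite !mxE.
  exact: e4 (partial_mxE _ _ _ _ _) (partial_mxE _ _ _ _ _).
rewrite !E (dC l k m p) (dC m l k p) (dC k m l p).
by rewrite (mC k l m p) (mC l m k p) (mC m k l p); ring.
Qed.

(** The second partial derivatives of g commute; each is expanded twice by
    metric compatibility. *)
Lemma curvature_skew x k l : U x ->
  curvature Gam x k l *m g x + g x *m (curvature Gam x k l)^T = 0.
Proof.
move=> Ux.
have dG j := @dGam j x Ux.
have dg := smooth_differentiable_mx sg Ux.
have E j j' : partial_mx j (partial_mx j' g) x =
    partial_mx j (Gam ^~ j') x *m g x
    + Gam x j' *m (Gam x j *m g x + g x *m (Gam x j)^T)
    + ((Gam x j *m g x + g x *m (Gam x j)^T) *m (Gam x j')^T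
       + g x *m (partial_mx j (Gam ^~ j') x)^T).
  rewrite -Gam_metric//.
  rewrite (eq_partial_mx j oU Ux (G := fun y => Gam y j' *m g y
     + g y *m (Gam y j')^T)); last by move=> y Uy; exact: Gam_metric.
  have dGt := differentiable_mx_tr (dG j').
  rewrite partial_mxD; [|exact: differentiable_mxM..].
  by rewrite (partial_mxM j (dG j') dg) (partial_mxM j dg dGt) partial_mx_tr.
have := partial_mx_comm k l oU Ux sg.
rewrite !E => /eqP; rewrite -subr_eq0 => /eqP H.
rewrite -[RHS]oppr0 -[X in - X]H /curvature.
have tr4 (A B C D : M4) : (A - B + C *m D - D *m C)^T
    = A^T - B^T + D^T *m C^T - C^T *m D^T.
  by rewrite !(linearD, linearN)/= !trmx_mul.
rewrite tr4; move: (partial_mx _ _ _)^T (partial_mx _ _ _)^T => T1 T2.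
by mxring.
Qed.

(** The second partial derivatives of the symbols cancel by symmetry, and the
    cubic terms by associativity. *)
Lemma curvature_bianchi2 x k l m : U x ->
  covd Gam m (fun y => curvature Gam y k l) x + covd Gam k (fun y => curvature Gam y l m) x
    + covd Gam l (fun y => curvature Gam y m k) x = 0.
Proof.
move=> Ux.
have sG j := smooth_Gam j.
have dG j := @dGam j x Ux.
have dpG j j' := smooth_differentiable_mx (smooth_on_partial_mx j (sG j')) Ux.
have E a b c : partial_mx a (fun y => curvature Gam y b c) x =
  partial_mx a (partial_mx c (Gam ^~ b)) x
  - partial_mx a (partial_mx b (Gam ^~ c)) x
  + (partial_mx a (Gam ^~ b) x *m Gam x c
     + Gam x b *m partial_mx a (Gam ^~ c) x)
  - (partial_mx a (Gam ^~ c) x *m Gam x b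
     + Gam x c *m partial_mx a (Gam ^~ b) x).
  have dGG j j' := differentiable_mxM (dG j) (dG j').
  have dd := differentiable_mxB (dpG c b) (dpG b c).
  rewrite /curvature partial_mxB//; last exact: differentiable_mxD.
  by rewrite partial_mxD// partial_mxB// (partial_mxM a (dG b) (dG c))
    (partial_mxM a (dG c) (dG b)).
rewrite /covd !E.
rewrite (partial_mx_comm m k oU Ux (sG l)) (partial_mx_comm m l oU Ux (sG k)).
rewrite (partial_mx_comm k l oU Ux (sG m)) /curvature.
by mxring.
Qed.

(** The identity 2-form with values in endomorphisms is covariantly closed,
    because the connection has no torsion. *)
Lemma covd_wedge_endo x k l m : U x ->
  covd Gam m (fun y => wedge_endo (g y) k l) x + covd Gam k (fun y => wedge_endo (g y) l m) x
    + covd Gam l (fun y => wedge_endo (g y) m k) x = 0.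
Proof.
move=> Ux.
have E a b c : covd Gam a (fun y => wedge_endo (g y) b c) x =
   g x *m ((Gam x a)^T *m (delta_mx b c - delta_mx c b)
           + (delta_mx b c - delta_mx c b) *m Gam x a).
  rewrite /covd /wedge_endo partial_mxM; first last.
  - by move=> i j; exact: differentiable_cst.
  - exact: smooth_differentiable_mx sg Ux.
  by rewrite partial_mx_cst Gam_metric//; mxring.
rewrite !E -!mulmxDr; set T := (X in _ *m X); suff -> : T = 0 by rewrite mulmx0.
have E2 a b c i j : ((Gam x a)^T *m (delta_mx b c - delta_mx c b)
   + (delta_mx b c - delta_mx c b) *m Gam x a) i j =
   Gam x a b i * (j == c)%:R - Gam x a c i * (j == b)%:R
   + (i == b)%:R * Gam x a c j - (i == c)%:R * Gam x a b j.
  have e4 (A B C D : M4) : (A - B + (C - D)) i j = A i j - B i j + C i j - D i j.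
    by rewrite !mxE addrA.
  by rewrite mulmxBr mulmxBl e4 !mulmx_deltaE !delta_mulmx_ijE ![(_^T) _ _]mxE.
apply/matrixP => i j; rewrite [RHS]mxE /T mxE [X in X + _]mxE !E2.
rewrite (GamC k l i Ux) (GamC l m i Ux) (GamC m k i Ux).
rewrite (GamC k l j Ux) (GamC l m j Ux) (GamC m k j Ux).
by ring.
Qed.

End Connection.

(** * Second covariant derivatives *)

Lemma cyclic_sum_aux (R : realType) (p1 p2 p3 a1 a2 a3 b1 b2 b3 c1 c2 c3 : R) :
  p1 + p2 + p3 = 0 -> a3 + b2 + c1 = 0 -> b3 + c2 + a1 = 0 -> c3 + a2 + b1 = 0 ->
  p1 - a1 - a2 - a3 + (p2 - b1 - b2 - b3) + (p3 - c1 - c2 - c3) = 0.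
Proof. by lra. Qed.

Section Hessian.
Variable R : realType.
Local Notation V := 'rV[R]_4.
Local Notation M4 := 'M[R]_4.

(** Full second covariant derivative, including the correction for the
    direction of the first derivative. *)
Definition hessian (Gam : V -> 'I_4 -> M4) (A : V -> M4) (x : V) (m k : 'I_4) : M4 :=
  covd Gam m (covd Gam k A) x - \sum_a Gam x m k a *: covd Gam a A x.

Lemma skew_entry (w : M4) b c : w + w^T = 0 -> w b c = - w c b.
Proof.
by move=> /matrixP/(_ b c); rewrite !mxE => /eqP; rewrite addr_eq0 => /eqP.
Qed.

Variables (U : set V) (g : V -> M4) (Gam : V -> 'I_4 -> M4).
Hypotheses (oU : open U) (sg : smooth_on_mx U g).
Hypothesis smooth_Gam : forall k, smooth_on_mx U (Gam ^~ k).
Hypothesis Gam_metric : forall x k, U x ->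
  partial_mx k g x = Gam x k *m g x + g x *m (Gam x k)^T.
Hypothesis GamC : forall x i k l, U x -> Gam x k i l = Gam x i k l.
Implicit Types (x : V) (A : V -> M4) (i k l m : 'I_4).

Let dG k x (Ux : U x) := smooth_differentiable_mx (smooth_Gam k) Ux.
Let dg x (Ux : U x) := smooth_differentiable_mx sg Ux.

Lemma partial_lower k A x : U x -> smooth_on_mx U A ->
  partial_mx k (fun y => A y *m g y) x =
  covd Gam k A x *m g x + Gam x k *m (A x *m g x) + A x *m g x *m (Gam x k)^T.
Proof.
move=> Ux sA; rewrite (partial_mxM k (smooth_differentiable_mx sA Ux) (dg Ux)).
by rewrite Gam_metric// /covd; mxring.
Qed.

Lemma covd_skew k A x : U x -> smooth_on_mx U A ->
  (forall y, U y -> A y *m g y + (A y *m g y)^T = 0) ->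
  covd Gam k A x *m g x + (covd Gam k A x *m g x)^T = 0.
Proof.
move=> Ux sA skA.
have sAg : smooth_on_mx U (fun y => A y *m g y) by exact: smooth_on_mxM.
have dAg := smooth_differentiable_mx sAg Ux.
have E : covd Gam k A x *m g x = partial_mx k (fun y => A y *m g y) x
    - Gam x k *m (A x *m g x) - A x *m g x *m (Gam x k)^T.
  by rewrite partial_lower//; mxring.
have N : (A x *m g x)^T = - (A x *m g x).
  by apply/eqP; rewrite -addr_eq0 addrC skA.
have PN : (partial_mx k (fun y => A y *m g y) x)^T
    = - partial_mx k (fun y => A y *m g y) x.
  rewrite -partial_mx_tr -(partial_mxN k dAg); apply: (eq_partial_mx k oU Ux) => y Uy.
  by apply/eqP; rewrite -addr_eq0 addrC skA.
rewrite E !raddfB/= PN (trmx_mul (Gam x k)) (trmx_mul _ (Gam x k)^T) N trmxK.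
by mxring.
Qed.

(** The symmetric symbols cancel in the cyclic sum of the derivatives of a
    2-form, so that the exterior derivative needs no correction. *)
Lemma closed_covd A x i j k : U x -> smooth_on_mx U A ->
  (A x *m g x + (A x *m g x)^T = 0) ->
  partial i (fun y => (A y *m g y) j k) x + partial j (fun y => (A y *m g y) k i) x
    + partial k (fun y => (A y *m g y) i j) x
  = (covd Gam i A x *m g x) j k + (covd Gam j A x *m g x) k i
    + (covd Gam k A x *m g x) i j.
Proof.
move=> Ux sA skA.
set w := A x *m g x in skA *.
have wN b c : w b c = - w c b.
  exact: skew_entry.
have E a b c : partial a (fun y => (A y *m g y) b c) x =
  (covd Gam a A x *m g x) b c + (\sum_d Gam x a b d * w d c)
   + (\sum_d w b d * Gam x a c d).
  have e3 (X Y Z : M4) (r s : R) : Y b c = r -> Z b c = s ->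
      (X + Y + Z) b c = X b c + r + s by move=> <- <-; rewrite !mxE.
  rewrite -(partial_mxE a (fun y => A y *m g y)) partial_lower//; apply: e3.
    exact: mulmx_ijE.
  by apply: etrans (mulmx_ijE _ _ _ _) _; apply: eq_bigr => d _; congr (_ * _); rewrite mxE.
rewrite !E.
have S1 a b c : \sum_d w c d * Gam x a b d = - \sum_d Gam x a b d * w d c.
  by rewrite -sumrN; apply: eq_bigr => d _; rewrite wN mulNr mulrC.
have S2 a b c : \sum_d Gam x a b d * w d c = \sum_d Gam x b a d * w d c.
  by apply: eq_bigr => d _; rewrite (GamC b a d Ux).
rewrite !S1 (S2 j i) (S2 k j) (S2 k i).
by ring.
Qed.

Section SecondOrder.
Variable J : V -> M4.
Hypothesis sJ : smooth_on_mx U J.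
Let P k := covd Gam k J.
Let sP k : smooth_on_mx U (P k). Proof. exact: smooth_covd. Qed.
Let dJ x (Ux : U x) := smooth_differentiable_mx sJ Ux.
Let dP k x (Ux : U x) := smooth_differentiable_mx (sP k) Ux.

Lemma hessian_comm k l x : U x ->
  hessian Gam J x k l - hessian Gam J x l k
    = curvature Gam x k l *m J x - J x *m curvature Gam x k l.
Proof.
move=> Ux; rewrite -(covd_comm oU smooth_Gam k l Ux sJ) /hessian.
have -> : \sum_a Gam x l k a *: covd Gam a J x = \sum_a Gam x k l a *: covd Gam a J x.
  by apply: eq_bigr => a _; rewrite (GamC k l a Ux).
by mxring.
Qed.

Lemma hessian_skew m k x : U x ->
  (forall y, U y -> J y *m g y + (J y *m g y)^T = 0) ->
  hessian Gam J x m k *m g x + (hessian Gam J x m k *m g x)^T = 0.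
Proof.
move=> Ux skJ.
have skP a y : U y -> P a y *m g y + (P a y *m g y)^T = 0.
  by move=> Uy; exact: covd_skew.
have H := covd_skew m Ux (sP k) (skP k).
have H2 : (\sum_a Gam x m k a *: covd Gam a J x) *m g x
   + ((\sum_a Gam x m k a *: covd Gam a J x) *m g x)^T = 0.
  rewrite mulmx_suml raddf_sum -big_split big1//= => a _.
  by rewrite -scalemxAl linearZ/= -scalerDr skP// scaler0.
rewrite /hessian mulmxBl raddfB/= addrACA -opprD H2 oppr0 addr0.
exact: H.
Qed.

Lemma hessian_anticomm m k x : U x -> (forall y, U y -> J y *m J y = - 1%:M) ->
  hessian Gam J x m k *m J x + J x *m hessian Gam J x m k
    + P k x *m P m x + P m x *m P k x = 0.
Proof.
move=> Ux JJ.
have acP a y : U y -> P a y *m J y + J y *m P a y = 0.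
  move=> Uy; rewrite -(covdM Gam a (dJ Uy) (dJ Uy)).
  rewrite (eq_covd Gam oU a Uy (A' := fun=> (- 1)%:M)) ?covd_cst_scalar// => z Uz.
  by rewrite JJ// raddfN.
have H : covd Gam m (fun y => P k y *m J y + J y *m P k y) x = 0.
  rewrite (eq_covd Gam oU m Ux (A' := fun=> 0%:M)) ?covd_cst_scalar// => z Uz.
  by rewrite acP// raddf0.
move: H; rewrite covdD; first last.
- exact: differentiable_mxM (dJ Ux) (dP k Ux).
- exact: differentiable_mxM (dP k Ux) (dJ Ux).
rewrite (covdM Gam m (dP k Ux) (dJ Ux)) (covdM Gam m (dJ Ux) (dP k Ux)).
rewrite -/(P m x) => H.
have H2 : (\sum_a Gam x m k a *: covd Gam a J x) *m J x
   + J x *m (\sum_a Gam x m k a *: covd Gam a J x) = 0.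
  rewrite mulmx_suml mulmx_sumr -big_split big1//= => a _.
  by rewrite -scalemxAl -scalemxAr -scalerDr acP// scaler0.
rewrite -[RHS](subrr 0) -[X in _ = X - _]H -[X in _ = _ - X]H2 /hessian /P.
by mxring.
Qed.

Lemma hessian_closed m i j k x : U x ->
  (forall y, U y -> forall i j k, (P i y *m g y) j k + (P j y *m g y) k i
    + (P k y *m g y) i j = 0) ->
  (hessian Gam J x m i *m g x) j k + (hessian Gam J x m j *m g x) k i
    + (hessian Gam J x m k *m g x) i j = 0.
Proof.
move=> Ux clP.
pose w a := P a x *m g x.
have E a b c : (hessian Gam J x m a *m g x) b c =
   partial m (fun y => (P a y *m g y) b c) x
   - (\sum_d Gam x m b d * w a d c) - (\sum_d Gam x m c d * w a b d)
   - \sum_d Gam x m a d * w d b c.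
  have e5 (H S Y Z : M4) (r s t : R) : Y b c = r -> Z b c = s -> S b c = t ->
    (H - S) b c = (H + Y + Z) b c - r - s - t.
    by move=> <- <- <-; rewrite !mxE; ring.
  rewrite /hessian mulmxBl -(partial_mxE m (fun y => P a y *m g y)).
  rewrite (partial_lower m Ux (sP a)); apply: e5.
  - exact: mulmx_ijE.
  - apply: etrans (mulmx_ijE _ _ _ _) _.
    by apply: eq_bigr => d _; rewrite mulrC; congr (_ * _); rewrite mxE.
  - rewrite mulmx_suml summxE; apply: eq_bigr => d _.
    by rewrite -scalemxAl mxE.
rewrite (E i j k) (E j k i) (E k i j).
have D : partial m (fun y => (P i y *m g y) j k) x
    + partial m (fun y => (P j y *m g y) k i) x
    + partial m (fun y => (P k y *m g y) i j) x = 0.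
  have dPg a b c : differentiable (fun y => (P a y *m g y) b c) x.
    exact: differentiable_mxM (dP a Ux) (dg Ux) b c.
  rewrite -partialD// -partialD//; last exact: differentiableD.
  rewrite -[RHS](partial_cst 0 m x).
  by apply: (eq_partial _ oU Ux) => y Uy; exact: clP.
have C (r : 'I_4) b c : \sum_d Gam x m r d * w d b c + \sum_d Gam x m r d * w b c d
    + \sum_d Gam x m r d * w c d b = 0.
  rewrite -!big_split big1//= => d _.
  by rewrite -!mulrDr /w clP// mulr0.
exact: cyclic_sum_aux D (C i j k) (C j k i) (C k i j).
Qed.

End SecondOrder.
End Hessian.

(** * Linear algebra in an adapted frame *)

Section AdaptedFrame.
Variable R : realType.
Local Notation M4 := 'M[R]_4.

Definition i0 : 'I_4 := @Ordinal 4 0 isT.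
Definition i1 : 'I_4 := @Ordinal 4 1 isT.
Definition i2 : 'I_4 := @Ordinal 4 2 isT.
Definition i3 : 'I_4 := @Ordinal 4 3 isT.

Lemma ord4P (Q : 'I_4 -> Prop) : Q i0 -> Q i1 -> Q i2 -> Q i3 -> forall i, Q i.
Proof.
move=> q0 q1 q2 q3 [[|[|[|[|//]]]] Hi]; [set a := i0 in q0|set a := i1 in q1
  |set a := i2 in q2|set a := i3 in q3];
  (suff -> : Ordinal Hi = a by []); exact: val_inj.
Qed.

Lemma sum4E (L : nmodType) (F : 'I_4 -> L) :
  \sum_i F i = F i0 + F i1 + F i2 + F i3.
Proof.
rewrite !big_ord_recl big_ord0 addr0 !addrA.
by do 3?[congr (_ + _)]; congr F; apply: val_inj.
Qed.

Lemma mulmx4E (A B : M4) i j : (A *m B) i j =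
  A i i0 * B i0 j + A i i1 * B i1 j + A i i2 * B i2 j + A i i3 * B i3 j.
Proof. by rewrite mxE sum4E. Qed.

Lemma mxtrace4E (A : M4) : \tr A = A i0 i0 + A i1 i1 + A i2 i2 + A i3 i3.
Proof. by rewrite /mxtrace sum4E. Qed.

Lemma matrix4P (A B : M4) :
  (A i0 i0 = B i0 i0 /\ A i0 i1 = B i0 i1 /\ A i0 i2 = B i0 i2 /\ A i0 i3 = B i0 i3) ->
  (A i1 i0 = B i1 i0 /\ A i1 i1 = B i1 i1 /\ A i1 i2 = B i1 i2 /\ A i1 i3 = B i1 i3) ->
  (A i2 i0 = B i2 i0 /\ A i2 i1 = B i2 i1 /\ A i2 i2 = B i2 i2 /\ A i2 i3 = B i2 i3) ->
  (A i3 i0 = B i3 i0 /\ A i3 i1 = B i3 i1 /\ A i3 i2 = B i3 i2 /\ A i3 i3 = B i3 i3) ->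
  A = B.
Proof.
by move=> [? [? [? ?]]] [? [? [? ?]]] [? [? [? ?]]] [? [? [? ?]]];
  apply/matrixP; apply: ord4P; apply: ord4P.
Qed.

Definition wedge (i j : 'I_4) : M4 := delta_mx i j - delta_mx j i.

(** The standard complex structure, and two anti-commuting self-dual
    structures spanning with it the imaginary quaternions. *)
Definition J0 : M4 := wedge i0 i1 + wedge i2 i3.
Definition phi0 : M4 := wedge i0 i2 - wedge i1 i3.
Definition psi0 : M4 := - (wedge i0 i3 + wedge i1 i2).

Lemma wedgeE i j k l : wedge i j k l =
  ((k == i) && (l == j))%:R - ((k == j) && (l == i))%:R.
Proof. by rewrite !mxE. Qed.

Lemma J0E k l : J0 k l = wedge i0 i1 k l + wedge i2 i3 k l.
Proof. by rewrite mxE. Qed.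
Lemma phi0E k l : phi0 k l = wedge i0 i2 k l - wedge i1 i3 k l.
Proof. by rewrite [LHS]mxE [X in _ + X]mxE. Qed.
Lemma psi0E k l : psi0 k l = - (wedge i0 i3 k l + wedge i1 i2 k l).
Proof. by rewrite [LHS]mxE [X in - X]mxE. Qed.

Lemma mulJ0E (A : M4) i :
  ((A *m J0) i i0 = - A i i1) * ((A *m J0) i i1 = A i i0) *
  ((A *m J0) i i2 = - A i i3) * ((A *m J0) i i3 = A i i2).
Proof. by do ![split]; rewrite mulmx4E !J0E !wedgeE /=; ring. Qed.

Lemma J0mulE (A : M4) i :
  ((J0 *m A) i0 i = A i1 i) * ((J0 *m A) i1 i = - A i0 i) *
  ((J0 *m A) i2 i = A i3 i) * ((J0 *m A) i3 i = - A i2 i).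
Proof. by do ![split]; rewrite mulmx4E !J0E !wedgeE /=; ring. Qed.

Lemma J0_sqr : J0 *m J0 = - 1%:M.
Proof.
by apply: matrix4P; rewrite !mulJ0E !J0E !wedgeE !mxE /=; do ![split]; ring.
Qed.

Lemma skew_anticomm_entries (X : M4) (s : R) : X + X^T = 0 ->
  X *m J0 + J0 *m X = (- (2 * s))%:M ->
  [/\ X i0 i1 = s, X i2 i3 = s, X i1 i3 = - X i0 i2 & X i1 i2 = X i0 i3].
Proof.
move=> sk ac.
have S i j : X i j = - X j i by exact: skew_entry.
have E i j : (X *m J0) i j + (J0 *m X) i j = (i == j)%:R * - (2 * s).
  transitivity ((X *m J0 + J0 *m X) i j); first by rewrite [RHS]mxE.
  by rewrite ac mxE [RHS]mulr_natl.
have := (E i0 i0, E i2 i2, E i0 i3, E i0 i2).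
rewrite !mulJ0E !J0mulE /= (S i1 i0) (S i3 i2).
by move=> [] [] [] h1 h2 h3 h4; split; lra.
Qed.

Definition std_comm i j : M4 := wedge i j *m J0 - J0 *m wedge i j.

End AdaptedFrame.

Section HessianInFrame.
Variable R : realType.
Local Notation M4 := 'M[R]_4.
Local Notation J0 := (J0 R).
Local Notation phi0 := (phi0 R).
Local Notation psi0 := (psi0 R).

Lemma phi0_sqr : phi0 *m phi0 = - 1%:M.
Proof.
by apply: matrix4P; do ![split]; rewrite mulmx4E !phi0E !wedgeE !mxE /=; ring.
Qed.

Lemma J0_phi0 : J0 *m phi0 = psi0.
Proof.
by apply: matrix4P; do ![split]; rewrite J0mulE phi0E psi0E !wedgeE /=; ring.
Qed.

Lemma phi0_J0 : phi0 *m J0 = - psi0.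
Proof.
by apply: matrix4P; do ![split]; rewrite mulJ0E [RHS]mxE phi0E psi0E !wedgeE /=; ring.
Qed.

Lemma psi0_sqr : psi0 *m psi0 = - 1%:M.
Proof.
by rewrite -{1}J0_phi0 -[psi0]opprK -phi0_J0 mulmxN mulmxA -(mulmxA J0)
  phi0_sqr mulmxN mulmx1 mulNmx opprK J0_sqr.
Qed.

Lemma phi0_psi0 : phi0 *m psi0 + psi0 *m phi0 = 0.
Proof.
rewrite -{1}J0_phi0 -[X in _ + X *m _]opprK -phi0_J0 mulmxA mulNmx.
by rewrite subrr.
Qed.

(** P and Q are the first and second covariant derivatives of J in an
    orthonormal frame whose last two vectors span the nullity. The conditions
    on Q are the derivatives of J^2 = -1 and of d Omega = 0, and the Ricci
    identity for J. *)
Variables (p mu : R) (P : 'I_4 -> M4) (Q : 'I_4 -> 'I_4 -> M4).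
Hypotheses (P0 : P i0 = p *: phi0) (P1 : P i1 = p *: psi0).
Hypotheses (P2 : P i2 = 0) (P3 : P i3 = 0).
Hypothesis Qskew : forall m k, Q m k + (Q m k)^T = 0.
Hypothesis Qanti : forall m k,
  Q m k *m J0 + J0 *m Q m k + P k *m P m + P m *m P k = 0.
Hypothesis Qclosed : forall m i j k, Q m i j k + Q m j k i + Q m k i j = 0.
Hypothesis Qcomm : forall k l, Q k l - Q l k = mu *: std_comm R k l.

Let s (m k : 'I_4) : R := - p ^+ 2 * ((m == k) && (m < 2)%N)%:R.

Lemma aligned_products m k : P k *m P m + P m *m P k = (2 * s m k)%:M.
Proof.
have e00 : P i0 *m P i0 = (- p ^+ 2)%:M.
  by rewrite P0 -scalemxAl -scalemxAr phi0_sqr scalerA scalerN scalemx1 raddfN.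
have e11 : P i1 *m P i1 = (- p ^+ 2)%:M.
  by rewrite P1 -scalemxAl -scalemxAr psi0_sqr scalerA scalerN scalemx1 raddfN.
have e01 : P i0 *m P i1 + P i1 *m P i0 = 0.
  by rewrite P0 P1 -!scalemxAl -!scalemxAr -!scalerDr phi0_psi0 !scaler0.
have z : (2 * (- p ^+ 2 * 0))%:M = 0 :> M4 by rewrite !mulr0 raddf0.
have w : (2 * (- p ^+ 2 * 1))%:M = (- p ^+ 2)%:M + (- p ^+ 2)%:M :> M4.
  by rewrite mulr1 -raddfD; congr _%:M; ring.
elim/ord4P: m; elim/ord4P: k; rewrite /s ?P2 ?P3 ?mul0mx ?mulmx0 ?addr0 ?z//.
- by rewrite e00 w.
- by rewrite addrC e01.
- by rewrite e11 w.
Qed.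

Lemma hessian_entries m k : [/\ Q m k i0 i1 = s m k, Q m k i2 i3 = s m k,
  Q m k i1 i3 = - Q m k i0 i2 & Q m k i1 i2 = Q m k i0 i3].
Proof.
apply: skew_anticomm_entries => //; have := Qanti m k.
by rewrite -addrA aligned_products => /eqP; rewrite addr_eq0 => /eqP ->; rewrite raddfN.
Qed.

Let a m k := Q m k i0 i2.
Let d m k := Q m k i0 i3.

Lemma hessian_cyclic m :
  [/\ a m i1 = d m i0, d m i1 = - a m i0,
     s m i0 - d m i2 + a m i3 = 0 & s m i1 + a m i2 + d m i3 = 0].
Proof.
have S k i j : Q m k i j = - Q m k j i by exact: skew_entry.
have [h01 h23 h13 h12] := hessian_entries m i0.
have [k01 k23 k13 k12] := hessian_entries m i1.
have [l01 l23 l13 l12] := hessian_entries m i2.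
have [n01 n23 n13 n12] := hessian_entries m i3.
have z2 : s m i2 = 0 by rewrite /s; case: eqP => [->|_]; rewrite mulr0.
have z3 : s m i3 = 0 by rewrite /s; case: eqP => [->|_]; rewrite mulr0.
have := (Qclosed m i0 i1 i2, Qclosed m i0 i1 i3, Qclosed m i0 i2 i3, Qclosed m i1 i2 i3).
rewrite (S i1 i2 i0) (S i1 i3 i0) (S i2 i3 i0) (S i2 i3 i1).
rewrite h12 h13 h23 k23 l01 n01 l13 n12 z2 z3 /a /d.
by move=> [] [] [] c1 c2 c3 c4; split; lra.
Qed.

Lemma hessian_exchange k l :
  a k l - a l k = mu * std_comm R k l i0 i2 /\ d k l - d l k = mu * std_comm R k l i0 i3.
Proof.
have E i j : Q k l i j - Q l k i j = mu * std_comm R k l i j.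
  transitivity ((Q k l - Q l k) i j); last by rewrite Qcomm mxE.
  by rewrite [RHS]mxE [X in _ = _ + X]mxE.
by split; exact: E.
Qed.

Lemma std_comm_entry k l i j :
  std_comm R k l i j = (wedge R k l *m J0) i j - (J0 *m wedge R k l) i j.
Proof. by rewrite /std_comm [LHS]mxE [X in _ + X = _]mxE. Qed.

Lemma std_comm02 k l :
  std_comm R k l i0 i2 = - wedge R k l i0 i3 - wedge R k l i1 i2.
Proof. by rewrite std_comm_entry mulJ0E J0mulE. Qed.

Lemma std_comm03 k l :
  std_comm R k l i0 i3 = wedge R k l i0 i2 - wedge R k l i1 i3.
Proof. by rewrite std_comm_entry mulJ0E J0mulE. Qed.

(** A Weitzenboeck formula: as Omega is closed, its rough Laplacian is a
    curvature term, and pairing it with Omega gives the norm of the derivative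
    of J. *)
Lemma mu_frame : mu = - p ^+ 2 / 2.
Proof.
have [c0 e0 f0 g0] := hessian_cyclic i0.
have [c1 e1 f1 g1] := hessian_cyclic i1.
have [c2 e2 f2 g2] := hessian_cyclic i2.
have [c3 e3 f3 g3] := hessian_cyclic i3.
have [x02 y02] := hessian_exchange i0 i2.
have [x03 y03] := hessian_exchange i0 i3.
have [x12 y12] := hessian_exchange i1 i2.
have [x13 y13] := hessian_exchange i1 i3.
move: x02 y02 x03 y03 x12 y12 x13 y13 f0 g0 f1 g1.
rewrite !std_comm02 !std_comm03 !wedgeE /s /= => x02 y02 x03 y03 x12 y12 x13 y13 f0 g0 f1 g1.
by lra.
Qed.

Lemma trace_phi0 (X : M4) : \tr (X *m phi0)
  = - (X i0 i2 - X i2 i0) + (X i1 i3 - X i3 i1).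
Proof.
rewrite mxtrace4E !mulmx4E !phi0E !wedgeE /=; ring.
Qed.

Lemma trace_psi0 (X : M4) : \tr (X *m psi0)
  = X i0 i3 - X i3 i0 + (X i1 i2 - X i2 i1).
Proof.
rewrite mxtrace4E !mulmx4E !psi0E !wedgeE /=; ring.
Qed.

Lemma hessian_traces m k :
  \tr (Q m k *m phi0) = - 4 * a m k /\ \tr (Q m k *m psi0) = 4 * d m k.
Proof.
have S i j : Q m k i j = - Q m k j i by exact: skew_entry.
have [h01 h23 h13 h12] := hessian_entries m k.
rewrite trace_phi0 trace_psi0 (S i2 i0) (S i3 i1) (S i3 i0) (S i2 i1) h13 h12 /a /d.
by split; ring.
Qed.

Hypothesis p0 : p != 0.
(* The squared norm of P, which is 8 p^2, is stationary. *)
Hypothesis norm_const : forall m, \tr (Q m i0 *m P i0) + \tr (Q m i1 *m P i1) = 0.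

Lemma hessian_nullity m :
  [/\ a m i0 = 0, a m i1 = 0, d m i0 = 0 & d m i1 = 0].
Proof.
have A0 k : a k i0 = 0.
  have := norm_const k; rewrite P0 P1 -!scalemxAr !mxtraceZ -mulrDr => /eqP.
  rewrite mulf_eq0 (negbTE p0)/= => /eqP.
  have [-> _] := hessian_traces k i0; have [_ ->] := hessian_traces k i1.
  by have [_ -> _ _] := hessian_cyclic k; lra.
have D1 k : d k i1 = 0 by have [_ -> _ _] := hessian_cyclic k; rewrite A0 oppr0.
suff D0 : d m i0 = 0.
  by split=> //; have [-> _ _ _] := hessian_cyclic m.
have [x01 y01] := hessian_exchange i0 i1.
have [_ y02] := hessian_exchange i0 i2.
have [x03 _] := hessian_exchange i0 i3.
have [_ y12] := hessian_exchange i1 i2.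
have [x13 _] := hessian_exchange i1 i3.
have [c0 _ f0 _] := hessian_cyclic i0.
have [_ _ f1 _] := hessian_cyclic i1.
have [c3 _ _ _] := hessian_cyclic i3.
move: x01 y01 y02 x03 y12 x13 f0 f1; rewrite !std_comm02 !std_comm03 !wedgeE /s /=.
rewrite !A0 !D1 mu_frame => x01 y01 y02 x03 y12 x13 f0 f1.
by elim/ord4P: m; lra.
Qed.

Lemma hessian_mixed : [/\ a i0 i2 = 0, a i0 i3 = p ^+ 2 / 2,
    a i1 i2 = p ^+ 2 / 2 & a i1 i3 = 0]
  /\ [/\ d i0 i2 = - (p ^+ 2 / 2), d i0 i3 = 0, d i1 i2 = 0 & d i1 i3 = p ^+ 2 / 2].
Proof.
have [x02 y02] := hessian_exchange i0 i2.
have [x03 y03] := hessian_exchange i0 i3.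
have [x12 y12] := hessian_exchange i1 i2.
have [x13 y13] := hessian_exchange i1 i3.
have [a20 a21 d20 d21] := hessian_nullity i2.
have [a30 a31 d30 d31] := hessian_nullity i3.
move: x02 y02 x03 y03 x12 y12 x13 y13.
rewrite !std_comm02 !std_comm03 !wedgeE /= mu_frame a20 a21 d20 d21 a30 a31 d30 d31.
by move=> x02 y02 x03 y03 x12 y12 x13 y13; split; split; lra.
Qed.

Lemma hessian_normal : [/\ a i2 i2 = - d i2 i3, a i3 i2 = - d i3 i3,
    d i2 i2 = a i2 i3, d i3 i2 = a i3 i3 & a i2 i3 = a i3 i2]
  /\ d i2 i3 = d i3 i2.
Proof.
have [x23 y23] := hessian_exchange i2 i3.
have [_ _ f2 g2] := hessian_cyclic i2.
have [_ _ f3 g3] := hessian_cyclic i3.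
move: x23 y23 f2 f3 g2 g3; rewrite std_comm02 std_comm03 !wedgeE /s /=.
by move=> x23 y23 f2 f3 g2 g3; split; [split|]; lra.
Qed.

Definition Pi0 : M4 := delta_mx i0 i0 + delta_mx i1 i1.

(** Where the norm 8 p^2 is constant, the projector on the orthogonal complement
    of the nullity is a constant multiple of the 2-tensor tr (P X P Y); these are
    the derivatives of this projector Pi and of J - 2 Pi J. *)
Definition dPi m : M4 := \matrix_(i, j)
  (- (\tr (Q m i *m P j) + \tr (P i *m Q m j)) / (4 * p ^+ 2)).

Definition dJbar m : M4 := P m - 2 *: (dPi m *m J0) - 2 *: (Pi0 *m P m).

Lemma dPi_entry m i j :
  dPi m i j = - (\tr (Q m i *m P j) + \tr (Q m j *m P i)) / (4 * p ^+ 2).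
Proof. by rewrite mxE (mxtrace_mulC (P i)). Qed.

Lemma trace_P m k :
  [/\ \tr (Q m k *m P i0) = - 4 * p * a m k, \tr (Q m k *m P i1) = 4 * p * d m k,
      \tr (Q m k *m P i2) = 0 & \tr (Q m k *m P i3) = 0].
Proof.
have [h1 h2] := hessian_traces m k.
rewrite P0 P1 P2 P3 mulmx0 mxtrace0 -!scalemxAr !mxtraceZ h1 h2.
by split=> //; ring.
Qed.

Lemma dPi_block m :
  [/\ dPi m i0 i0 = 0, dPi m i0 i1 = 0, dPi m i1 i0 = 0 & dPi m i1 i1 = 0] /\
  [/\ dPi m i2 i2 = 0, dPi m i2 i3 = 0, dPi m i3 i2 = 0 & dPi m i3 i3 = 0].
Proof.
have [h00 h01 h02 h03] := trace_P m i0.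
have [h10 h11 h12 h13] := trace_P m i1.
have [h20 h21 h22 h23] := trace_P m i2.
have [h30 h31 h32 h33] := trace_P m i3.
have [z1 z2 z3 z4] := hessian_nullity m.
rewrite !dPi_entry h00 h01 h10 h11 h22 h23 h32 h33 z1 z2 z3 z4.
by rewrite !mulr0 !addr0 oppr0 mul0r.
Qed.

Lemma dPi_mixed m :
  [/\ dPi m i0 i2 = a m i2 / p, dPi m i0 i3 = a m i3 / p,
      dPi m i1 i2 = - d m i2 / p & dPi m i1 i3 = - d m i3 / p] /\
  [/\ dPi m i2 i0 = a m i2 / p, dPi m i3 i0 = a m i3 / p,
      dPi m i2 i1 = - d m i2 / p & dPi m i3 i1 = - d m i3 / p].
Proof.
have [h00 h01 h02 h03] := trace_P m i0.
have [h10 h11 h12 h13] := trace_P m i1.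
have [h20 h21 h22 h23] := trace_P m i2.
have [h30 h31 h32 h33] := trace_P m i3.
rewrite !dPi_entry h02 h03 h12 h13 h20 h21 h30 h31.
by split; split; field.
Qed.

Lemma Pi0_mul (X : M4) j : ((Pi0 *m X) i0 j = X i0 j) * ((Pi0 *m X) i1 j = X i1 j)
  * ((Pi0 *m X) i2 j = 0) * ((Pi0 *m X) i3 j = 0).
Proof. by do ![split]; rewrite mulmx4E !mxE /=; ring. Qed.

Lemma dJbar_entry m i j :
  dJbar m i j = P m i j - 2 * (dPi m *m J0) i j - 2 * (Pi0 *m P m) i j.
Proof.
have e3 (A B C : M4) : (A - 2 *: B - 2 *: C) i j = A i j - 2 * B i j - 2 * C i j.
  by rewrite !mxE.
exact: e3.
Qed.

Lemma P0_entry i j : P i0 i j = p * (wedge R i0 i2 i j - wedge R i1 i3 i j).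
Proof. by rewrite P0 mxE phi0E. Qed.

Lemma P1_entry i j : P i1 i j = - p * (wedge R i0 i3 i j + wedge R i1 i2 i j).
Proof. by rewrite P1 mxE psi0E mulrN mulNr. Qed.

(** The mixed second derivatives of J have the size p^2 / 2 at which the
    derivative of Pi compensates the derivative of J. *)
Lemma dJbar_parallel : dJbar i0 = 0 /\ dJbar i1 = 0.
Proof.
have [[b1 b2 b3 b4] [b5 b6 b7 b8]] := dPi_block i0.
have [[c1 c2 c3 c4] [c5 c6 c7 c8]] := dPi_mixed i0.
have [[b1' b2' b3' b4'] [b5' b6' b7' b8']] := dPi_block i1.
have [[c1' c2' c3' c4'] [c5' c6' c7' c8']] := dPi_mixed i1.
have [[m1 m2 m3 m4] [n1 n2 n3 n4]] := hessian_mixed.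
split; apply: matrix4P; do ![split]; rewrite dJbar_entry mulJ0E Pi0_mul [RHS]mxE.
all: rewrite ?P0_entry ?P1_entry !wedgeE /=.
all: rewrite ?(b1, b2, b3, b4, b5, b6, b7, b8, c1, c2, c3, c4, c5, c6, c7, c8).
all: rewrite ?(b1', b2', b3', b4', b5', b6', b7', b8', c1', c2', c3', c4', c5', c6', c7', c8').
all: rewrite ?(m1, m2, m3, m4, n1, n2, n3, n4).
all: by field.
Qed.

(** The plane field orthogonal to the nullity has a symmetric second
    fundamental form, that is, it is involutive. *)
Lemma dPi_sym j : dPi i0 i1 j = dPi i1 i0 j.
Proof.
have [[b1 b2 b3 b4] _] := dPi_block i0.
have [[c1 c2 c3 c4] _] := dPi_mixed i0.
have [[b1' b2' b3' b4'] _] := dPi_block i1.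
have [[c1' c2' c3' c4'] _] := dPi_mixed i1.
have [[m1 m2 m3 m4] [n1 n2 n3 n4]] := hessian_mixed.
elim/ord4P: j.
- by rewrite b3 b1'.
- by rewrite b4 b2'.
- by rewrite c3 c1' n1 m3 opprK.
by rewrite c4 c2' n2 m4 oppr0.
Qed.

Lemma dJbar_normal_entry m i j : P m = 0 ->
  dJbar m i j = - 2 * (dPi m *m J0) i j.
Proof.
by move=> Pm0; rewrite dJbar_entry Pm0 mulmx0 !mxE mulr0 subr0 sub0r mulNr.
Qed.

Lemma dJbar_closed i j k : dJbar i j k + dJbar j k i + dJbar k i j = 0.
Proof.
have [z0 z1] := dJbar_parallel.
have Z0 k' l' : dJbar i0 k' l' = 0 by rewrite z0 mxE.
have Z1 k' l' : dJbar i1 k' l' = 0 by rewrite z1 mxE.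
have N2 k' l' := @dJbar_normal_entry i2 k' l' P2.
have N3 k' l' := @dJbar_normal_entry i3 k' l' P3.
have [[b1 b2 b3 b4] [b5 b6 b7 b8]] := dPi_block i2.
have [[c1 c2 c3 c4] [c5 c6 c7 c8]] := dPi_mixed i2.
have [[b1' b2' b3' b4'] [b5' b6' b7' b8']] := dPi_block i3.
have [[c1' c2' c3' c4'] [c5' c6' c7' c8']] := dPi_mixed i3.
have [[n1 n2 n3 n4 n5] n6] := hessian_normal.
elim/ord4P: i; elim/ord4P: j; elim/ord4P: k;
  rewrite ?(Z0, Z1, N2, N3) ?mulJ0E
    ?(b1, b2, b3, b4, b5, b6, b7, b8, c1, c2, c3, c4, c5, c6, c7, c8)
    ?(b1', b2', b3', b4', b5', b6', b7', b8', c1', c2', c3', c4', c5', c6', c7', c8')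
    ?(n1, n2, n3, n4, n5, n6); by field.
Qed.

End HessianInFrame.

Section CurvatureInFrame.
Variable R : realType.
Local Notation M4 := 'M[R]_4.
Local Notation J0 := (J0 R).
Local Notation phi0 := (phi0 R).
Local Notation psi0 := (psi0 R).
Local Notation wedge := (wedge R).

Lemma wedge_skew i j : wedge i j + (wedge i j)^T = 0.
Proof.
by rewrite /wedge raddfB/= !trmx_delta addrC subrKA subrr.
Qed.

Lemma skew_diag (X : M4) i : X + X^T = 0 -> X i i = 0.
Proof. by move=> /(skew_entry i i) /eqP; rewrite -addr_eq0 -mulr2n mulrn_eq0 => /eqP. Qed.

Lemma comm_J0 (X : M4) : X + X^T = 0 -> X *m J0 - J0 *m X =
  - (X i0 i2 - X i1 i3) *: psi0 - (X i0 i3 + X i1 i2) *: phi0.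
Proof.
move=> sk; have S i j : X i j = - X j i by exact: skew_entry.
have D i : X i i = 0 by exact: skew_diag.
apply: matrix4P; do ![split].
all: have e2 (A B C E : M4) (u v : R) k l :
  (A k l - B k l = u * C k l + v * E k l) -> (A - B) k l = (u *: C + v *: E) k l
  by rewrite !mxE.
all: rewrite -scaleNr; apply: e2; rewrite mulJ0E J0mulE psi0E phi0E !wedgeE /= ?D.
all: rewrite ?(S i1 i0) ?(S i2 i0) ?(S i3 i0) ?(S i2 i1) ?(S i3 i1) ?(S i3 i2); ring.
Qed.

Lemma mulphi0E (A : M4) i :
  ((A *m phi0) i i0 = - A i i2) * ((A *m phi0) i i1 = A i i3) *
  ((A *m phi0) i i2 = A i i0) * ((A *m phi0) i i3 = - A i i1).
Proof. by do ![split]; rewrite mulmx4E !phi0E !wedgeE /=; ring. Qed.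

Lemma phi0mulE (A : M4) i :
  ((phi0 *m A) i0 i = A i2 i) * ((phi0 *m A) i1 i = - A i3 i) *
  ((phi0 *m A) i2 i = - A i0 i) * ((phi0 *m A) i3 i = A i1 i).
Proof. by do ![split]; rewrite mulmx4E !phi0E !wedgeE /=; ring. Qed.

Lemma mulpsi0E (A : M4) i :
  ((A *m psi0) i i0 = A i i3) * ((A *m psi0) i i1 = A i i2) *
  ((A *m psi0) i i2 = - A i i1) * ((A *m psi0) i i3 = - A i i0).
Proof. by do ![split]; rewrite mulmx4E !psi0E !wedgeE /=; ring. Qed.

Lemma psi0mulE (A : M4) i :
  ((psi0 *m A) i0 i = - A i3 i) * ((psi0 *m A) i1 i = - A i2 i) *
  ((psi0 *m A) i2 i = A i1 i) * ((psi0 *m A) i3 i = A i0 i).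
Proof. by do ![split]; rewrite mulmx4E !psi0E !wedgeE /=; ring. Qed.

Lemma comm_phi0 (X : M4) : X + X^T = 0 -> X *m J0 - J0 *m X = 0 ->
  X *m phi0 - phi0 *m X = (X i0 i1 + X i2 i3) *: psi0 /\
  X *m psi0 - psi0 *m X = - (X i0 i1 + X i2 i3) *: phi0.
Proof.
move=> sk cX; have S i j : X i j = - X j i by exact: skew_entry.
have D i : X i i = 0 by exact: skew_diag.
have e1 (A B : M4) k l : A - B = 0 -> A k l = B k l by move=> /subr0_eq ->.
have h13 : X i1 i3 = X i0 i2.
  by have := e1 _ _ i0 i3 cX; rewrite mulJ0E J0mulE => ->.
have h12 : X i1 i2 = - X i0 i3.
  by have := e1 _ _ i0 i2 cX; rewrite mulJ0E J0mulE => ->.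
have e2 (A B C : M4) (u : R) k l :
  (A k l - B k l = u * C k l) -> (A - B) k l = (u *: C) k l by rewrite !mxE.
split; apply: matrix4P; do ![split]; apply: e2;
  rewrite ?mulphi0E ?phi0mulE ?mulpsi0E ?psi0mulE ?psi0E ?phi0E !wedgeE /= ?D.
all: rewrite ?(S i1 i0) ?(S i2 i0) ?(S i3 i0) ?(S i2 i1) ?(S i3 i1) ?(S i3 i2) ?h13 ?h12; ring.
Qed.

Definition conjJ (i : 'I_4) : 'I_4 :=
  if i == i0 then i1 else if i == i1 then i0 else if i == i2 then i3 else i2.
Definition sgJ (i : 'I_4) : R := (-1) ^+ odd i.

Variable F : 'I_4 -> 'I_4 -> M4.
Hypothesis FN : forall i j, F i j = - F j i.
Hypothesis Fskew : forall i j, F i j + (F i j)^T = 0.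
Hypothesis Fbianchi : forall i j k l, F i j k l + F j k i l + F k i j l = 0.

Lemma F_antisym i j k l : F i j k l = - F j i k l.
Proof. by rewrite FN mxE. Qed.

Lemma F_pair i j k l : F i j k l = F k l i j.
Proof.
have A := F_antisym; have S a b c d : F a b c d = - F a b d c by exact: skew_entry.
have := Fbianchi i j k l; have := Fbianchi j k l i.
have := Fbianchi k l i j; have := Fbianchi l i j k.
rewrite (S j k l i) (S k l j i) (S l i j k) (A i k l j) (S k i l j).
rewrite (S i j l k) (A j l i k) (S l j i k).
by lra.
Qed.

Lemma F_diag i k l : F i i k l = 0.
Proof. by have /eqP := F_antisym i i k l; rewrite -addr_eq0 -mulr2n mulrn_eq0 => /eqP. Qed.

Lemma F_diag' i k l : F k l i i = 0.
Proof. exact: skew_diag. Qed.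

(* The image of the i-th frame vector under J0 is, up to the sign sgJ i, the
   frame vector with index conjJ i. *)
Hypothesis G2 : forall i j k l,
  F i j k l - sgJ i * sgJ j * F (conjJ i) (conjJ j) k l
  = sgJ i * sgJ k * F (conjJ i) j (conjJ k) l
    + sgJ i * sgJ l * F (conjJ i) j k (conjJ l).

Lemma G2_entries :
  let u i j := F i j i0 i2 - F i j i1 i3 in
  let w i j := F i j i0 i3 + F i j i1 i2 in
  [/\ u i0 i1 = 0, w i0 i1 = 0, u i2 i3 = 0 & w i2 i3 = 0] /\
  [/\ u i1 i3 = - u i0 i2, u i0 i3 = 0 & u i1 i2 = 0] /\
  [/\ w i0 i2 = 0, w i1 i3 = 0, w i0 i3 = u i0 i2 & w i1 i2 = u i0 i2].
Proof.
move=> u w; have S a b c d : F a b c d = - F a b d c by exact: skew_entry.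
pose N := (fun a b => S a b i1 i0, fun a b => S a b i2 i0, fun a b => S a b i3 i0,
  fun a b => S a b i2 i1, fun a b => S a b i3 i1, fun a b => S a b i3 i2,
  F_antisym i1 i0, F_antisym i2 i0, F_antisym i3 i0, F_antisym i2 i1,
  F_antisym i3 i1, F_antisym i3 i2, F_diag, F_diag').
have := (G2 i0 i2 i0 i1, G2 i0 i3 i0 i1, G2 i0 i2 i2 i3, G2 i0 i3 i2 i3).
rewrite /sgJ /conjJ /= !N.
move=> [[[p1 p2] p3] p4].
split.
  rewrite /u /w (F_pair i0 i1 i0 i2) (F_pair i0 i1 i1 i3) (F_pair i0 i1 i0 i3).
  rewrite (F_pair i0 i1 i1 i2) (F_pair i2 i3 i0 i2) (F_pair i2 i3 i1 i3).
  by rewrite (F_pair i2 i3 i0 i3) (F_pair i2 i3 i1 i2); split; lra.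
rewrite /u /w {u w}.
have := (G2 i0 i2 i0 i2, G2 i0 i2 i1 i3, G2 i0 i2 i0 i3, G2 i0 i2 i1 i2).
have := (G2 i1 i3 i0 i2, G2 i1 i3 i1 i3, G2 i1 i3 i0 i3, G2 i1 i3 i1 i2).
have := (G2 i0 i3 i0 i2, G2 i0 i3 i1 i3, G2 i0 i3 i0 i3, G2 i0 i3 i1 i2).
rewrite /sgJ /conjJ /= ?N => -[] [] [] q1 q2 q3 q4 [] [] [] q5 q6 q7 q8.
move=> -[] [] [] q9 q10 q11 q12.
have := (F_pair i0 i2 i1 i3, F_pair i0 i2 i0 i3, F_pair i0 i2 i1 i2).
have := (F_pair i1 i3 i0 i3, F_pair i1 i3 i1 i2, F_pair i0 i3 i1 i2).
move=> [] [] h1 h2 h3 [] [] h4 h5 h6.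
by split; split; lra.
Qed.

(** The condition leaves one free number among the components of the curvature
    that do not commute with J0, the same that a tensor of constant curvature
    has there. *)
Lemma G2_scalar : exists mu, forall i j,
  F i j *m J0 - J0 *m F i j = mu *: std_comm R i j.
Proof.
have := G2_entries => /= -[[a1 a2 a3 a4] [[b1 b2 b3] [c1 c2 c3 c4]]].
pose mu := F i0 i2 i0 i2 - F i0 i2 i1 i3.
have key i j :
    F i j i0 i2 - F i j i1 i3 = mu * (wedge i j i0 i2 - wedge i j i1 i3) /\
    F i j i0 i3 + F i j i1 i2 = mu * (wedge i j i0 i3 + wedge i j i1 i2).
  have half k l : (F k l i0 i2 - F k l i1 i3 = mu * (wedge k l i0 i2 - wedge k l i1 i3) /\
      F k l i0 i3 + F k l i1 i2 = mu * (wedge k l i0 i3 + wedge k l i1 i2)) ->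
    F l k i0 i2 - F l k i1 i3 = mu * (wedge l k i0 i2 - wedge l k i1 i3) /\
      F l k i0 i3 + F l k i1 i2 = mu * (wedge l k i0 i3 + wedge l k i1 i2).
    move=> [h1 h2]; rewrite !(F_antisym l k) -/(- _).
    have W a b : wedge l k a b = - wedge k l a b by rewrite !wedgeE opprB.
    by rewrite !W; split; lra.
  have D k : F k k i0 i2 - F k k i1 i3 = mu * (wedge k k i0 i2 - wedge k k i1 i3) /\
      F k k i0 i3 + F k k i1 i2 = mu * (wedge k k i0 i3 + wedge k k i1 i2).
    by rewrite !F_diag !wedgeE; split; ring.
  elim/ord4P: i; elim/ord4P: j; try exact: D;
    first [rewrite !wedgeE /= ?(a1, a2, a3, a4, b1, b2, b3, c1, c2, c3, c4) /mu;
      by split; ring | apply: half;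
    rewrite !wedgeE /= ?(a1, a2, a3, a4, b1, b2, b3, c1, c2, c3, c4) /mu;
      by split; ring].
exists mu => i j; have [e1 e2] := key i j.
move: mu e1 e2 {key} => mu e1 e2.
rewrite /std_comm (comm_J0 (wedge_skew i j)) comm_J0// [RHS]scalerBr e1 e2 !scalerA.
by rewrite mulrN.
Qed.

End CurvatureInFrame.

Section ComplexCurvature.
Variable R : realType.
Local Notation M4 := 'M[R]_4.
Local Notation J0 := (J0 R).
Local Notation phi0 := (phi0 R).
Local Notation psi0 := (psi0 R).
Local Notation wedge := (wedge R).

Lemma subr_exchange (Z : zmodType) (x a y b : Z) : x - a - (y - b) = x - y - (a - b).
Proof. by rewrite !opprB addrACA [RHS]addrACA; congr (_ + _); rewrite addrC. Qed.

Lemma wedgeN i j : wedge i j = - wedge j i.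
Proof. by rewrite /wedge opprB. Qed.

Lemma wedge_bianchi i j k l : wedge i j k l + wedge j k i l + wedge k i j l = 0.
Proof.
by rewrite !wedgeE (eq_sym i k) (eq_sym j k) (eq_sym j i); ring.
Qed.

(** The tensor of constant curvature mu has the same commutators with J0, and
    all the symmetries of a curvature tensor. *)
Lemma reduced_curvature (F : 'I_4 -> 'I_4 -> M4) (mu : R) :
  (forall i j, F i j = - F j i) -> (forall i j, F i j + (F i j)^T = 0) ->
  (forall i j k l, F i j k l + F j k i l + F k i j l = 0) ->
  (forall i j, F i j *m J0 - J0 *m F i j = mu *: std_comm R i j) ->
  let F' i j := F i j - mu *: wedge i j in
  [/\ forall i j, F' i j = - F' j i, forall i j, F' i j + (F' i j)^T = 0,
      forall i j k l, F' i j k l + F' j k i l + F' k i j l = 0 &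
      forall i j, F' i j *m J0 - J0 *m F' i j = 0].
Proof.
move=> FN Fs Fb Fc F'; rewrite /F'; split.
- by move=> i j; rewrite FN wedgeN scalerN opprD.
- move=> i j; have := Fs i j; have := wedge_skew R i j.
  move: (F i j) (wedge i j) => X w hw hX.
  transitivity ((X + X^T) - mu *: (w + w^T)); last by rewrite hX hw scaler0 subr0.
  by apply/matrixP => a b; rewrite !mxE; ring.
- move=> i j k l.
  have E (X Y : M4) a b : (X - mu *: Y) a b = X a b - mu * Y a b by rewrite !mxE.
  rewrite !E.
  transitivity (F i j k l + F j k i l + F k i j l
    - mu * (wedge i j k l + wedge j k i l + wedge k i j l)); first by ring.
  by rewrite Fb wedge_bianchi mulr0 subr0.
- move=> i j; have := Fc i j; rewrite /std_comm.
  move: (F i j) (wedge i j) J0 => X w K H.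
  transitivity ((X *m K - K *m X) - mu *: (w *m K - K *m w)); last by rewrite H subrr.
  by rewrite mulmxBl mulmxBr -scalemxAl -scalemxAr scalerBr; exact: subr_exchange.
Qed.

Variable F : 'I_4 -> 'I_4 -> M4.
Hypothesis FN : forall i j, F i j = - F j i.
Hypothesis Fskew : forall i j, F i j + (F i j)^T = 0.
Hypothesis Fbianchi : forall i j k l, F i j k l + F j k i l + F k i j l = 0.
Hypothesis Fcomm : forall i j, F i j *m J0 - J0 *m F i j = 0.

Let g k l := F k l i0 i1 + F k l i2 i3.

Lemma Fcomm_entries k l : F k l i1 i3 = F k l i0 i2 /\ F k l i1 i2 = - F k l i0 i3.
Proof.
have e1 (A B : M4) i j : A - B = 0 -> A i j = B i j by move=> /subr0_eq ->.
split; first by have := e1 _ _ i0 i3 (Fcomm k l); rewrite mulJ0E J0mulE => ->.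
by have := e1 _ _ i0 i2 (Fcomm k l); rewrite mulJ0E J0mulE => ->.
Qed.

Lemma Fpair i j k l : F i j k l = F k l i j.
Proof. exact: F_pair. Qed.

(** Pair symmetry moves J0 from one pair of arguments to the other. *)
Lemma g_invariant : g i0 i2 = g i1 i3 /\ g i0 i3 = - g i1 i2.
Proof.
have [h1 h2] := Fcomm_entries i0 i1; have [h3 h4] := Fcomm_entries i2 i3.
rewrite /g !(Fpair _ _ i0 i1) !(Fpair _ _ i2 i3) h1 h2 h3 h4.
by split; ring.
Qed.

(** For a curvature tensor that commutes with J0 the first Bianchi identity
    expresses the Ricci form through g, the image of the fundamental form. *)
Lemma ricci_frame : [/\ g i0 i2 = 0, g i0 i3 = 0, g i1 i2 = 0, g i1 i3 = 0 & g i2 i3 = 0] ->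
  forall j l, \sum_i F i j i l = g i0 i1 * Pi0 R j l.
Proof.
move=> [g02 g03 g12 g13 g23].
have S a b c d : F a b c d = - F a b d c by exact: skew_entry.
pose N := (fun a b => S a b i1 i0, fun a b => S a b i2 i0, fun a b => S a b i3 i0,
  fun a b => S a b i2 i1, fun a b => S a b i3 i1, fun a b => S a b i3 i2,
  F_antisym FN i1 i0, F_antisym FN i2 i0, F_antisym FN i3 i0, F_antisym FN i2 i1,
  F_antisym FN i3 i1, F_antisym FN i3 i2, F_diag FN, F_diag' Fskew).
have C13 k l : F k l i1 i3 = F k l i0 i2 by have [] := Fcomm_entries k l.
have C12 k l : F k l i1 i2 = - F k l i0 i3 by have [] := Fcomm_entries k l.
have B := Fbianchi i0 i1 i2 i3; rewrite !N C13 (Fpair i1 i2) C12 in B.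
have D13 k l : F i1 i3 k l = F i0 i2 k l by rewrite !(Fpair _ _ k l) C13.
have D12 k l : F i1 i2 k l = - F i0 i3 k l by rewrite !(Fpair _ _ k l) C12.
rewrite /g in g02 g03 g12 g13 g23 *.
rewrite ?C13 ?C12 ?D13 ?D12 in g02 g03 g12 g13 g23 B.
have h1 := Fpair i0 i1 i2 i3; have h2 := Fpair i0 i1 i0 i2; have h3 := Fpair i0 i1 i0 i3.
have h4 := Fpair i2 i3 i0 i2; have h5 := Fpair i2 i3 i0 i3; have h6 := Fpair i0 i2 i0 i3.
have PE i j : Pi0 R i j = ((i == i0) && (j == i0))%:R + ((i == i1) && (j == i1))%:R.
  by rewrite !mxE.
elim/ord4P => l; elim/ord4P: l; rewrite sum4E PE ?N ?C13 ?C12 ?D13 ?D12 ?N /=.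
all: clear N S C13 C12 D13 D12 PE.
all: by lra.
Qed.

Variables (p : R) (P : 'I_4 -> M4) (dmu : 'I_4 -> R).
Hypotheses (p0 : p != 0) (P0 : P i0 = p *: phi0) (P1 : P i1 = p *: psi0).
Hypotheses (P2 : P i2 = 0) (P3 : P i3 = 0).
(* The exterior derivative of the identity [F, J] = mu [W, J], where W is the
   tensor of constant curvature 1. *)
Hypothesis bianchi2 : forall m k l,
  (F k l *m P m - P m *m F k l) + (F l m *m P k - P k *m F l m)
    + (F m k *m P l - P l *m F m k)
  = dmu m *: std_comm R k l + dmu k *: std_comm R l m + dmu l *: std_comm R m k.

Lemma commP k l : [/\ F k l *m P i0 - P i0 *m F k l = (p * g k l) *: psi0,
  F k l *m P i1 - P i1 *m F k l = - (p * g k l) *: phi0,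
  F k l *m P i2 - P i2 *m F k l = 0 & F k l *m P i3 - P i3 *m F k l = 0].
Proof.
have [h1 h2] := comm_phi0 (Fskew k l) (Fcomm k l).
rewrite P0 P1 P2 P3 !mulmx0 !mul0mx !subrr; split=> //.
  by rewrite -scalemxAl -scalemxAr -scalerBr h1 scalerA.
by rewrite -scalemxAl -scalemxAr -scalerBr h2 scalerA mulrN.
Qed.

(** By [comm_phi0] the commutator of F with P only sees the form g, so the
    hypothesis is a linear system for g and dmu. *)
Lemma bianchi2_frame : (forall m, dmu m = 0) /\
  [/\ g i0 i2 = 0, g i0 i3 = 0, g i1 i2 = 0, g i1 i3 = 0 & g i2 i3 = 0].
Proof.
have gN k l : g k l = - g l k by rewrite /g 2!(F_antisym FN k l) opprD.
have [n1 n2] := g_invariant.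
have e6 (X Y Z : R) (A B C : M4) i j : (X *: A + Y *: B + Z *: C) i j
    = X * A i j + Y * B i j + Z * C i j by rewrite !mxE.
have E m k l (X Y Z : M4) i j : X + Y + Z =
  dmu m *: std_comm R k l + dmu k *: std_comm R l m + dmu l *: std_comm R m k ->
  X i j + Y i j + Z i j = dmu m * std_comm R k l i j + dmu k * std_comm R l m i j
    + dmu l * std_comm R m k i j.
  by move=> H; rewrite -e6 -H !mxE.
have [a0 a1 a2 a3] := commP i0 i1. have [b0 b1 b2 b3] := commP i1 i2.
have [c0 c1 c2 c3] := commP i2 i0. have [d0 d1 d2 d3] := commP i1 i3.
have [k0 k1 k2 k3] := commP i3 i0. have [l0 l1 l2 l3] := commP i2 i3.
have [m0 m1 m2 m3] := commP i0 i2. have [n0 n1' n2' n3] := commP i3 i1.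
have sE (r : R) (A : M4) i j : (r *: A) i j = r * A i j by rewrite mxE.
have z i j : (0 : M4) i j = 0 by rewrite mxE.
have := (E _ _ _ _ _ _ i0 i2 (bianchi2 i0 i1 i2), E _ _ _ _ _ _ i0 i3 (bianchi2 i0 i1 i2)).
have := (E _ _ _ _ _ _ i0 i2 (bianchi2 i0 i1 i3), E _ _ _ _ _ _ i0 i3 (bianchi2 i0 i1 i3)).
have := (E _ _ _ _ _ _ i0 i2 (bianchi2 i0 i2 i3), E _ _ _ _ _ _ i0 i3 (bianchi2 i0 i2 i3)).
have := (E _ _ _ _ _ _ i0 i2 (bianchi2 i1 i2 i3), E _ _ _ _ _ _ i0 i3 (bianchi2 i1 i2 i3)).
rewrite ?(a0, a1, a2, a3, b0, b1, b2, b3, c0, c1, c2, c3, d0, d1, d2, d3).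
rewrite ?(k0, k1, k2, k3, l0, l1, l2, l3, m0, m1, m2, m3, n0, n1', n2', n3).
rewrite !sE !z !std_comm02 !std_comm03 !psi0E !phi0E !wedgeE /=.
rewrite ?(gN i2 i0) ?(gN i3 i0) ?(gN i3 i1) n1 n2.
move: (g i1 i2) (g i1 i3) (g i2 i3) {E e6 gN n1 n2 a0 a1 a2 a3 b0 b1 b2 b3 c0 c1 c2 c3}.
move=> g12 g13 g23 {d0 d1 d2 d3 k0 k1 k2 k3 l0 l1 l2 l3 m0 m1 m2 m3 n0 n1' n2' n3 sE z}.
move=> [e1 e2] [e3 e4] [e5 e6] [e7 e8].
have [y0 y1 y2 y3] : [/\ dmu i0 = 0, dmu i1 = 0, dmu i2 = 0 & dmu i3 = 0].
  by split; lra.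
have [z1 z2 z3] : [/\ p * g12 = 0, p * g13 = 0 & p * g23 = 0] by split; lra.
have pz x : p * x = 0 -> x = 0 by move/eqP; rewrite mulf_eq0 (negbTE p0) => /eqP.
by split; [elim/ord4P | rewrite (pz _ z1) (pz _ z2) (pz _ z3) oppr0].
Qed.

End ComplexCurvature.

(** * Change of frame *)

Section FrameSums.
Variables (R : realType) (B : 'M[R]_4).
Implicit Types (L : lmodType R).

(** Components in the frame formed by the rows of B *)
Definition fr L (T : 'I_4 -> L) (i : 'I_4) : L := \sum_k B i k *: T k.
Definition fr2 L (T : 'I_4 -> 'I_4 -> L) i j : L := fr (fun a => fr (T a) j) i.
Definition fr3 L (T : 'I_4 -> 'I_4 -> 'I_4 -> L) i j k : L :=
  fr (fun a => fr2 (T a) j k) i.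

Lemma eq_fr L (T S : 'I_4 -> L) i : T =1 S -> fr T i = fr S i.
Proof. by move=> TS; apply: eq_bigr => k _; rewrite TS. Qed.

Lemma eq_fr2 L (T S : 'I_4 -> 'I_4 -> L) i j : T =2 S -> fr2 T i j = fr2 S i j.
Proof. by move=> TS; apply: eq_fr => a; apply: eq_fr. Qed.

Lemma frD L (T S : 'I_4 -> L) i : fr (fun a => T a + S a) i = fr T i + fr S i.
Proof. by rewrite /fr -big_split; apply: eq_bigr => k _; rewrite scalerDr. Qed.

Lemma frN L (T : 'I_4 -> L) i : fr (fun a => - T a) i = - fr T i.
Proof. by rewrite /fr -sumrN; apply: eq_bigr => k _; rewrite scalerN. Qed.

Lemma fr0 L i : fr (fun=> 0 : L) i = 0.
Proof. by rewrite /fr big1// => k _; rewrite scaler0. Qed.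

Lemma frZ L c (T : 'I_4 -> L) i : fr (fun a => c *: T a) i = c *: fr T i.
Proof. by rewrite /fr scaler_sumr; apply: eq_bigr => k _; rewrite !scalerA mulrC. Qed.

Lemma fr_swap L (T : 'I_4 -> 'I_4 -> L) i j :
  fr (fun a => fr (T a) j) i = fr (fun b => fr (T^~ b) i) j.
Proof.
rewrite /fr; under eq_bigr do rewrite scaler_sumr.
rewrite exchange_big/=; apply: eq_bigr => b _; rewrite scaler_sumr.
by apply: eq_bigr => a _; rewrite !scalerA mulrC.
Qed.

Lemma fr2_swap L (T : 'I_4 -> 'I_4 -> L) i j : fr2 T j i = fr2 (fun a b => T b a) i j.
Proof. exact: fr_swap. Qed.

Lemma fr2D L (T S : 'I_4 -> 'I_4 -> L) i j :
  fr2 (fun a b => T a b + S a b) i j = fr2 T i j + fr2 S i j.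
Proof. by rewrite /fr2 -frD; apply: eq_fr => a; rewrite frD. Qed.

Lemma fr2N L (T : 'I_4 -> 'I_4 -> L) i j : fr2 (fun a b => - T a b) i j = - fr2 T i j.
Proof. by rewrite /fr2 -frN; apply: eq_fr => a; rewrite frN. Qed.

Lemma fr2Z L c (T : 'I_4 -> 'I_4 -> L) i j :
  fr2 (fun a b => c *: T a b) i j = c *: fr2 T i j.
Proof. by rewrite /fr2 -frZ; apply: eq_fr => a; rewrite frZ. Qed.

Lemma fr2_0 L (T : 'I_4 -> 'I_4 -> L) i j : (forall a b, T a b = 0) -> fr2 T i j = 0.
Proof.
move=> T0; rewrite /fr2 -[RHS](fr0 L i); apply: eq_fr => a.
by rewrite -[RHS](fr0 L j); apply: eq_fr.
Qed.

Lemma fr3_0 L (T : 'I_4 -> 'I_4 -> 'I_4 -> L) i j k :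
  (forall a b c, T a b c = 0) -> fr3 T i j k = 0.
Proof.
move=> T0; rewrite /fr3 -[RHS](fr0 L i); apply: eq_fr => a; exact: fr2_0.
Qed.

Lemma fr3D L (T S : 'I_4 -> 'I_4 -> 'I_4 -> L) i j k :
  fr3 (fun a b c => T a b c + S a b c) i j k = fr3 T i j k + fr3 S i j k.
Proof. by rewrite /fr3 -frD; apply: eq_fr => a; rewrite fr2D. Qed.

Lemma fr3_rot L (T : 'I_4 -> 'I_4 -> 'I_4 -> L) i j k :
  fr3 T j k i = fr3 (fun a b c => T b c a) i j k.
Proof.
rewrite /fr3 /fr2.
rewrite (eq_fr (S := fun a => fr (fun c => fr (fun b => T a b c) k) i)); last first.
  by move=> a; rewrite fr_swap.
by rewrite fr_swap.
Qed.

Lemma cyclic_fr3 L (T : 'I_4 -> 'I_4 -> 'I_4 -> L) i j k :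
  (forall a b c, T a b c + T b c a + T c a b = 0) ->
  fr3 T i j k + fr3 T j k i + fr3 T k i j = 0.
Proof.
move=> T0; rewrite (fr3_rot T i j k) (fr3_rot T j k i) (fr3_rot _ i j k) -!fr3D.
exact: fr3_0.
Qed.

Lemma fr_mulmxr (T : 'I_4 -> 'M[R]_4) (A : 'M[R]_4) i :
  fr (fun a => T a *m A) i = fr T i *m A.
Proof. by rewrite /fr mulmx_suml; apply: eq_bigr => k _; rewrite scalemxAl. Qed.

Lemma fr_mulmxl (T : 'I_4 -> 'M[R]_4) (A : 'M[R]_4) i :
  fr (fun a => A *m T a) i = A *m fr T i.
Proof. by rewrite /fr mulmx_sumr; apply: eq_bigr => k _; rewrite scalemxAr. Qed.

Lemma fr2_mulmxr (T : 'I_4 -> 'I_4 -> 'M[R]_4) (A : 'M[R]_4) i j :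
  fr2 (fun a b => T a b *m A) i j = fr2 T i j *m A.
Proof. by rewrite /fr2 -fr_mulmxr; apply: eq_fr => a; rewrite fr_mulmxr. Qed.

Lemma fr2_mulmxl (T : 'I_4 -> 'I_4 -> 'M[R]_4) (A : 'M[R]_4) i j :
  fr2 (fun a b => A *m T a b) i j = A *m fr2 T i j.
Proof. by rewrite /fr2 -fr_mulmxl; apply: eq_fr => a; rewrite fr_mulmxl. Qed.

Lemma fr_tr (T : 'I_4 -> 'M[R]_4) i : fr (fun a => (T a)^T) i = (fr T i)^T.
Proof. by rewrite /fr raddf_sum; apply: eq_bigr => k _ /=; rewrite linearZ. Qed.

Lemma form_frame (A : 'M[R]_4) i j :
  (B *m A *m B^T) i j = fr2 (fun a b => A a b : R^o) i j.
Proof.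
rewrite mxE /fr2 (fr_swap (fun a b => A a b : R^o)) /fr.
apply: eq_bigr => b _; rewrite [in RHS]/GRing.scale/= mulrC !mxE; congr (_ * _).
Qed.

End FrameSums.

Section FrameChange.
Variable R : realType.
Local Notation M4 := 'M[R]_4.
Local Notation J0 := (J0 R).
Variables (G J B : M4).
Hypothesis BG : B *m G *m B^T = 1%:M.
Hypothesis BJ : B *m J = J0 *m B.
Hypothesis GT : G^T = G.

Let C := G *m B^T.

Lemma frameBC : B *m C = 1%:M.
Proof. by rewrite mulmxA BG. Qed.

Lemma frameCB : C *m B = 1%:M.
Proof. exact: mulmx1C frameBC. Qed.

(** The inverse of B is G *m B^T. *)
Definition hat (A : M4) : M4 := B *m A *m (G *m B^T).

Lemma hatM A A' : hat (A *m A') = hat A *m hat A'.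
Proof.
rewrite /hat -/C -[A in LHS]mulmx1 -frameCB; move: C => K; by mxring.
Qed.

Lemma hatD A A' : hat (A + A') = hat A + hat A'.
Proof. by rewrite /hat; move: (G *m B^T) => K; mxring. Qed.

Lemma hatN A : hat (- A) = - hat A.
Proof. by rewrite /hat; move: (G *m B^T) => K; mxring. Qed.

Lemma hatZ c A : hat (c *: A) = c *: hat A.
Proof. by rewrite /hat -scalemxAr -scalemxAl. Qed.

Lemma hat0 : hat 0 = 0.
Proof. by rewrite /hat mulmx0 mul0mx. Qed.

Lemma hat_J : hat J = J0.
Proof. by rewrite /hat BJ -mulmxA -/C frameBC mulmx1. Qed.

Lemma hat_scalar c : hat c%:M = c%:M.
Proof. by rewrite /hat mul_mx_scalar -scalemxAl -/C frameBC scalemx1. Qed.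

Lemma hat_form A : hat A = B *m (A *m G) *m B^T.
Proof. by rewrite /hat !mulmxA. Qed.

Lemma hat_inj A : hat A = 0 -> A = 0.
Proof.
move=> A0; have : C *m hat A *m B = A.
  rewrite /hat -/C; move: C frameCB => K KB.
  by rewrite !mulmxA KB mul1mx -mulmxA KB mulmx1.
by rewrite A0 mulmx0 mul0mx.
Qed.

Lemma mxtrace_hat A : \tr (hat A) = \tr A.
Proof. by rewrite /hat -mulmxA mxtrace_mulC -mulmxA -/C frameCB mulmx1. Qed.

Lemma hat_fr P i : hat (fr B P i) = fr B (fun a => hat (P a)) i.
Proof.
by rewrite /hat /fr mulmx_sumr mulmx_suml; apply: eq_bigr => k _;
  rewrite -scalemxAr -scalemxAl.
Qed.

Lemma fr_inverse (L : lmodType R) (T : 'I_4 -> L) k :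
  \sum_i C k i *: fr B T i = T k.
Proof.
have E a : \sum_i C k i *: (B i a *: T a) = (k == a)%:R *: T a.
  transitivity ((\sum_i C k i * B i a) *: T a).
    by rewrite scaler_suml; apply: eq_bigr => i _; rewrite scalerA.
  by rewrite -mulmx_ijE frameCB mxE.
rewrite /fr; under eq_bigr do rewrite scaler_sumr.
rewrite exchange_big/=; under eq_bigr do rewrite E.
rewrite (bigD1 k)//= eqxx scale1r big1 ?addr0// => a /negPf ak.
by rewrite eq_sym ak scale0r.
Qed.

Lemma fr_contract (L : lmodType R) (A : M4) (X : 'I_4 -> L) j :
  fr B (fun k => \sum_a A k a *: X a) j = \sum_a hat A j a *: fr B X a.
Proof.
transitivity (\sum_b (hat A *m B) j b *: X b); last first.
  rewrite /fr; under [RHS]eq_bigr do rewrite scaler_sumr.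
  rewrite exchange_big/=; apply: eq_bigr => b _.
  by rewrite mulmx_ijE scaler_suml; apply: eq_bigr => a _; rewrite scalerA.
have -> : hat A *m B = B *m A by rewrite /hat -/C -mulmxA frameCB mulmx1.
rewrite /fr; under eq_bigr do rewrite scaler_sumr.
rewrite exchange_big/=; apply: eq_bigr => b _.
by rewrite mulmx_ijE scaler_suml; apply: eq_bigr => a _; rewrite scalerA.
Qed.

Lemma fr2_inj (L : lmodType R) (T : 'I_4 -> 'I_4 -> L) :
  (forall i j, fr2 B T i j = 0) -> forall a b, T a b = 0.
Proof.
move=> T0 a b; rewrite -(fr_inverse (T a) b) big1// => j _.
rewrite -(fr_inverse (fun a => fr B (T a) j) a) big1 ?scaler0// => i _.
by rewrite -/(fr2 B T i j) T0 scaler0.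
Qed.

Definition hat1 (P : 'I_4 -> M4) i : M4 := hat (fr B P i).
Definition hat2 (F : 'I_4 -> 'I_4 -> M4) i j : M4 := hat (fr2 B F i j).

Lemma hat_skew A : A *m G + (A *m G)^T = 0 -> hat A + (hat A)^T = 0.
Proof.
move=> sk; rewrite hat_form.
have -> : (B *m (A *m G) *m B^T)^T = B *m (A *m G)^T *m B^T.
  by rewrite !trmx_mul trmxK mulmxA.
by rewrite -mulmxDl -mulmxDr sk mulmx0 mul0mx.
Qed.

Lemma skew_fr P i : (forall a, P a *m G + (P a *m G)^T = 0) ->
  fr B P i *m G + (fr B P i *m G)^T = 0.
Proof.
move=> sk; rewrite -fr_mulmxr -fr_tr -frD -[RHS](fr0 B M4 i).
exact: eq_fr.
Qed.

Lemma hat1_skew P i : (forall a, P a *m G + (P a *m G)^T = 0) ->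
  hat1 P i + (hat1 P i)^T = 0.
Proof. by move=> sk; apply: hat_skew; apply: skew_fr. Qed.

Lemma hat2_skew F i j : (forall a b, F a b *m G + (F a b *m G)^T = 0) ->
  hat2 F i j + (hat2 F i j)^T = 0.
Proof. by move=> sk; apply: hat_skew; apply: skew_fr => a; apply: skew_fr. Qed.

Lemma hat2_comm Q F :
  (forall k l, Q k l - Q l k = F k l *m J - J *m F k l) ->
  forall i j, hat2 Q i j - hat2 Q j i = hat2 F i j *m J0 - J0 *m hat2 F i j.
Proof.
move=> E i j; rewrite -hat_J -!hatM -!hatN -!hatD; congr hat.
rewrite (fr2_swap B Q i j) -fr2_mulmxr -fr2_mulmxl -!fr2N -!fr2D.
exact: eq_fr2.
Qed.

Lemma hat_fr_mul P P' i j : hat1 P i *m hat1 P' j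
  = hat (fr2 B (fun a b => P a *m P' b) i j).
Proof.
rewrite -hatM; congr hat; rewrite -fr_mulmxr; apply: eq_fr => a.
by rewrite -fr_mulmxl.
Qed.

Lemma hat2_anticomm Q P :
  (forall m k, Q m k *m J + J *m Q m k + P k *m P m + P m *m P k = 0) ->
  forall i j, hat2 Q i j *m J0 + J0 *m hat2 Q i j
    + hat1 P j *m hat1 P i + hat1 P i *m hat1 P j = 0.
Proof.
move=> E i j; rewrite !hat_fr_mul (fr2_swap B (fun a b => P a *m P b) i j).
by rewrite -hat_J -!hatM -!hatD -fr2_mulmxr -fr2_mulmxl -!fr2D fr2_0 ?hat0.
Qed.

Lemma hat1_anticomm P : (forall k, P k *m J + J *m P k = 0) ->
  forall i, hat1 P i *m J0 + J0 *m hat1 P i = 0.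
Proof.
move=> E i; rewrite -hat_J -!hatM -hatD -fr_mulmxr -fr_mulmxl -frD.
by rewrite (eq_fr _ _ E) fr0 hat0.
Qed.

Lemma hat2N F : (forall k l, F k l = - F l k) -> forall i j, hat2 F i j = - hat2 F j i.
Proof.
move=> FN i j; rewrite -hatN; congr hat; rewrite (fr2_swap B F i j) -fr2N.
exact: eq_fr2.
Qed.

Lemma hat1_entry P i j k :
  hat1 P i j k = fr3 B (fun a b c => (P a *m G) b c : R^o) i j k.
Proof.
rewrite /hat1 hat_form form_frame /fr3 /fr2.
rewrite [RHS](fr_swap B (fun a b => fr B (fun c => (P a *m G) b c : R^o) k)).
apply: eq_fr => b; rewrite [RHS](fr_swap B (fun a c => (P a *m G) b c : R^o)).
by apply: eq_fr => c; rewrite -fr_mulmxr /fr summxE; apply: eq_bigr => a _; rewrite mxE.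
Qed.

Lemma hat1_closed P :
  (forall i j k, (P i *m G) j k + (P j *m G) k i + (P k *m G) i j = 0) ->
  forall i j k, hat1 P i j k + hat1 P j k i + hat1 P k i j = 0.
Proof. by move=> cl i j k; rewrite !hat1_entry; apply: cyclic_fr3. Qed.

Lemma hat2_closed Q :
  (forall m i j k, (Q m i *m G) j k + (Q m j *m G) k i + (Q m k *m G) i j = 0) ->
  forall m i j k, hat2 Q m i j k + hat2 Q m j k i + hat2 Q m k i j = 0.
Proof.
move=> cl m i j k.
have E a b c : hat2 Q m a b c = hat1 (fun k => fr B (Q^~ k) m) a b c.
  by rewrite /hat2 /hat1 /fr2 fr_swap.
rewrite !E; apply: hat1_closed => a b c.
have E2 u v w : (fr B (Q^~ u) m *m G) v w = fr B (fun d => (Q d u *m G) v w : R^o) m.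
  by rewrite -fr_mulmxr /fr summxE; apply: eq_bigr => d _; rewrite mxE.
rewrite !E2 -!frD -[RHS](fr0 B R^o m); apply: eq_fr => d; exact: cl.
Qed.

Lemma hat2_entry F i j k q :
  hat2 F i j k q = fr3 B (fun a b c => (F a b *m C) c q : R^o) i j k.
Proof.
rewrite /hat2 /hat -/C -mulmxA mxE.
transitivity (fr B (fun c => fr2 B (fun a b => (F a b *m C) c q : R^o) i j) k).
  apply: eq_bigr => c _; congr (_ * _); rewrite -fr2_mulmxr /fr2 /fr summxE.
  apply: eq_bigr => a _; rewrite mxE summxE; congr (_ * _).
  by apply: eq_bigr => b _; rewrite mxE.
rewrite /fr3 /fr2 fr_swap; apply: eq_fr => a.
by rewrite fr_swap.
Qed.

Lemma hat2_bianchi (F : 'I_4 -> 'I_4 -> M4) :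
  (forall k l m p, F k l m p + F l m k p + F m k l p = 0) ->
  forall i j k l, hat2 F i j k l + hat2 F j k i l + hat2 F k i j l = 0.
Proof.
move=> b1 i j k q; rewrite !hat2_entry; apply: cyclic_fr3 => a b c.
rewrite !mulmx_ijE -!big_split big1//= => d _.
by rewrite -!mulrDl b1 mul0r.
Qed.

Lemma fr2_delta i j : fr2 B (fun a b => delta_mx a b : M4) i j
  = B^T *m delta_mx i j *m B.
Proof.
apply/matrixP => u v; rewrite -mulmxA mxE (bigD1 i)//= big1 ?addr0; last first.
  by move=> k /negPf ki; rewrite delta_mulmx_ijE ki mul0r mulr0.
rewrite delta_mulmx_ijE eqxx mul1r mxE.
transitivity (\sum_a B i a * \sum_b B j b * ((u == a) && (v == b))%:R).
  rewrite /fr2 /fr summxE; apply: eq_bigr => a _; rewrite mxE summxE; congr (_ * _).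
  by apply: eq_bigr => b _; rewrite !mxE.
have S a : \sum_b B j b * ((u == a) && (v == b))%:R = (u == a)%:R * B j v.
  rewrite (bigD1 v)//= eqxx andbT mulrC big1 ?addr0// => b /negPf bv.
  by rewrite (eq_sym v) bv andbF mulr0.
rewrite (bigD1 u)//= S eqxx mul1r big1 ?addr0// => a /negPf au.
by rewrite S eq_sym au mul0r mulr0.
Qed.

Lemma hat2_wedge i j : hat2 (wedge_endo G) i j = wedge R i j.
Proof.
have E : fr2 B (wedge_endo G) i j = G *m B^T *m wedge R i j *m B.
  rewrite /wedge_endo fr2_mulmxl fr2D fr2N (fr2_delta i j).
  rewrite -(fr2_swap B (fun a b => delta_mx a b : M4) i j) (fr2_delta j i).
  by rewrite /wedge; move: (delta_mx i j) (delta_mx j i) => X Y; mxring.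
rewrite /hat2 E /hat -/C; move: C frameBC => K BK.
by rewrite !mulmxA BK mul1mx -mulmxA BK mulmx1.
Qed.

Lemma hat_bianchi2 F P (dmu : 'I_4 -> R) :
  (forall m k l,
    (F k l *m P m - P m *m F k l) + (F l m *m P k - P k *m F l m)
      + (F m k *m P l - P l *m F m k)
    = dmu m *: (wedge_endo G k l *m J - J *m wedge_endo G k l)
      + dmu k *: (wedge_endo G l m *m J - J *m wedge_endo G l m)
      + dmu l *: (wedge_endo G m k *m J - J *m wedge_endo G m k)) ->
  let hP := hat1 P in let hF := hat2 F in
  let d i := fr B (dmu : 'I_4 -> R^o) i in
  forall m k l,
    (hF k l *m hP m - hP m *m hF k l) + (hF l m *m hP k - hP k *m hF l m)
      + (hF m k *m hP l - hP l *m hF m k)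
    = d m *: std_comm R k l + d k *: std_comm R l m + d l *: std_comm R m k.
Proof.
move=> H hP hF d m k l.
pose X a b c := F b c *m P a - P a *m F b c
  - dmu a *: (wedge_endo G b c *m J - J *m wedge_endo G b c).
have X0 a b c : X a b c + X b c a + X c a b = 0.
  have := H a b c; rewrite /X => /eqP; rewrite -subr_eq0 => /eqP E.
  rewrite -[RHS]E; move: (dmu a *: _) (dmu b *: _) (dmu c *: _) => r s t.
  by mxring.
have HX i j n : hat (fr3 B X i j n)
    = hF j n *m hP i - hP i *m hF j n - d i *: std_comm R j n.
  have E : fr3 B X i j n = fr2 B F j n *m fr B P i - fr B P i *m fr2 B F j n
    - d i *: (fr2 B (wedge_endo G) j n *m J - J *m fr2 B (wedge_endo G) j n).
    set Wj := fr2 B (wedge_endo G) j n *m J - J *m fr2 B (wedge_endo G) j n.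
    have Xa a : fr2 B (X a) j n = fr2 B F j n *m P a - P a *m fr2 B F j n
        - dmu a *: Wj.
      by rewrite /Wj -!fr2_mulmxl -!fr2_mulmxr -!fr2N -!fr2D -fr2Z -fr2N -fr2D.
    have D : fr B (fun a => dmu a *: Wj) i = d i *: Wj.
      by rewrite /d /fr scaler_suml; apply: eq_bigr => a _; rewrite scalerA.
    rewrite /fr3 (eq_fr B i Xa) -fr_mulmxl -fr_mulmxr -D.
    by rewrite -!frN -!frD.
  rewrite E !hatD !hatN hatZ hatD hatN !hatM hat_J -/(hat2 (wedge_endo G) j n) hat2_wedge.
  by [].
have := cyclic_fr3 B m k l X0 => /(congr1 hat); rewrite hat0 !hatD !HX => E.
apply/eqP; rewrite -subr_eq0 -[X in _ == X]E; apply/eqP.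
by move: (d m *: _) (d k *: _) (d l *: _) => r s t; mxring.
Qed.

End FrameChange.

Section FrameExistence.
Variable R : realType.
Local Notation V := 'rV[R]_4.
Local Notation M4 := 'M[R]_4.
Local Notation J0 := (J0 R).
Local Notation phi0 := (phi0 R).
Local Notation psi0 := (psi0 R).

Lemma form_row (G B : M4) i j : (B *m G *m B^T) i j = bil G (row i B) (row j B).
Proof.
rewrite /bil mxE [RHS]mxE; apply: eq_bigr => k _; congr (_ * _).
  by rewrite -row_mul [RHS]mxE.
by rewrite !mxE.
Qed.

Lemma row_J0 (B : M4) :
  [/\ row i0 (J0 *m B) = row i1 B, row i1 (J0 *m B) = - row i0 B,
      row i2 (J0 *m B) = row i3 B & row i3 (J0 *m B) = - row i2 B].
Proof. by split; apply/rowP => j; rewrite mxE J0mulE !mxE. Qed.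

Definition frame4 (u v w z : V) : M4 :=
  \matrix_i (if i == i0 then u else if i == i1 then v else if i == i2 then w else z).

Lemma row_frame4 u v w z :
  [/\ row i0 (frame4 u v w z) = u, row i1 (frame4 u v w z) = v,
      row i2 (frame4 u v w z) = w & row i3 (frame4 u v w z) = z].
Proof. by split; rewrite rowK. Qed.

Variables (G J : M4).
Hypothesis GT : G^T = G.
Hypothesis Gpos : forall X : V, X != 0 -> 0 < bil G X X.
Hypothesis JG : J *m G *m J^T = G.
Hypothesis JJ : J *m J = - 1%:M.
Implicit Types X Y : V.

Lemma bilC X Y : bil G X Y = bil G Y X.
Proof.
by rewrite /bil -[X *m G *m Y^T]trmxK mxE !trmx_mul trmxK GT mulmxA.
Qed.

Lemma bil_J X Y : bil G (X *m J) (Y *m J) = bil G X Y.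
Proof. by rewrite /bil trmx_mul -{2}JG !mulmxA. Qed.

Lemma bil_Jr X Y : bil G X (Y *m J) = - bil G (X *m J) Y.
Proof.
rewrite -bil_J -(mulmxA Y) JJ mulmxN mulmx1 /bil linearN/= mulmxN mxE.
by [].
Qed.

Lemma bil_XJ X : bil G X (X *m J) = 0.
Proof.
have := bil_Jr X X; rewrite [in RHS]bilC => /eqP; rewrite -addr_eq0 -mulr2n.
by rewrite mulrn_eq0 => /eqP.
Qed.

Lemma bilZ c X : bil G (c *: X) (c *: X) = c ^+ 2 * bil G X X.
Proof. by rewrite /bil linearZ/= -!scalemxAl -scalemxAr !mxE expr2 mulrA. Qed.

Lemma bilZl c X Y : bil G (c *: X) Y = c * bil G X Y.
Proof. by rewrite /bil -!scalemxAl mxE. Qed.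

Lemma unit_vector X : X != 0 -> exists c, bil G (c *: X) (c *: X) = 1.
Proof.
move=> /Gpos X0; exists (Num.sqrt (bil G X X))^-1.
by rewrite bilZ exprVn sqr_sqrtr ?ltW// mulVf// gt_eqF.
Qed.

Lemma adapted_frame_exists : exists B : M4,
  B *m G *m B^T = 1%:M /\ B *m J = J0 *m B.
Proof.
have [c c1] : exists c, bil G (c *: delta_mx 0 i0) (c *: delta_mx 0 i0) = 1.
  apply: unit_vector; apply/eqP => /matrixP/(_ 0 i0); rewrite !mxE !eqxx => /eqP.
  by rewrite oner_eq0.
set e := c *: _ in c1.
pose K : 'M[R]_(4, 1 + 1) := row_mx (G *m e^T) (G *m (e *m J)^T).
have [y y0 yK] : exists2 y : V, y != 0 & y *m K = 0.
  have rk : (0 < \rank (kermx K))%N.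
    rewrite mxrank_ker subn_gt0 (leq_ltn_trans (rank_leq_col K))//.
  have /rowV0Pn [y /sub_kermxP yK y0] : kermx K != 0 by rewrite -mxrank_eq0 -lt0n.
  by exists y.
move: yK; rewrite /K mul_mx_row => /eqP; rewrite row_mx_eq0 => /andP[/eqP k1 /eqP k2].
have y1 : bil G y e = 0 by rewrite /bil -mulmxA k1 mxE.
have y2 : bil G y (e *m J) = 0 by rewrite /bil -mulmxA k2 mxE.
have [d d1] := unit_vector y0.
set f := d *: y in d1.
have f1 : bil G f e = 0 by rewrite bilZl y1 mulr0.
have f2 : bil G f (e *m J) = 0 by rewrite bilZl y2 mulr0.
exists (frame4 e (e *m J) f (f *m J)).
have [r0 r1 r2 r3] := row_frame4 e (e *m J) f (f *m J).
have f1' : bil G e f = 0 by rewrite bilC.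
have f2' : bil G (e *m J) f = 0 by rewrite bilC.
have f3 : bil G e (f *m J) = 0 by rewrite bil_Jr f2' oppr0.
have f3' : bil G (f *m J) e = 0 by rewrite bilC.
have e3 : bil G (e *m J) e = 0 by rewrite bilC bil_XJ.
have e4 : bil G (f *m J) f = 0 by rewrite bilC bil_XJ.
have [s0 s1 s2 s3] := row_J0 (frame4 e (e *m J) f (f *m J)).
split; last first.
  apply/row_matrixP; apply: ord4P; rewrite row_mul ?(s0, s1, s2, s3) ?(r0, r1, r2, r3)//.
    by rewrite -mulmxA JJ mulmxN mulmx1.
  by rewrite -mulmxA JJ mulmxN mulmx1.
have I i j : (1%:M : M4) i j = (i == j)%:R by rewrite mxE.
apply: matrix4P; do ![split]; rewrite form_row I ?(r0, r1, r2, r3) ?bil_J /=.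
all: by rewrite ?bil_XJ ?(c1, d1, f1, f2, f1', f2', f3, f3', e3, e4).
Qed.

Variable P : 'I_4 -> M4.
Hypothesis Pskew : forall k, P k *m G + (P k *m G)^T = 0.
Hypothesis Panti : forall k, P k *m J + J *m P k = 0.
Hypothesis Pclosed : forall i j k,
  (P i *m G) j k + (P j *m G) k i + (P k *m G) i j = 0.

(** Skewness and anticommutation with J put each component of P in the plane of
    phi0 and psi0, and closedness leaves the four components of a 1-form. *)
Lemma generic_frame (B : M4) : B *m G *m B^T = 1%:M -> B *m J = J0 *m B ->
  exists a0 d0 a2 d2 : R, let hP := hat1 G B P in
  [/\ hP i0 = a0 *: phi0 - d0 *: psi0, hP i1 = d0 *: phi0 + a0 *: psi0,
      hP i2 = a2 *: phi0 - d2 *: psi0 & hP i3 = d2 *: phi0 + a2 *: psi0].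
Proof.
move=> BG BJ.
pose hP := hat1 G B P.
have sk i : hP i + (hP i)^T = 0 by exact: hat1_skew.
have ac i : hP i *m J0 + J0 *m hP i = 0 by exact: (hat1_anticomm BG BJ Panti).
have cl i j k : hP i j k + hP j k i + hP k i j = 0 by exact: hat1_closed.
have ent i : [/\ hP i i0 i1 = 0, hP i i2 i3 = 0, hP i i1 i3 = - hP i i0 i2 &
    hP i i1 i2 = hP i i0 i3].
  by apply: skew_anticomm_entries => //; rewrite mulr0 oppr0 raddf0.
have S k i j : hP k i j = - hP k j i by exact: skew_entry.
have form i : hP i = hP i i0 i2 *: phi0 - hP i i0 i3 *: psi0.
  have [e1 e2 e3 e4] := ent i.
  have D k : hP i k k = 0 by exact: skew_diag.
  have E2 (X Y : M4) (r s : R) k l : (r *: X - s *: Y) k l = r * X k l - s * Y k l.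
    by rewrite !mxE.
  apply: matrix4P; do ![split]; rewrite E2 phi0E psi0E !wedgeE /= ?D.
  all: rewrite ?(S i i1 i0) ?(S i i2 i0) ?(S i i3 i0) ?(S i i2 i1) ?(S i i3 i1) ?(S i i3 i2).
  all: rewrite ?e1 ?e2 ?e3 ?e4.
  all: try ring.

have [p1 p2 p3 p4] := ent i0; have [q1 q2 q3 q4] := ent i1.
have [r1 r2 r3 r4] := ent i2; have [s1 s2 s3 s4] := ent i3.
have := (cl i0 i1 i2, cl i0 i1 i3, cl i0 i2 i3, cl i1 i2 i3).
rewrite p4 p3 p2 q2 r1 s1 s4 (S i1 i2 i0) (S i1 i3 i0) (S i2 i3 i0) (S i2 i3 i1) r3.
move=> [] [] [] c1 c2 c3 c4.
exists (hP i0 i0 i2), (hP i0 i0 i3), (hP i2 i0 i2), (hP i2 i0 i3).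
have F1 : hP i1 = hP i0 i0 i3 *: phi0 + hP i0 i0 i2 *: psi0.
  by rewrite form -scaleNr; congr (_ *: _ + _ *: _); lra.
have F3 : hP i3 = hP i2 i0 i3 *: phi0 + hP i2 i0 i2 *: psi0.
  by rewrite form -scaleNr; congr (_ *: _ + _ *: _); lra.
by split; [exact: form | exact: F1 | exact: form | exact: F3].
Qed.

(** The rotation aligning the first two frame vectors with a 1-form; it lies
    in the special unitary group, so it commutes with the quaternions. *)
Definition rotation (a0 d0 a2 d2 : R) : M4 := \matrix_(i, j)
  nth 0 (nth [::] [:: [:: a0; d0; a2; d2]; [:: - d0; a0; - d2; a2];
    [:: - a2; d2; a0; - d0]; [:: - d2; - a2; d0; a0]] i) j.

Lemma rotationE a0 d0 a2 d2 i j : rotation a0 d0 a2 d2 i j =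
  nth 0 (nth [::] [:: [:: a0; d0; a2; d2]; [:: - d0; a0; - d2; a2];
    [:: - a2; d2; a0; - d0]; [:: - d2; - a2; d0; a0]] i) j.
Proof. by rewrite mxE. Qed.

Lemma rotation_quaternion a0 d0 a2 d2 : let K := rotation a0 d0 a2 d2 in
  [/\ K *m J0 = J0 *m K, K *m phi0 = phi0 *m K, K *m psi0 = psi0 *m K &
     K *m K^T = (a0 ^+ 2 + d0 ^+ 2 + a2 ^+ 2 + d2 ^+ 2)%:M].
Proof.
move=> K; split; apply: matrix4P; do ![split].
all: rewrite ?(mulJ0E, J0mulE, mulphi0E, phi0mulE, mulpsi0E, psi0mulE).
all: rewrite ?mulmx4E ?[(_^T) _ _]mxE ?rotationE /= ?opprK//.
all: rewrite ?mulmx4E ![(_%:M) _ _]mxE ?[(_^T) _ _]mxE ?rotationE /=.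
all: ring.
Qed.

(** Where the derivative of J does not vanish, some adapted frame has its last
    two vectors in the nullity. *)
Lemma aligned_frame : (exists k, P k != 0) -> exists (B : M4) (p : R),
  [/\ B *m G *m B^T = 1%:M, B *m J = J0 *m B, p != 0 &
    [/\ hat1 G B P i0 = p *: phi0, hat1 G B P i1 = p *: psi0,
       hat1 G B P i2 = 0 & hat1 G B P i3 = 0]].
Proof.
move=> [k Pk].
have [B0 [B0G B0J]] := adapted_frame_exists.
have [a0 [d0 [a2 [d2 /= [h0 h1 h2 h3]]]]] := generic_frame B0G B0J.
pose n := a0 ^+ 2 + d0 ^+ 2 + a2 ^+ 2 + d2 ^+ 2.
have n_ge0 : 0 <= n by rewrite !addr_ge0// sqr_ge0.
have n0 : n != 0.
  apply/eqP => /eqP; rewrite /n !paddr_eq0 ?sqr_ge0 ?addr_ge0 ?sqr_ge0//.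
  rewrite !sqrf_eq0 => /andP[/andP[/andP[/eqP A0 /eqP D0] /eqP A2] /eqP D2].
  move: Pk; rewrite -(fr_inverse B0G P k) big1 ?eqxx// => i _.
  suff -> : fr B0 P i = 0 by rewrite scaler0.
  apply: (hat_inj B0G); elim/ord4P: i.
  - by rewrite [LHS]h0 A0 D0 !scale0r subr0.
  - by rewrite [LHS]h1 A0 D0 !scale0r addr0.
  - by rewrite [LHS]h2 A2 D2 !scale0r subr0.
  - by rewrite [LHS]h3 A2 D2 !scale0r addr0.
pose p := Num.sqrt n.
have pn : n = p ^+ 2 by rewrite sqr_sqrtr.
have p0 : p != 0 by move: n0; rewrite pn sqrf_eq0.
have [KJ Kphi Kpsi KK] := rotation_quaternion a0 d0 a2 d2.
pose K := p^-1 *: rotation a0 d0 a2 d2.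
have KT : K *m K^T = 1%:M.
  rewrite /K linearZ/= -scalemxAl -scalemxAr scalerA KK -/n pn scale_scalar_mx.
  by congr _%:M; field.
have B1 (X : M4) : rotation a0 d0 a2 d2 *m X = X *m rotation a0 d0 a2 d2 ->
    K *m X *m K^T = X.
  move=> XK; have -> : K *m X = X *m K by rewrite /K -scalemxAl XK scalemxAr.
  by rewrite -mulmxA KT mulmx1.
exists (K *m B0), p; split=> //.
- by rewrite trmx_mul -!mulmxA (mulmxA B0) (mulmxA (B0 *m G)) B0G mul1mx KT.
- by rewrite -mulmxA B0J !mulmxA; congr (_ *m _); rewrite /K -scalemxAl KJ -scalemxAr.
have E i : hat1 G (K *m B0) P i = K *m (\sum_l K i l *: hat1 G B0 P l) *m K^T.
  have -> : \sum_l K i l *: hat1 G B0 P l = hat G B0 (fr (K *m B0) P i).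
    have -> : fr (K *m B0) P i = \sum_l K i l *: fr B0 P l.
      rewrite /fr; under [RHS]eq_bigr do rewrite scaler_sumr.
      rewrite exchange_big/=; apply: eq_bigr => j _; rewrite mulmx_ijE scaler_suml.
      by apply: eq_bigr => l _; rewrite scalerA.
    rewrite /hat mulmx_sumr mulmx_suml; apply: eq_bigr => l _.
    by rewrite -scalemxAr -scalemxAl.
  by rewrite /hat1 /hat trmx_mul !mulmxA.
have lin2 (L X Y : M4) x y : L *m X *m L^T = X -> L *m Y *m L^T = Y ->
    L *m (x *: X + y *: Y) *m L^T = x *: X + y *: Y.
  by move=> HX HY; rewrite mulmxDr mulmxDl -!scalemxAr -!scalemxAl HX HY.
have lin i x y : \sum_l K i l *: hat1 G B0 P l = x *: phi0 + y *: psi0 ->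
    hat1 G (K *m B0) P i = x *: phi0 + y *: psi0.
  by move=> S; rewrite E S; apply: lin2; exact: B1.
have KE i l : K i l = p^-1 * rotation a0 d0 a2 d2 i l by rewrite mxE.
have q : p^-1 * n = p by rewrite pn; field.
have S0 : \sum_l K i0 l *: hat1 G B0 P l = (p^-1 * n) *: phi0 + 0 *: psi0.
  rewrite sum4E h0 h1 h2 h3 !KE !rotationE /n /=.
  by move: phi0 psi0 => X Y; apply/matrixP => u v; rewrite !mxE; ring.
have S1 : \sum_l K i1 l *: hat1 G B0 P l = 0 *: phi0 + (p^-1 * n) *: psi0.
  rewrite sum4E h0 h1 h2 h3 !KE !rotationE /n /=.
  by move: phi0 psi0 => X Y; apply/matrixP => u v; rewrite !mxE; ring.
have S2 : \sum_l K i2 l *: hat1 G B0 P l = 0 *: phi0 + 0 *: psi0.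
  rewrite sum4E h0 h1 h2 h3 !KE !rotationE /=.
  by move: phi0 psi0 => X Y; apply/matrixP => u v; rewrite !mxE; ring.
have S3 : \sum_l K i3 l *: hat1 G B0 P l = 0 *: phi0 + 0 *: psi0.
  rewrite sum4E h0 h1 h2 h3 !KE !rotationE /=.
  by move: phi0 psi0 => X Y; apply/matrixP => u v; rewrite !mxE; ring.
split.
- by rewrite (lin _ _ _ S0) q scale0r addr0.
- by rewrite (lin _ _ _ S1) q scale0r add0r.
- by rewrite (lin _ _ _ S2) !scale0r addr0.
- by rewrite (lin _ _ _ S3) !scale0r addr0.
Qed.

End FrameExistence.

(** * The structure equations in a chart *)

Section ChartGeometry.
Variable R : realType.
Local Notation V := 'rV[R]_4.
Local Notation M4 := 'M[R]_4.
Local Notation J0 := (J0 R).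
Local Notation phi0 := (phi0 R).
Local Notation psi0 := (psi0 R).

(** [riem] for arbitrary symbols. *)
Definition riemann (Gam : V -> 'I_4 -> M4) (g : V -> M4) x (X Y Z W : V) : R :=
  \sum_k \sum_l X 0 k * Y 0 l * bil (curvature Gam x k l *m g x) Z W.

Variables (U : set V) (g : V -> M4) (Gam : V -> 'I_4 -> M4) (J : V -> M4).
Hypotheses (oU : open U) (sg : smooth_on_mx U g).
Hypothesis gT : forall x, U x -> (g x)^T = g x.
Hypothesis gpos : forall x, U x -> forall X : V, X != 0 -> 0 < bil (g x) X X.
Hypothesis smooth_Gam : forall k, smooth_on_mx U (Gam ^~ k).
Hypothesis Gam_metric : forall x k, U x ->
  partial_mx k g x = Gam x k *m g x + g x *m (Gam x k)^T.
Hypothesis GamC : forall x i k l, U x -> Gam x k i l = Gam x i k l.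
Hypothesis sJ : smooth_on_mx U J.
Hypothesis JJ : forall x, U x -> J x *m J x = - 1%:M.
Hypothesis JG : forall x, U x -> J x *m g x *m (J x)^T = g x.
Hypothesis closed : forall x, U x -> forall i j k,
  partial i (fun y => (J y *m g y) j k) x + partial j (fun y => (J y *m g y) k i) x
    + partial k (fun y => (J y *m g y) i j) x = 0.
Hypothesis G2 : forall x, U x -> forall X Y Z W,
  riemann Gam g x X Y Z W - riemann Gam g x (X *m J x) (Y *m J x) Z W
  = riemann Gam g x (X *m J x) Y (Z *m J x) W + riemann Gam g x (X *m J x) Y Z (W *m J x).
Implicit Types x : V.

Let P k := covd Gam k J.
Let Q x m k := hessian Gam J x m k.
Let F x k l := curvature Gam x k l.

Let gu x (Ux : U x) : g x \in unitmx := positive_unitmx (gpos Ux).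

Lemma smooth_P k : smooth_on_mx U (P k).
Proof. exact: smooth_covd. Qed.

Lemma J_skew x : U x -> J x *m g x + (J x *m g x)^T = 0.
Proof.
move=> Ux; have : J x *m (J x *m g x *m (J x)^T) = J x *m g x by rewrite JG.
rewrite !mulmxA JJ// mulNmx mul1mx mulNmx trmx_mul gT// => <-.
by rewrite addNr.
Qed.

Lemma P_skew k x : U x -> P k x *m g x + (P k x *m g x)^T = 0.
Proof. move=> Ux; exact: (covd_skew oU sg Gam_metric k Ux sJ J_skew). Qed.

Lemma P_anticomm k x : U x -> P k x *m J x + J x *m P k x = 0.
Proof.
move=> Ux; have dJ := smooth_differentiable_mx sJ Ux.
rewrite -(covdM Gam k dJ dJ).
rewrite (eq_covd Gam oU k Ux (A' := fun=> (- 1)%:M)) ?covd_cst_scalar// => z Uz.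
by rewrite JJ// raddfN.
Qed.

Lemma P_closed i j k x : U x ->
  (P i x *m g x) j k + (P j x *m g x) k i + (P k x *m g x) i j = 0.
Proof.
move=> Ux; rewrite -(closed Ux i j k).
by rewrite (closed_covd sg Gam_metric GamC i j k Ux sJ (J_skew Ux)).
Qed.

Lemma invmx_frame (G B : M4) : G \in unitmx -> B *m G *m B^T = 1%:M -> invmx G = B^T *m B.
Proof.
move=> uG BG; have CB : G *m (B^T *m B) = 1%:M.
  by have := mulmx1C (etrans (mulmxA _ _ _) BG); rewrite mulmxA.
by rewrite -[RHS]mul1mx -(mulVmx uG) -mulmxA CB mulmx1.
Qed.

(** The endomorphism dual to the 2-tensor tr (P X P Y); minus its trace is,
    up to a constant, the squared norm of the derivative of J. *)
Definition trace_form x : M4 := \matrix_(k, l) \tr (P k x *m P l x).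
Definition trace_endo x : M4 := trace_form x *m invmx (g x).
Definition norm_dJ x : R := - \tr (trace_endo x).

Lemma smooth_trace_endo : smooth_on_mx U trace_endo.
Proof.
apply: smooth_on_mxM => //; last exact: smooth_on_invmx.
move=> k l; under eq_fun do rewrite mxE.
by apply: smooth_on_tr => //; apply: smooth_on_mxM => //; exact: smooth_P.
Qed.

Lemma smooth_norm_dJ : smooth_on U norm_dJ.
Proof.
by apply: smooth_onN => //; apply: smooth_on_tr => //; exact: smooth_trace_endo.
Qed.

Definition dtrace_form x m : M4 :=
  \matrix_(k, l) (\tr (Q x m k *m P l x) + \tr (P k x *m Q x m l)).

Lemma covd_trace_endo m x : U x ->
  covd Gam m trace_endo x = dtrace_form x m *m invmx (g x).
Proof.
move=> Ux; have sT := smooth_trace_endo.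
have TgE y : U y -> trace_endo y *m g y = trace_form y.
  by move=> Uy; rewrite /trace_endo mulmxKV// gu.
have := partial_lower sg Gam_metric m Ux sT; rewrite TgE// => H.
suff : covd Gam m trace_endo x *m g x = dtrace_form x m.
  by move=> <-; rewrite mulmxK// gu.
have -> : covd Gam m trace_endo x *m g x = partial_mx m trace_form x
    - Gam x m *m trace_form x - trace_form x *m (Gam x m)^T.
  rewrite -(eq_partial_mx m oU Ux TgE) H.
  by mxring.
apply/matrixP => k l.
have e3 (A X Y : M4) (r s t u : R) : A k l = r -> X k l = s -> Y k l = t ->
  r - s - t = u -> (A - X - Y) k l = u by move=> <- <- <- <-; rewrite !mxE.
have dP j := smooth_differentiable_mx (smooth_P j) Ux.
apply: (e3 _ _ _ (\tr (covd Gam m (P k) x *m P l x) + \tr (P k x *m covd Gam m (P l) x))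
  (\sum_a Gam x m k a * \tr (P a x *m P l x))
  (\sum_a Gam x m l a * \tr (P k x *m P a x))).
- rewrite partial_mxE.
  transitivity (partial m (fun y => \tr (P k y *m P l y)) x).
    by apply: partial_ext => y; rewrite mxE.
  rewrite (partial_trE Gam m (differentiable_mxM (dP k) (dP l))).
  by rewrite (covdM Gam m (dP k) (dP l)) raddfD.
- by rewrite mulmx_ijE; apply: eq_bigr => a _; rewrite mxE.
- by rewrite mulmx_ijE; apply: eq_bigr => a _; rewrite mulrC !mxE.
have trBl (X S Y : M4) : \tr ((X - S) *m Y) = \tr (X *m Y) - \tr (S *m Y).
  by rewrite mulmxBl raddfB.
have trBr (X S Y : M4) : \tr (Y *m (X - S)) = \tr (Y *m X) - \tr (Y *m S).
  by rewrite mulmxBr raddfB.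
rewrite mxE /Q /hessian (trBl (covd Gam m (covd Gam k J) x)).
rewrite (trBr (covd Gam m (covd Gam l J) x)).
have trSl (c : 'I_4 -> R) (X : 'I_4 -> M4) Y :
    \tr ((\sum_a c a *: X a) *m Y) = \sum_a c a * \tr (X a *m Y).
  rewrite mulmx_suml raddf_sum; apply: eq_bigr => a _.
  by rewrite /= -scalemxAl mxtraceZ.
have trSr (c : 'I_4 -> R) (X : 'I_4 -> M4) Y :
    \tr (Y *m (\sum_a c a *: X a)) = \sum_a c a * \tr (Y *m X a).
  rewrite mulmx_sumr raddf_sum; apply: eq_bigr => a _.
  by rewrite /= -scalemxAr mxtraceZ.
rewrite trSl trSr.
have ar (a b c d : R) : a + b - c - d = a - c + (b - d) by ring.
exact: ar.
Qed.

Lemma partial_norm_dJ m x : U x ->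
  partial m norm_dJ x = - \tr (dtrace_form x m *m invmx (g x)).
Proof.
move=> Ux; have dT := smooth_differentiable_mx smooth_trace_endo Ux.
rewrite /norm_dJ partialN; last first.
  exact: smooth_on_differentiable (smooth_on_tr oU smooth_trace_endo) Ux.
by rewrite (partial_trE Gam m dT) covd_trace_endo.
Qed.

(** ** Pointwise facts in an adapted frame *)

Section AtPoint.
Variables (x : V) (B : M4) (p : R).
Hypothesis Ux : U x.
Hypothesis BG : B *m g x *m B^T = 1%:M.
Hypothesis BJ : B *m J x = J0 *m B.
Let hP := hat1 (g x) B (P^~ x).
Let hQ := hat2 (g x) B (Q x).
Let hF := hat2 (g x) B (F x).

Lemma hF_skew i j : hF i j + (hF i j)^T = 0.
Proof.
apply: hat2_skew => a b; rewrite trmx_mul gT//.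
exact (curvature_skew oU sg smooth_Gam Gam_metric a b Ux).
Qed.

Lemma hF_antisym i j : hF i j = - hF j i.
Proof. by apply: hat2N => k l; exact: curvatureN. Qed.

Lemma hF_bianchi i j k l : hF i j k l + hF j k i l + hF k i j l = 0.
Proof.
apply: hat2_bianchi => a b c d; exact (curvature_bianchi1 oU GamC a b c d Ux).
Qed.

Lemma hQ_skew m k : hQ m k + (hQ m k)^T = 0.
Proof.
apply: hat2_skew => a b; apply: (hessian_skew oU sg) => // y Uy; exact: J_skew.
Qed.

Lemma hQ_anticomm m k : hQ m k *m J0 + J0 *m hQ m k + hP k *m hP m + hP m *m hP k = 0.
Proof.
apply: (hat2_anticomm BG BJ) => a b.
by apply: (hessian_anticomm oU smooth_Gam sJ a b Ux).
Qed.

Lemma hQ_closed m i j k : hQ m i j k + hQ m j k i + hQ m k i j = 0.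
Proof.
apply: hat2_closed => a b c d; apply: (hessian_closed oU sg) => // y Uy u v w.
exact: P_closed.
Qed.

Lemma hQ_comm k l : hQ k l - hQ l k = hF k l *m J0 - J0 *m hF k l.
Proof.
apply: (hat2_comm BG BJ) => a b.
exact: (hessian_comm oU smooth_Gam GamC sJ a b Ux).
Qed.

Lemma riemann_frame i j k l :
  riemann Gam g x (row i B) (row j B) (row k B) (row l B) = hF i j k l.
Proof.
rewrite /hF /hat2 hat_form form_row -fr2_mulmxr.
have bil_fr (T : 'I_4 -> M4) a Z W :
    bil (fr B T a) Z W = fr B (fun c => bil (T c) Z W : R^o) a.
  rewrite /bil /fr mulmx_sumr mulmx_suml summxE; apply: eq_bigr => c _.
  by rewrite -scalemxAr -scalemxAl mxE.
rewrite /fr2 bil_fr; apply: eq_bigr => a _; rewrite bil_fr scaler_sumr.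
by apply: eq_bigr => b _; rewrite !mxE -mulrA.
Qed.

Lemma riemannZ a b c d X Y Z W :
  riemann Gam g x (a *: X) (b *: Y) (c *: Z) (d *: W)
    = a * b * c * d * riemann Gam g x X Y Z W.
Proof.
rewrite /riemann mulr_sumr; apply: eq_bigr => k _; rewrite mulr_sumr.
apply: eq_bigr => l _; rewrite /bil linearZ/= -!scalemxAl -scalemxAr !mxE.
by ring.
Qed.

Lemma row_conjJ i : row i B *m J x = sgJ R i *: row (conjJ i) B.
Proof.
rewrite -row_mul BJ; have [s0 s1 s2 s3] := row_J0 B.
by elim/ord4P: i; rewrite ?(s0, s1, s2, s3) /sgJ /conjJ /= ?expr0 ?expr1 ?scale1r ?scaleN1r.
Qed.

Lemma hF_G2 i j k l :
  hF i j k l - sgJ R i * sgJ R j * hF (conjJ i) (conjJ j) k l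
  = sgJ R i * sgJ R k * hF (conjJ i) j (conjJ k) l
    + sgJ R i * sgJ R l * hF (conjJ i) j k (conjJ l).
Proof.
have := G2 Ux (row i B) (row j B) (row k B) (row l B).
rewrite !row_conjJ.
have E a b c d : riemann Gam g x (row a B) (row b B) (row c B) (row d B) = hF a b c d.
  exact: riemann_frame.
have Z2 a b r s Z W : riemann Gam g x (a *: row r B) (b *: row s B) Z W
    = a * b * riemann Gam g x (row r B) (row s B) Z W.
  by rewrite -{1}[Z]scale1r -{1}[W]scale1r riemannZ !mulr1.
have Z13 a b r Y s W : riemann Gam g x (a *: row r B) Y (b *: row s B) W
    = a * b * riemann Gam g x (row r B) Y (row s B) W.
  by rewrite -{1}[Y]scale1r -{1}[W]scale1r riemannZ !mulr1.
have Z14 a b r Y Z s : riemann Gam g x (a *: row r B) Y Z (b *: row s B)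
    = a * b * riemann Gam g x (row r B) Y Z (row s B).
  by rewrite -{1}[Y]scale1r -{1}[Z]scale1r riemannZ !mulr1.
by rewrite Z2 Z13 Z14 !E.
Qed.

Lemma trace_endo_hat i j : hat (g x) B (trace_endo x) i j = \tr (hP i *m hP j).
Proof.
have -> : hat (g x) B (trace_endo x) = B *m trace_form x *m B^T.
  by rewrite /hat /trace_endo -!mulmxA (mulmxA (invmx _)) mulVmx ?gu// mul1mx.
rewrite form_frame /hP (hat_fr_mul BG) (mxtrace_hat BG).
rewrite /fr2 /fr raddf_sum; apply: eq_bigr => a _.
rewrite /= mxtraceZ; congr (_ * _); rewrite raddf_sum; apply: eq_bigr => b _.
by rewrite /= mxtraceZ !mxE.
Qed.

Lemma dtrace_hat m i j :
  fr B (fun a => (B *m dtrace_form x a *m B^T) i j : R^o) m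
    = \tr (hQ m i *m hP j) + \tr (hP i *m hQ m j).
Proof.
have -> : hQ m i = hat1 (g x) B (fun b => fr B ((Q x)^~ b) m) i.
  by rewrite /hQ /hat2 /fr2 fr_swap.
have -> : hQ m j = hat1 (g x) B (fun b => fr B ((Q x)^~ b) m) j.
  by rewrite /hQ /hat2 /fr2 fr_swap.
rewrite !(hat_fr_mul BG) !(mxtrace_hat BG).
have trfr2 (S : 'I_4 -> 'I_4 -> M4) : \tr (fr2 B S i j) = fr2 B (fun a b => \tr (S a b) : R^o) i j.
  rewrite /fr2 /fr raddf_sum; apply: eq_bigr => a _; rewrite /= mxtraceZ.
  by congr (_ * _); rewrite raddf_sum; apply: eq_bigr => b _; rewrite /= mxtraceZ.
rewrite !trfr2 -fr2D.
have -> : fr B (fun a => (B *m dtrace_form x a *m B^T) i j : R^o) m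
   = fr B (fun a => fr2 B (fun b c => dtrace_form x a b c : R^o) i j) m.
  by apply: eq_fr => a; rewrite form_frame.
rewrite /fr2 fr_swap; apply: eq_fr => b; rewrite fr_swap; apply: eq_fr => c.
have trfr (S : 'I_4 -> M4) : \tr (fr B S m) = fr B (fun a => \tr (S a) : R^o) m.
  by rewrite /fr raddf_sum; apply: eq_bigr => a _; rewrite /= mxtraceZ.
rewrite -fr_mulmxr -fr_mulmxl !trfr -frD; apply: eq_fr => a.
by rewrite mxE.
Qed.

Lemma partial_norm_hat m :
  fr B (fun a => partial a norm_dJ x : R^o) m
    = - \sum_i (\tr (hQ m i *m hP i) + \tr (hP i *m hQ m i)).
Proof.
under eq_fr => a do rewrite (partial_norm_dJ a Ux) (invmx_frame (gu Ux) BG).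
rewrite frN; congr (- _).
under [RHS]eq_bigr => i _ do rewrite -dtrace_hat.
rewrite /fr exchange_big/=; apply: eq_bigr => a _.
rewrite -scaler_sumr; congr (_ *: _).
by rewrite mulmxA mxtrace_mulC mulmxA.
Qed.

Section Aligned.
Hypothesis p0 : p != 0.
Hypotheses (h0 : hP i0 = p *: phi0) (h1 : hP i1 = p *: psi0).
Hypotheses (h2 : hP i2 = 0) (h3 : hP i3 = 0).

Lemma trace_hP_diag :
  [/\ \tr (hP i0 *m hP i0) = - 4 * p ^+ 2, \tr (hP i1 *m hP i1) = - 4 * p ^+ 2,
      \tr (hP i2 *m hP i2) = 0 & \tr (hP i3 *m hP i3) = 0].
Proof.
have t1 : \tr (- 1%:M : M4) = - 4 by rewrite raddfN/= mxtrace1.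
rewrite h0 h1 h2 h3 mulmx0 mxtrace0 -!scalemxAl -!scalemxAr phi0_sqr psi0_sqr.
by rewrite !mxtraceZ t1; split=> //; ring.
Qed.

Lemma norm_aligned : norm_dJ x = 8 * p ^+ 2.
Proof.
rewrite /norm_dJ -(mxtrace_hat BG) mxtrace4E !trace_endo_hat.
by have [-> -> -> ->] := trace_hP_diag; ring.
Qed.

Lemma hF_comm i j : hF i j *m J0 - J0 *m hF i j = (- p ^+ 2 / 2) *: std_comm R i j.
Proof.
have [mu H] := G2_scalar hF_antisym hF_skew hF_bianchi hF_G2.
suff <- : mu = - p ^+ 2 / 2 by [].
apply: (mu_frame h0 h1 h2 h3 hQ_skew hQ_anticomm hQ_closed) => k l.
by rewrite hQ_comm H.
Qed.

Lemma curvature_comm_aligned k l : F x k l *m J x - J x *m F x k l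
  = (- norm_dJ x / 16) *: (wedge_endo (g x) k l *m J x - J x *m wedge_endo (g x) k l).
Proof.
apply/eqP; rewrite -subr_eq0; apply/eqP.
pose X a b := F x a b *m J x - J x *m F x a b
  - (- norm_dJ x / 16) *: (wedge_endo (g x) a b *m J x - J x *m wedge_endo (g x) a b).
suff : forall i j, fr2 B X i j = 0 by move=> /(fr2_inj BG)/(_ k l).
move=> i j; apply: (hat_inj BG); rewrite norm_aligned in X *.
have -> : fr2 B X i j = fr2 B (F x) i j *m J x - J x *m fr2 B (F x) i j
  - (- (8 * p ^+ 2) / 16) *: (fr2 B (wedge_endo (g x)) i j *m J x
      - J x *m fr2 B (wedge_endo (g x)) i j).
  by rewrite -!fr2_mulmxl -!fr2_mulmxr -!fr2N -!fr2D -fr2Z -fr2N -fr2D.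
rewrite !(hatD, hatN, hatZ) !(hatM BG) (hat_J BG BJ).
rewrite -/(hat2 (g x) B (F x) i j) -/(hat2 (g x) B (wedge_endo (g x)) i j).
rewrite (hat2_wedge BG) -/hF hF_comm -/(std_comm R i j).
by rewrite -scalerBl (_ : _ - _ = 0) ?scale0r//; field.
Qed.

End Aligned.
End AtPoint.

Lemma aligned_frame_exists x : U x -> norm_dJ x != 0 -> exists (B : M4) (p : R),
  [/\ B *m g x *m B^T = 1%:M, B *m J x = J0 *m B, p != 0 &
    [/\ hat1 (g x) B (P^~ x) i0 = p *: phi0, hat1 (g x) B (P^~ x) i1 = p *: psi0,
       hat1 (g x) B (P^~ x) i2 = 0 & hat1 (g x) B (P^~ x) i3 = 0]].
Proof.
move=> Ux N0; apply: (aligned_frame (gT Ux) (gpos Ux) (JG Ux) (JJ Ux)).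
- by move=> k; exact: P_skew.
- by move=> k; exact: P_anticomm.
- by move=> i j k; exact: P_closed.
apply: contrapT => nP.
have Pk0 k : P k x = 0.
  by apply/eqP/negPn/negP => Pk; apply: nP; exists k.
move/negP: N0; apply; rewrite /norm_dJ /trace_endo.
suff -> : trace_form x = 0 by rewrite mul0mx mxtrace0 oppr0.
apply/matrixP => k l; rewrite !mxE.
by rewrite Pk0 mul0mx mxtrace0.
Qed.

Lemma norm_eq0 x k : U x -> norm_dJ x = 0 -> P k x = 0.
Proof.
move=> Ux N0; apply/eqP/negPn/negP => Pk.
have := aligned_frame (gT Ux) (gpos Ux) (JG Ux) (JJ Ux) (P := P^~ x).
case.
- by move=> a; exact: P_skew.
- by move=> a; exact: P_anticomm.
- by move=> a b c; exact: P_closed.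
- by exists k.
move=> B [p [BG BJ p0 [h0 h1 h2 h3]]].
have := norm_aligned Ux BG h0 h1 h2 h3; rewrite N0 => /esym/eqP.
by rewrite mulf_eq0 sqrf_eq0 (negbTE p0) pnatr_eq0.
Qed.

Lemma curvature_comm x k l : U x -> norm_dJ x != 0 ->
  F x k l *m J x - J x *m F x k l
  = (- norm_dJ x / 16) *: (wedge_endo (g x) k l *m J x - J x *m wedge_endo (g x) k l).
Proof.
move=> Ux N0; have [B [p [BG BJ p0 [h0 h1 h2 h3]]]] := aligned_frame_exists Ux N0.
exact: (curvature_comm_aligned Ux BG BJ h0 h1 h2 h3).
Qed.

(** Exterior covariant derivative of [curvature_comm]: the curvature and the
    tensor of constant curvature are closed, so only the derivatives of J and of
    the scalar remain. *)
Lemma bianchi_commutator x m k l : U x -> norm_dJ x != 0 ->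
  let mu y := - norm_dJ y / 16 in
  let W a b := wedge_endo (g x) a b in
  let F' a b := F x a b - mu x *: W a b in
  (F' k l *m P m x - P m x *m F' k l) + (F' l m *m P k x - P k x *m F' l m)
    + (F' m k *m P l x - P l x *m F' m k)
  = partial m mu x *: (W k l *m J x - J x *m W k l)
    + partial k mu x *: (W l m *m J x - J x *m W l m)
    + partial l mu x *: (W m k *m J x - J x *m W m k).
Proof.
move=> Ux N0 mu W F'.
have dN := smooth_on_differentiable smooth_norm_dJ Ux.
have dJ := smooth_differentiable_mx sJ Ux.
have dmu : differentiable mu x.
  have -> : mu = fun y => (- 16^-1) * norm_dJ y.
    by apply/funext => y; rewrite /mu mulNr mulrC mulNr.
  exact: (smooth_on_differentiable (smooth_onZ _ oU smooth_norm_dJ) Ux).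
pose U' := [set y | U y /\ norm_dJ y != 0].
have oU' : open U'.
  rewrite openE => y [Uy Ny].
  have cN : {for y, continuous norm_dJ}.
    apply: differentiable_continuous.
    exact: smooth_on_differentiable smooth_norm_dJ Uy.
  have nU : nbhs y U by exact: open_nbhs_nbhs.
  have nN : \forall z \near y, norm_dJ z != 0 by exact: cvgr_neq0 cN Ny.
  by apply: filterS2 nU nN => z Uz Nz; split.
have U'x : U' x by split.
have dF a b := smooth_differentiable_mx (smooth_curvature oU smooth_Gam a b) Ux.
have dW a b : differentiable_mx (fun y => wedge_endo (g y) a b) x.
  apply: differentiable_mxM; first exact: smooth_differentiable_mx sg Ux.
  by move=> i j; exact: differentiable_cst.
have dcomm (A : V -> M4) : differentiable_mx A x ->
    differentiable_mx (fun y => A y *m J y - J y *m A y) x.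
  by move=> dA; apply: differentiable_mxB; apply: differentiable_mxM.
have covd_comm' (A : V -> M4) c : differentiable_mx A x ->
    covd Gam c (fun y => A y *m J y - J y *m A y) x
    = (covd Gam c A x *m J x - J x *m covd Gam c A x)
      + (A x *m P c x - P c x *m A x).
  move=> dA; rewrite (covdB Gam c (differentiable_mxM dA dJ) (differentiable_mxM dJ dA)).
  by rewrite (covdM Gam c dA dJ) (covdM Gam c dJ dA) -/(P c); mxring.
have E a b c : (covd Gam c (fun y => F y a b) x *m J x
      - J x *m covd Gam c (fun y => F y a b) x) + (F x a b *m P c x - P c x *m F x a b)
    = partial c mu x *: (W a b *m J x - J x *m W a b)
      + mu x *: ((covd Gam c (fun y => wedge_endo (g y) a b) x *m J x
        - J x *m covd Gam c (fun y => wedge_endo (g y) a b) x)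
        + (W a b *m P c x - P c x *m W a b)).
  rewrite -(covd_comm' _ c (dF a b)) -(covd_comm' _ c (dW a b)).
  rewrite -(covdZ Gam c dmu (dcomm _ (dW a b))).
  by apply: (eq_covd Gam oU' c U'x) => y [Uy Ny]; exact: curvature_comm.
have B2 := curvature_bianchi2 oU smooth_Gam k l m Ux.
have W2 := covd_wedge_endo sg Gam_metric GamC k l m Ux.
have := congr2 +%R (congr2 +%R (E k l m) (E l m k)) (E m k l).
rewrite /F' /F.
move: B2 W2.
move: (covd Gam m (fun y => curvature Gam y k l) x) => B1.
move: (covd Gam k (fun y => curvature Gam y l m) x) => B2.
move: (covd Gam l (fun y => curvature Gam y m k) x) => B3.
move: (covd Gam m (fun y => wedge_endo (g y) k l) x) => C1.
move: (covd Gam k (fun y => wedge_endo (g y) l m) x) => C2.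
move: (covd Gam l (fun y => wedge_endo (g y) m k) x) => C3.
move: (partial m mu x) (partial k mu x) (partial l mu x) (mu x) => d1 d2 d3 u.
move: (W k l) (W l m) (W m k) (curvature Gam x k l) => W1 W2 W3 F1.
move: (curvature Gam x l m) (curvature Gam x m k) (P m x) (P k x) (P l x) (J x).
move=> F2 F3 P1 P2 P3 K hB hC; rewrite /cst /=.
have sc (C W' P' : M4) : u *: (C *m K - K *m C + (W' *m P' - P' *m W'))
  = (u *: C) *m K - K *m (u *: C) + ((u *: W') *m P' - P' *m (u *: W')).
  by rewrite !scalerDr !scalerN -!scalemxAl -!scalemxAr.
have hD : u *: C1 + u *: C2 + u *: C3 = 0 by rewrite -!scalerDr hC scaler0.
rewrite !sc; move: (u *: C1) (u *: C2) (u *: C3) hD => D1 D2 D3 hD.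
move: (u *: W1) (u *: W2) (u *: W3) => V1 V2 V3.
move: (d1 *: _) (d2 *: _) (d3 *: _) => G1 G2' G3 H.
have eB : (B1 + B2 + B3) *m K - K *m (B1 + B2 + B3) = 0.
  by rewrite hB mul0mx mulmx0 subrr.
have eD : (D1 + D2 + D3) *m K - K *m (D1 + D2 + D3) = 0.
  by rewrite hD mul0mx mulmx0 subrr.
apply/eqP; rewrite -subr_eq0; apply/eqP.
move/eqP: H; rewrite -subr_eq0 => /eqP H.
have key (r h b d : M4) : h = 0 -> b = 0 -> d = 0 -> r = h - b + d -> r = 0.
  by move=> -> -> -> ->; rewrite subr0 addr0.
by apply: (key _ _ _ _ H eB eD); mxring.
Qed.

Section ReducedCurvature.
Variables (x : V) (B : M4) (p : R).
Hypothesis Ux : U x.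
Hypothesis BG : B *m g x *m B^T = 1%:M.
Hypothesis BJ : B *m J x = J0 *m B.
Hypothesis p0 : p != 0.
Let hP := hat1 (g x) B (P^~ x).
Let hF := hat2 (g x) B (F x).
Hypotheses (h0 : hP i0 = p *: phi0) (h1 : hP i1 = p *: psi0).
Hypotheses (h2 : hP i2 = 0) (h3 : hP i3 = 0).
Let F' i j := hF i j - (- p ^+ 2 / 2) *: wedge R i j.

Lemma reduced_hF : [/\ forall i j, F' i j = - F' j i,
  forall i j, F' i j + (F' i j)^T = 0,
  forall i j k l, F' i j k l + F' j k i l + F' k i j l = 0 &
  forall i j, F' i j *m J0 - J0 *m F' i j = 0].
Proof.
apply: reduced_curvature.
- exact: hF_antisym.
- exact: hF_skew.
- exact: hF_bianchi.
- exact: (hF_comm Ux BG BJ h0 h1 h2 h3).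
Qed.

Lemma reduced_hF_bianchi2 :
  (forall m, fr B ((fun k => partial k (fun y => - norm_dJ y / 16) x) : 'I_4 -> R^o) m = 0) /\
  let f k l := F' k l i0 i1 + F' k l i2 i3 in
  [/\ f i0 i2 = 0, f i0 i3 = 0, f i1 i2 = 0, f i1 i3 = 0 & f i2 i3 = 0].
Proof.
have N0 : norm_dJ x != 0.
  by rewrite (norm_aligned Ux BG h0 h1 h2 h3) mulf_eq0 pnatr_eq0 sqrf_eq0.
pose mu y := - norm_dJ y / 16.
have H := hat_bianchi2 BG BJ (F := fun a b => F x a b - mu x *: wedge_endo (g x) a b)
  (P := P^~ x) (dmu := fun k => partial k mu x)
  (fun m k l => bianchi_commutator m k l Ux N0).
have muE : mu x = - p ^+ 2 / 2.
  by rewrite /mu (norm_aligned Ux BG h0 h1 h2 h3); field.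
have FE i j : hat2 (g x) B (fun a b => F x a b - mu x *: wedge_endo (g x) a b) i j = F' i j.
  rewrite /F' -muE -(hat2_wedge BG) -hatZ -hatN -hatD /hat2.
  by rewrite -fr2Z -fr2N -fr2D.
have [r1 r2 r3 r4] := reduced_hF.
apply: (bianchi2_frame r1 r2 r3 r4 p0 h0 h1 h2 h3) => m k l.
by rewrite -!FE; exact: H.
Qed.

End ReducedCurvature.

(** The norm is a multiple of the scalar mu, which [bianchi2_frame] shows to be
    stationary; at a zero the derivative vanishes with P. *)
Lemma partial_norm_eq0 x m : U x -> partial m norm_dJ x = 0.
Proof.
move=> Ux; have [N0|N0] := eqVneq (norm_dJ x) 0.
  rewrite partial_norm_dJ// (_ : dtrace_form x m = 0) ?mul0mx ?mxtrace0 ?oppr0//.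
  by apply/matrixP => k l; rewrite !mxE !norm_eq0// mulmx0 mul0mx !mxtrace0 addr0.
have [B [p [BG BJ p0 [h0 h1 h2 h3]]]] := aligned_frame_exists Ux N0.
have [d0 _] := reduced_hF_bianchi2 Ux BG BJ p0 h0 h1 h2 h3.
have := fr_inverse BG ((fun k => partial k (fun y => - norm_dJ y / 16) x) : 'I_4 -> R^o) m.
rewrite big1 => [|i _]; last by rewrite d0 scaler0.
have -> : (fun y => - norm_dJ y / 16) = (fun y => - 16^-1 * norm_dJ y).
  by apply/funext => y; rewrite mulNr mulrC mulNr.
rewrite partialZ; last exact: smooth_on_differentiable smooth_norm_dJ Ux.
by move/esym/eqP; rewrite mulf_eq0 oppr_eq0 invr_eq0 pnatr_eq0 => /eqP.
Qed.

(** ** The projector on the orthogonal complement of the nullity *)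

Section Reversal.
Hypothesis norm_neq0 : forall x, U x -> norm_dJ x != 0.

(** In an aligned frame the trace endomorphism is -4 p^2 on the first two
    vectors and 0 on the nullity, and the norm is 8 p^2. *)
Definition nproj x : M4 := (- 2 / norm_dJ x) *: trace_endo x.
Definition Jbar x : M4 := J x - 2 *: (nproj x *m J x).
Let Pb k := covd Gam k Jbar.

Lemma smooth_nproj : smooth_on_mx U nproj.
Proof.
apply: smooth_on_mxZ => //; last exact: smooth_trace_endo.
by apply: smooth_onZ => //; apply: smooth_onV => //; exact: smooth_norm_dJ.
Qed.

Lemma smooth_double_nprojJ : smooth_on_mx U (fun x => 2 *: (nproj x *m J x)).
Proof.
apply: (smooth_on_mxZ (f := fun=> 2)) => //; first exact: smooth_on_cst.
by apply: smooth_on_mxM => //; exact: smooth_nproj.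
Qed.

Lemma smooth_Jbar : smooth_on_mx U Jbar.
Proof. by apply: smooth_on_mxB => //; exact: smooth_double_nprojJ. Qed.

Lemma covd_nproj m x : U x ->
  covd Gam m nproj x = (- 2 / norm_dJ x) *: (dtrace_form x m *m invmx (g x)).
Proof.
move=> Ux; rewrite -covd_trace_endo//.
have sV : smooth_on U (fun y => (norm_dJ y)^-1).
  by apply: smooth_onV => //; exact: smooth_norm_dJ.
have dN : differentiable (fun y => - 2 / norm_dJ y) x.
  exact: (smooth_on_differentiable (smooth_onZ _ oU sV) Ux).
rewrite /nproj (covdZ Gam m dN (smooth_differentiable_mx smooth_trace_endo Ux)).
rewrite (_ : partial m _ x = 0) ?scale0r ?add0r//.
rewrite (partialZ _ _ (smooth_on_differentiable sV Ux)) partialV ?norm_neq0//.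
  by rewrite partial_norm_eq0// !mulr0.
exact: smooth_on_differentiable smooth_norm_dJ Ux.
Qed.

Lemma covd_Jbar m x : U x ->
  covd Gam m Jbar x = P m x - 2 *: (covd Gam m nproj x *m J x) - 2 *: (nproj x *m P m x).
Proof.
move=> Ux; have dJ := smooth_differentiable_mx sJ Ux.
have dPi := smooth_differentiable_mx smooth_nproj Ux.
have d2 : differentiable ((fun=> 2) : V -> R) x by exact: differentiable_cst.
rewrite /Jbar (covdB Gam m dJ (smooth_differentiable_mx smooth_double_nprojJ Ux)).
rewrite (covdZ Gam m d2 (differentiable_mxM dPi dJ)) partial_cst scale0r add0r.
by rewrite (covdM Gam m dPi dJ) scalerDr opprD addrA.
Qed.

Section AlignedReversal.
Variables (x : V) (B : M4) (p : R).
Hypothesis Ux : U x.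
Hypothesis BG : B *m g x *m B^T = 1%:M.
Hypothesis BJ : B *m J x = J0 *m B.
Hypothesis p0 : p != 0.
Let hP := hat1 (g x) B (P^~ x).
Let hQ := hat2 (g x) B (Q x).
Let hF := hat2 (g x) B (F x).
Hypotheses (h0 : hP i0 = p *: phi0) (h1 : hP i1 = p *: psi0).
Hypotheses (h2 : hP i2 = 0) (h3 : hP i3 = 0).

Lemma trace_hP_offdiag i j : i != j -> \tr (hP i *m hP j) = 0.
Proof.
have sy k l : \tr (hP k *m hP l) = \tr (hP l *m hP k) by exact: mxtrace_mulC.
have t01 : \tr (hP i0 *m hP i1) = 0.
  rewrite h0 h1 -!scalemxAl -!scalemxAr !mxtraceZ.
  have : \tr (phi0 *m psi0 + psi0 *m phi0) = 0 by rewrite phi0_psi0 mxtrace0.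
  rewrite raddfD/= (mxtrace_mulC psi0) => /eqP.
  by rewrite -mulr2n mulrn_eq0/= => /eqP ->; rewrite !mulr0.
elim/ord4P: i; elim/ord4P: j => //= _;
  rewrite ?h2 ?h3 ?mulmx0 ?mul0mx ?mxtrace0//.
by rewrite sy.
Qed.

Lemma hat_nproj : hat (g x) B (nproj x) = Pi0 R.
Proof.
rewrite /nproj hatZ (norm_aligned Ux BG h0 h1 h2 h3).
have T i j : ((- 2 / (8 * p ^+ 2)) *: hat (g x) B (trace_endo x)) i j
    = - 2 / (8 * p ^+ 2) * \tr (hP i *m hP j).
  by rewrite mxE trace_endo_hat.
have [t0 t1 t2 t3] := trace_hP_diag h0 h1 h2 h3.
apply/matrixP => i j; rewrite T.
have [<-|ij] := eqVneq i j; last first.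
  rewrite trace_hP_offdiag// mulr0 !mxE.
  by move: ij; elim/ord4P: i; elim/ord4P: j => //= _; rewrite addr0.
by elim/ord4P: i; rewrite ?t0 ?t1 ?t2 ?t3 !mxE/= ?addr0 ?add0r; field.
Qed.

Lemma hat_covd_nproj m : hat1 (g x) B (fun m => covd Gam m nproj x) m = dPi p hP hQ m.
Proof.
apply/matrixP => i j; rewrite [RHS]mxE.
have N8 := norm_aligned Ux BG h0 h1 h2 h3.
transitivity ((- 2 / norm_dJ x) *
   fr B (fun a => (B *m dtrace_form x a *m B^T) i j : R^o) m).
  rewrite /hat1 (_ : fr B _ m = (- 2 / norm_dJ x) *:
     fr B (fun a => dtrace_form x a *m invmx (g x)) m); last first.
    by rewrite -frZ; apply: eq_fr => a; rewrite covd_nproj.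
  rewrite hatZ [LHS]mxE; congr (_ * _).
  rewrite hat_fr /fr summxE; apply: eq_bigr => a _.
  rewrite [LHS]mxE; congr (_ * _).
  by rewrite /hat -!mulmxA (mulmxA (invmx _)) mulVmx ?gu// mul1mx.
by rewrite dtrace_hat// N8; field.
Qed.

Lemma hat_covd_Jbar m : hat1 (g x) B (Pb^~ x) m = dJbar p hP hQ m.
Proof.
have E : fr B (Pb^~ x) m = fr B (P^~ x) m - 2 *: (fr B (fun m => covd Gam m nproj x) m *m J x)
   - 2 *: (nproj x *m fr B (P^~ x) m).
  rewrite -fr_mulmxr -fr_mulmxl -!frZ -!frN -!frD; apply: eq_fr => a.
  by rewrite /Pb covd_Jbar.
rewrite /hat1 E !(hatD, hatN, hatZ) !(hatM BG) (hat_J BG BJ) hat_nproj.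
by rewrite -/(hat1 _ _ (fun m => covd Gam m nproj x) m) hat_covd_nproj.
Qed.

Lemma norm_const_frame m : \tr (hQ m i0 *m hP i0) + \tr (hQ m i1 *m hP i1) = 0.
Proof.
have := partial_norm_hat Ux BG m.
rewrite /fr big1 => [|a _]; last by rewrite partial_norm_eq0// scaler0.
have key (X0 X1 X2 X3 Y0 Y1 Y2 Y3 : M4) : Y2 = 0 -> Y3 = 0 ->
    0 = - (\tr (X0 *m Y0) + \tr (Y0 *m X0) + (\tr (X1 *m Y1) + \tr (Y1 *m X1))
      + (\tr (X2 *m Y2) + \tr (Y2 *m X2)) + (\tr (X3 *m Y3) + \tr (Y3 *m X3))) ->
    \tr (X0 *m Y0) + \tr (X1 *m Y1) = 0.
  move=> -> ->; rewrite !mulmx0 !mul0mx !mxtrace0 (mxtrace_mulC Y0) (mxtrace_mulC Y1).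
  by move: (\tr _) (\tr _) => u v; lra.
by rewrite sum4E => /(key _ _ _ _ _ _ _ _ h2 h3).
Qed.

Lemma hQ_comm' k l : hQ k l - hQ l k = (- p ^+ 2 / 2) *: std_comm R k l.
Proof. by rewrite (hQ_comm Ux BG BJ) (hF_comm Ux BG BJ h0 h1 h2 h3). Qed.

Let dJbar_facts := conj
  (dJbar_parallel h0 h1 h2 h3 (hQ_skew B Ux) (hQ_anticomm Ux BG BJ) (hQ_closed B Ux)
    hQ_comm' p0 norm_const_frame)
  (dJbar_closed h0 h1 h2 h3 (hQ_skew B Ux) (hQ_anticomm Ux BG BJ) (hQ_closed B Ux)
    hQ_comm' p0 norm_const_frame).

Lemma hat_dJbar_parallel : hat1 (g x) B (Pb^~ x) i0 = 0 /\ hat1 (g x) B (Pb^~ x) i1 = 0.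
Proof. by rewrite !hat_covd_Jbar; have [] := dJbar_facts. Qed.

Lemma hat_dJbar_closed i j k : hat1 (g x) B (Pb^~ x) i j k
  + hat1 (g x) B (Pb^~ x) j k i + hat1 (g x) B (Pb^~ x) k i j = 0.
Proof. by rewrite !hat_covd_Jbar; have [_] := dJbar_facts. Qed.

Lemma nproj_Jbar_aligned k : \sum_a nproj x k a *: Pb a x = 0.
Proof.
have [z0 z1] := hat_dJbar_parallel.
have y0 : fr B (Pb^~ x) i0 = 0 by exact: (hat_inj BG).
have y1 : fr B (Pb^~ x) i1 = 0 by exact: (hat_inj BG).
rewrite -(fr_inverse BG (fun k => \sum_a nproj x k a *: Pb a x) k) big1// => i _.
rewrite (fr_contract BG) hat_nproj sum4E y0 y1 !scaler0 !add0r !mxE.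
by rewrite !andbF !addr0 !scale0r addr0 scaler0.
Qed.

End AlignedReversal.

(** The image of the projector is spanned by the first two frame vectors, along
    which [dJbar_parallel] applies. *)
Lemma nproj_Jbar x k : U x -> \sum_a nproj x k a *: Pb a x = 0.
Proof.
move=> Ux; have [B [p [BG BJ p0 [h0 h1 h2 h3]]]] := aligned_frame_exists Ux (norm_neq0 Ux).
exact: (nproj_Jbar_aligned Ux BG BJ p0 h0 h1 h2 h3).
Qed.

Lemma contract_mul (A A' : M4) (X : 'I_4 -> M4) k :
  \sum_a (A *m A') k a *: X a = \sum_a A k a *: \sum_b A' a b *: X b.
Proof.
under [RHS]eq_bigr do rewrite scaler_sumr.
rewrite exchange_big/=; apply: eq_bigr => b _.
by rewrite mulmx_ijE scaler_suml; apply: eq_bigr => a _; rewrite scalerA.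
Qed.

Lemma nproj_hessian_Jbar x m k : U x ->
  \sum_a covd Gam m nproj x k a *: Pb a x + \sum_a nproj x k a *: hessian Gam Jbar x m a = 0.
Proof.
move=> Ux.
have dN a : differentiable (fun y => nproj y k a) x.
  exact: (smooth_on_differentiable (smooth_nproj k a) Ux).
have dP a : differentiable_mx (Pb a) x.
  exact: smooth_differentiable_mx (smooth_covd oU smooth_Gam a smooth_Jbar) Ux.
have z : covd Gam m (fun y => \sum_a nproj y k a *: Pb a y) x = 0.
  rewrite -[RHS](covd_cst_scalar Gam m 0 x); apply: (eq_covd Gam oU m Ux) => y Uy.
  by rewrite nproj_Jbar// raddf0.
rewrite (covd_sumZ Gam m dN dP) big_split/= in z.
have C A A' := contract_mul A A' (Pb^~ x) k.
have t1 := C (nproj x) (Gam x m).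
have t2 : \sum_a (Gam x m *m nproj x) k a *: Pb a x = 0.
  by rewrite C big1// => a _; rewrite nproj_Jbar ?scaler0.
have t3 : \sum_a partial m (fun y => nproj y k a) x *: Pb a x
    = \sum_a covd Gam m nproj x k a *: Pb a x
      - \sum_a (nproj x *m Gam x m) k a *: Pb a x
      + \sum_a (Gam x m *m nproj x) k a *: Pb a x.
  rewrite -sumrN -!big_split; apply: eq_bigr => a _ /=.
  rewrite -scalerBl -scalerDl -partial_mxE; congr (_ *: _).
  have e (X Y Z : M4) : X k a = (X + Y - Z) k a - Y k a + Z k a.
    by rewrite !mxE; ring.
  exact: e.
rewrite t3 t2 t1 addr0 in z.
rewrite -[RHS]z -addrA; congr (_ + _); rewrite -sumrN -big_split; apply: eq_bigr => a _ /=.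
by rewrite -scalerN -scalerDr addrC.
Qed.

Section AlignedCurvature.
Variables (x : V) (B : M4) (p : R).
Hypothesis Ux : U x.
Hypothesis BG : B *m g x *m B^T = 1%:M.
Hypothesis BJ : B *m J x = J0 *m B.
Hypothesis p0 : p != 0.
Let hP := hat1 (g x) B (P^~ x).
Let hQ := hat2 (g x) B (Q x).
Let hF := hat2 (g x) B (F x).
Hypotheses (h0 : hP i0 = p *: phi0) (h1 : hP i1 = p *: psi0).
Hypotheses (h2 : hP i2 = 0) (h3 : hP i3 = 0).
Let Hb := hessian Gam Jbar x.

(** Differentiating [nproj_Jbar] expresses the second derivatives in the
    directions of the first two vectors through first derivatives. *)
Lemma hat_hessian_Jbar (i j : 'I_4) : (j < 2)%N ->
  fr2 B Hb i j = - \sum_a dPi p hP hQ i j a *: fr B (Pb^~ x) a.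
Proof.
move=> j2.
have E : fr B (fun m => fr B (fun k => \sum_a covd Gam m nproj x k a *: Pb a x
    + \sum_a nproj x k a *: hessian Gam Jbar x m a) j) i = 0.
  rewrite -[RHS](fr0 B M4 i); apply: eq_fr => m; rewrite -[RHS](fr0 B M4 j).
  by apply: eq_fr => k; exact: nproj_hessian_Jbar.
apply/eqP; rewrite -addr_eq0 addrC -[X in _ == X]E; apply/eqP.
rewrite (eq_fr _ _ (fun m => frD _ _ _ _)) frD; congr (_ + _).
  rewrite (eq_fr _ _ (fun m => fr_contract BG _ _ _)).
  rewrite /fr; under [RHS]eq_bigr do rewrite scaler_sumr.
  rewrite exchange_big/=; apply: eq_bigr => a _.
  rewrite -(hat_covd_nproj Ux BG p0 h0 h1 h2 h3) /hat1 hat_fr.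
  rewrite /fr summxE scaler_suml; apply: eq_bigr => b _.
  by rewrite scalerA; congr (_ *: _); rewrite [LHS]mxE.
rewrite (eq_fr _ _ (fun m => fr_contract BG _ _ _)) (hat_nproj Ux BG p0 h0 h1 h2 h3).
rewrite /fr2; apply: eq_fr => m.
have jj a : Pi0 R j a = (a == j)%:R.
  rewrite !mxE; move: j2; elim/ord4P: j {E} => //= _; elim/ord4P: a => //=;
  by rewrite ?addr0 ?add0r.
rewrite (bigD1 j)//= jj eqxx scale1r big1 ?addr0// => a /negPf aj.
by rewrite jj aj scale0r.
Qed.

(** By the Ricci identity the commutator is a difference of two second
    derivatives, which agree because the second fundamental form is
    symmetric. *)
Lemma curvature_commutes_Jbar :
  hat2 (g x) B (F x) i0 i1 *m hat (g x) B (Jbar x)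
    = hat (g x) B (Jbar x) *m hat2 (g x) B (F x) i0 i1.
Proof.
have c2 := hessian_comm oU smooth_Gam GamC smooth_Jbar _ _ Ux.
apply/eqP; rewrite -subr_eq0 -!(hatM BG) -hatN -hatD; apply/eqP.
have -> : fr2 B (F x) i0 i1 *m Jbar x - Jbar x *m fr2 B (F x) i0 i1
   = fr2 B Hb i0 i1 - fr2 B Hb i1 i0.
  rewrite (fr2_swap B Hb i0 i1) -fr2_mulmxl -fr2_mulmxr -!fr2N -!fr2D.
  by apply: eq_fr2 => a b; rewrite [RHS]c2.
rewrite !hat_hessian_Jbar//.
rewrite (_ : _ - _ = 0) ?hat0//; apply/eqP; rewrite subr_eq0; apply/eqP; congr (- _).
apply: eq_bigr => a _; congr (_ *: _).
exact: (dPi_sym h0 h1 h2 h3 (hQ_skew B Ux) (hQ_anticomm Ux BG BJ) (hQ_closed B Ux)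
  (hQ_comm' Ux BG BJ h0 h1 h2 h3) p0 (norm_const_frame Ux BG h2 h3)).
Qed.

End AlignedCurvature.

End Reversal.

End ChartGeometry.

(** * Two-forms in an orthonormal frame *)

Section Determinant4.
Variable R : realType.
Local Notation V := 'rV[R]_4.
Local Notation M4 := 'M[R]_4.

Definition det4 (X Y Z W : V) : R := \det (\matrix_(r < 4) tnth [tuple X; Y; Z; W] r).

(** Laplace expansion along the row that varies, which its cofactors do not
    involve. *)
Lemma det4_expand (A : M4) (i : 'I_4) : exists c : 'I_4 -> R, forall X : V,
  \det (\matrix_(r < 4) (if r == i then X else row r A)) = \sum_j X 0 j * c j.
Proof.
exists (fun j => cofactor (\matrix_(r < 4) (if r == i then 0 else row r A)) i j) => X.
rewrite (expand_det_row _ i); apply: eq_bigr => j _; rewrite mxE eqxx; congr (_ * _).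
rewrite /cofactor; congr (_ * \det _); apply/matrixP => a b.
by rewrite !mxE eq_sym (negbTE (neq_lift _ _)).
Qed.

Lemma det_row_frame (A B : M4) (i s : 'I_4) :
  \det (\matrix_(r < 4) (if r == i then row s B else row r A))
  = fr B (fun k => \det (\matrix_(r < 4) (if r == i then delta_mx 0 k else row r A)) : R^o) s.
Proof.
have [c E] := det4_expand A i; rewrite E; apply: eq_bigr => k _.
rewrite mxE E; congr (_ * _); rewrite (bigD1 k)//= big1 => [|j /negPf jk].
  by rewrite mxE !eqxx mul1r addr0.
by rewrite mxE jk andbF mul0r.
Qed.

Lemma det4E X Y Z W : det4 X Y Z W = \det (frame4 X Y Z W).
Proof.
congr (\det _); apply/row_matrixP => i; rewrite !rowK.
by elim/ord4P: i.
Qed.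

Lemma det4_row (B : M4) :
  [/\ forall s Y Z W, det4 (row s B) Y Z W = fr B (fun i => det4 (delta_mx 0 i) Y Z W : R^o) s,
  forall s X Z W, det4 X (row s B) Z W = fr B (fun i => det4 X (delta_mx 0 i) Z W : R^o) s,
  forall s X Y W, det4 X Y (row s B) W = fr B (fun i => det4 X Y (delta_mx 0 i) W : R^o) s &
  forall s X Y Z, det4 X Y Z (row s B) = fr B (fun i => det4 X Y Z (delta_mx 0 i) : R^o) s].
Proof.
have E (i : 'I_4) X Y Z W T :
   det4 (if i == i0 then T else X) (if i == i1 then T else Y)
        (if i == i2 then T else Z) (if i == i3 then T else W)
  = \det (\matrix_(r < 4) (if r == i then T else row r (frame4 X Y Z W))).
  rewrite det4E; congr (\det _); apply/row_matrixP => r; rewrite !rowK.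
  by elim/ord4P: r; elim/ord4P: i.
split=> s U1 U2 U3.
- apply: etrans (E i0 0 U1 U2 U3 _) _; rewrite det_row_frame.
  by apply: eq_fr => k; apply: esym; exact: (E i0 0 U1 U2 U3).
- apply: etrans (E i1 U1 0 U2 U3 _) _; rewrite det_row_frame.
  by apply: eq_fr => k; apply: esym; exact: (E i1 U1 0 U2 U3).
- apply: etrans (E i2 U1 U2 0 U3 _) _; rewrite det_row_frame.
  by apply: eq_fr => k; apply: esym; exact: (E i2 U1 U2 0 U3).
apply: etrans (E i3 U1 U2 U3 0 _) _; rewrite det_row_frame.
by apply: eq_fr => k; apply: esym; exact: (E i3 U1 U2 U3 0).
Qed.

Lemma det4_mul (B : M4) X Y Z W :
  det4 (X *m B) (Y *m B) (Z *m B) (W *m B) = det4 X Y Z W * \det B.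
Proof.
rewrite !det4E -det_mulmx; congr (\det _); apply/row_matrixP => i.
rewrite row_mul !rowK.
by elim/ord4P: i.
Qed.

Lemma det_mx33 (a : nat -> nat -> R) :
  \det (\matrix_(i < 3, j < 3) a i j)
  = a 0 0 * (a 1 1 * a 2 2 - a 1 2 * a 2 1) - a 0 1 * (a 1 0 * a 2 2 - a 1 2 * a 2 0)
    + a 0 2 * (a 1 0 * a 2 1 - a 1 1 * a 2 0).
Proof.
do 2! rewrite !(expand_det_row _ ord0) !big_ord_recl !big_ord0 /cofactor.
rewrite !det_mx11 !mxE /= /bump /=.
by ring.
Qed.

Lemma det_mx44 (a : nat -> nat -> R) :
  let m i j k := a 1 i * (a 2 j * a 3 k - a 2 k * a 3 j) - a 1 j * (a 2 i * a 3 k - a 2 k * a 3 i)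
    + a 1 k * (a 2 i * a 3 j - a 2 j * a 3 i) in
  \det (\matrix_(i < 4, j < 4) a i j)
  = a 0 0 * m 1 2 3 - a 0 1 * m 0 2 3 + a 0 2 * m 0 1 3 - a 0 3 * m 0 1 2.
Proof.
move=> m.
pose det3 (b : nat -> nat -> R) := b 0 0 * (b 1 1 * b 2 2 - b 1 2 * b 2 1)
  - b 0 1 * (b 1 0 * b 2 2 - b 1 2 * b 2 0) + b 0 2 * (b 1 0 * b 2 1 - b 1 1 * b 2 0).
have E (j : 'I_4) : \det (row' ord0 (col' j (\matrix_(i < 4, j < 4) a i j)))
  = det3 (fun x y => a x.+1 (bump j y)).
  by apply: etrans (det_mx33 (fun x y => a x.+1 (bump j y))); congr (\det _); apply/matrixP => u v; rewrite !mxE.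
rewrite (expand_det_row _ ord0) !big_ord_recl !big_ord0 /cofactor !E !mxE /det3 /=.
by rewrite /bump /= /m; ring.
Qed.

Lemma det4_formula (X Y Z W : V) :
  let a i j := (nth X [:: X; Y; Z; W] i) 0 j in
  let m i j k := a 1 i * (a 2 j * a 3 k - a 2 k * a 3 j) - a 1 j * (a 2 i * a 3 k - a 2 k * a 3 i)
    + a 1 k * (a 2 i * a 3 j - a 2 j * a 3 i) in
  det4 X Y Z W
  = a 0 i0 * m i1 i2 i3 - a 0 i1 * m i0 i2 i3 + a 0 i2 * m i0 i1 i3 - a 0 i3 * m i0 i1 i2.
Proof.
move=> a m.
have E : \matrix_(r < 4) tnth [tuple X; Y; Z; W] r
    = \matrix_(i < 4, j < 4) (fun i j => a i (inord j)) i j.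
  by apply/matrixP => i j; rewrite !mxE /= inord_val (tnth_nth X).
rewrite /det4 E; apply: etrans (det_mx44 (fun i j => a i (inord j))) _; rewrite /m.
have k0 : inord 0 = i0 by apply: val_inj; rewrite /= inordK.
have k1 : inord 1 = i1 by apply: val_inj; rewrite /= inordK.
have k2 : inord 2 = i2 by apply: val_inj; rewrite /= inordK.
have k3 : inord 3 = i3 by apply: val_inj; rewrite /= inordK.
by rewrite k0 k1 k2 k3.
Qed.

Let eps i j k l := det4 (delta_mx 0 i) (delta_mx 0 j) (delta_mx 0 k) (delta_mx 0 l).

(** Hodge dual of a 2-form in an oriented orthonormal frame *)
Definition star (f : M4) : M4 :=
  \matrix_(k, l) (2^-1 * \sum_i \sum_j f i j * eps i j k l).

Lemma epsE i j k l : let d a b : R := (b == a)%:R in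
  let m u v w := d j u * (d k v * d l w - d k w * d l v) - d j v * (d k u * d l w - d k w * d l u)
    + d j w * (d k u * d l v - d k v * d l u) in
  eps i j k l
  = d i i0 * m i1 i2 i3 - d i i1 * m i0 i2 i3 + d i i2 * m i0 i1 i3 - d i i3 * m i0 i1 i2.
Proof. by move=> d m; rewrite /eps det4_formula /= !mxE. Qed.

Lemma star_skew f : f + f^T = 0 -> star f + (star f)^T = 0.
Proof.
move=> _; have S i j k l : eps i j k l + eps i j l k = 0 by rewrite !epsE; ring.
apply/matrixP => k l; rewrite !mxE -mulrDr -big_split big1 ?mulr0// => i _.
by rewrite -big_split big1// => j _; rewrite /= -mulrDr S mulr0.
Qed.

Lemma starE f : f + f^T = 0 ->
  [/\ star f i0 i1 = f i2 i3, star f i2 i3 = f i0 i1, star f i0 i2 = - f i1 i3 &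
  [/\ star f i1 i3 = - f i0 i2, star f i0 i3 = f i1 i2 & star f i1 i2 = f i0 i3]].
Proof.
move=> fs; have S i j : f i j = - f j i by exact: skew_entry.
have D i : f i i = 0 by exact: skew_diag.
split; last split.
all: rewrite mxE !sum4E !epsE /=.
all: rewrite ?D ?(S i1 i0) ?(S i2 i0) ?(S i3 i0) ?(S i2 i1) ?(S i3 i1) ?(S i3 i2).
all: by field.
Qed.

Lemma self_dual_frame f : f + f^T = 0 ->
  f + star f = (f i0 i1 + f i2 i3) *: J0 R + (f i0 i2 - f i1 i3) *: phi0 R
    - (f i0 i3 + f i1 i2) *: psi0 R.
Proof.
move=> fs; have S i j : f i j = - f j i by exact: skew_entry.
have D i : f i i = 0 by exact: skew_diag.
have S' i j : star f i j = - star f j i by exact: skew_entry (star_skew fs).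
have D' i : star f i i = 0 by exact: skew_diag (star_skew fs).
have [e1 e2 e3 [e4 e5 e6]] := starE fs.
have E (X Y A C E : M4) (a b c : R) i j : X i j + Y i j = a * A i j + b * C i j - c * E i j ->
  (X + Y) i j = (a *: A + b *: C - c *: E) i j by rewrite !mxE.
apply: matrix4P; do ![split]; apply: E; rewrite J0E phi0E psi0E !wedgeE /=.
all: rewrite ?D ?D' ?(S i1 i0) ?(S i2 i0) ?(S i3 i0) ?(S i2 i1) ?(S i3 i1) ?(S i3 i2).
all: rewrite ?(S' i1 i0) ?(S' i2 i0) ?(S' i3 i0) ?(S' i2 i1) ?(S' i3 i1) ?(S' i3 i2).
all: rewrite ?(e1, e2, e3, e4, e5, e6); ring.
Qed.

Lemma anti_self_dual_frame f : f + f^T = 0 ->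
  f - star f = (f i0 i1 - f i2 i3) *: (wedge R i0 i1 - wedge R i2 i3)
    + (f i0 i2 + f i1 i3) *: (wedge R i0 i2 + wedge R i1 i3)
    + (f i0 i3 - f i1 i2) *: (wedge R i0 i3 - wedge R i1 i2).
Proof.
move=> fs; have S i j : f i j = - f j i by exact: skew_entry.
have D i : f i i = 0 by exact: skew_diag.
have S' i j : star f i j = - star f j i by exact: skew_entry (star_skew fs).
have D' i : star f i i = 0 by exact: skew_diag (star_skew fs).
have [e1 e2 e3 [e4 e5 e6]] := starE fs.
have E (X Y A A' C C' E E' : M4) (a b c : R) i j :
  X i j - Y i j = a * (A i j - A' i j) + b * (C i j + C' i j) + c * (E i j - E' i j) ->
  (X - Y) i j = (a *: (A - A') + b *: (C + C') + c *: (E - E')) i j by rewrite !mxE.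
apply: matrix4P; do ![split]; apply: E; rewrite !wedgeE /=.
all: rewrite ?D ?D' ?(S i1 i0) ?(S i2 i0) ?(S i3 i0) ?(S i2 i1) ?(S i3 i1) ?(S i3 i2).
all: rewrite ?(S' i1 i0) ?(S' i2 i0) ?(S' i3 i0) ?(S' i2 i1) ?(S' i3 i1) ?(S' i3 i2).
all: rewrite ?(e1, e2, e3, e4, e5, e6); ring.
Qed.

End Determinant4.

(** ** Curvature operators in an orthonormal frame *)

Lemma sum_delta_form (R : realType) (C : 'I_4 -> 'I_4 -> 'M[R]_4) (i j k l : 'I_4) :
  \sum_a \sum_b delta_mx 0 i (0 : 'I_1) a * delta_mx 0 j (0 : 'I_1) b
    * bil (C a b) (delta_mx 0 k) (delta_mx 0 l) = C i j k l.
Proof.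
rewrite (bigD1 i)//= [X in _ + X]big1 ?addr0 => [|a /negPf ai]; last first.
  by rewrite big1// => b _; rewrite [delta_mx _ _ _ _]mxE ai andbF !mul0r.
rewrite (bigD1 j)//= [X in _ + X]big1 ?addr0 => [|b /negPf bj]; last first.
  by rewrite ![delta_mx _ _ _ _]mxE bj !andbF mulr0 mul0r.
rewrite ![delta_mx _ _ _ _]mxE !eqxx !mul1r /bil -rowE trmx_delta -colE.
by rewrite [LHS]mxE [LHS]mxE.
Qed.

Lemma frame_contraction (R : realType) (B : 'M[R]_4) (X : 'I_4 -> 'I_4 -> 'M[R]_4) j l :
  fr2 B (fun a b => \sum_s \sum_i B s i * (B *m X i a) s b : R^o) j l
  = \sum_s fr2 B (fun i a => (B *m X i a *m B^T) s l : R^o) s j.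
Proof.
rewrite /fr2 /fr /GRing.scale/=.
under [RHS]eq_bigr => s _ do under eq_bigr => i _ do rewrite mulr_sumr.
under [RHS]eq_bigr => s _ do rewrite exchange_big/=.
rewrite [RHS]exchange_big/=; apply: eq_bigr => a _.
under eq_bigr => b _ do rewrite mulr_sumr.
rewrite exchange_big/= mulr_sumr; apply: eq_bigr => s _.
under eq_bigr => b _ do rewrite mulr_sumr.
rewrite exchange_big/= mulr_sumr; apply: eq_bigr => i _.
rewrite (mulmx_ijE _ B^T) !mulr_sumr; apply: eq_bigr => b _.
by rewrite [B^T _ _]mxE; ring.
Qed.

Section LowerFrame.
Variable R : realType.
Local Notation V := 'rV[R]_4.
Local Notation M4 := 'M[R]_4.
Variables (G B : M4).
Hypotheses (uG : G \in unitmx) (BG : B *m G *m B^T = 1%:M).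

Definition low (f : M4) : M4 := B *m f *m B^T.

Lemma lowD f h : low (f + h) = low f + low h.
Proof. by rewrite /low mulmxDr mulmxDl. Qed.
Lemma lowN f : low (- f) = - low f.
Proof. by rewrite /low mulmxN mulNmx. Qed.
Lemma lowZ c f : low (c *: f) = c *: low f.
Proof. by rewrite /low -scalemxAr -scalemxAl. Qed.
Lemma low_tr f : low f^T = (low f)^T.
Proof. by rewrite /low !trmx_mul trmxK mulmxA. Qed.
Lemma lowE f i j : low f i j = fr2 B (fun a b => f a b : R^o) i j.
Proof. exact: form_frame. Qed.

Lemma low_metric : low G = 1%:M. Proof. exact: BG. Qed.

Let iG : invmx G = B^T *m B := invmx_frame uG BG.

Lemma low_inj f h : low f = low h -> f = h.
Proof.
have BBG : B^T *m B *m G = 1%:M by rewrite -iG mulVmx.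
have GBB : G *m (B^T *m B) = 1%:M by rewrite -iG mulmxV.
have E k : G *m B^T *m low k *m (B *m G) = k.
  rewrite /low; move: BBG GBB; move: (B^T) B => T S; rewrite -mulmxA => h1.
  by rewrite mulmxA => h2; rewrite !mulmxA h2 mul1mx -!mulmxA h1 mulmx1.
by move=> fh; rewrite -(E f) fh E.
Qed.

Lemma raise2_low f : raise2 G f = B^T *m low f *m B.
Proof. by rewrite /raise2 iG /low !mulmxA. Qed.

Lemma inner2_low f h : inner2 G f h = 2^-1 * \tr (low f *m (low h)^T).
Proof.
rewrite /inner2 raise2_low -low_tr /low -!mulmxA mxtrace_mulC !mulmxA.
by [].
Qed.

Lemma low_skew f : f + f^T = 0 -> low f + (low f)^T = 0.
Proof. by move=> fs; rewrite -low_tr -lowD fs /low mulmx0 mul0mx. Qed.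

Lemma tr_raise2 (T f : M4) :
  \sum_i \sum_j T i j * raise2 G f i j = \tr (low T *m (low f)^T).
Proof.
transitivity (\tr (T *m (raise2 G f)^T)).
  by rewrite /mxtrace; apply: eq_bigr => i _; rewrite mxE; apply: eq_bigr => j _;
    rewrite [in RHS]mxE.
rewrite raise2_low !(trmx_mul _ B) (trmx_mul B^T) trmxK [low T]/low; move: (low f)^T => K.
by rewrite -!(mulmxA B) [RHS]mxtrace_mulC !mulmxA.
Qed.

Lemma fr2_linear (T : M4 -> R^o) (X : 'I_4 -> 'I_4 -> M4) k l :
  (forall a X Y, T (a *: X + Y) = a * T X + T Y) ->
  fr2 B (fun a b => T (X a b)) k l = T (fr2 B X k l).
Proof.
move=> Tl; have T0 : T 0 = 0.
  by have /eqP := Tl 1 0 0; rewrite scaler0 addr0 mul1r -[X in X == _]addr0 =>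
    /eqP/addrI.
have Ts (c : 'I_4 -> R) (Y : 'I_4 -> M4) : T (\sum_a c a *: Y a) = \sum_a c a * T (Y a).
  by elim/big_rec2: _ => // a u v _ <-.
rewrite /fr2 /fr Ts; apply: eq_bigr => a _; congr (_ * _).
by rewrite Ts.
Qed.

Lemma det4_frame i j k l :
  fr2 B (fun a b => fr2 B (fun u v =>
     det4 (delta_mx 0 u) (delta_mx 0 v) (delta_mx 0 a) (delta_mx 0 b) : R^o) i j) k l
  = det4 (delta_mx 0 i) (delta_mx 0 j) (delta_mx 0 k) (delta_mx 0 l : V) * \det B.
Proof.
have [r0 r1 r2 r3] := det4_row B.
rewrite -det4_mul -!rowE r2 /fr2; apply: eq_fr => a; rewrite r3; apply: eq_fr => b.
by rewrite r0; apply: eq_fr => u; rewrite r1.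
Qed.

(** The volume form takes the value det B on the frame. *)
Lemma low_hodge e f :
  low (hodge G e f) = (e * Num.sqrt (\det G) * \det B) *: star (low f).
Proof.
pose D i j a b := det4 (delta_mx 0 i) (delta_mx 0 j) (delta_mx 0 a) (delta_mx 0 b) : R.
set c := e * _.
have vE i j a b : vol G e i j a b = c * D i j a b.
  congr (_ * \det _); apply/row_matrixP => r; rewrite !rowK.
  by elim/ord4P: r.
pose Dm a b : M4 := \matrix_(i, j) D i j a b.
have E1 a b : hodge G e f a b = c / 2 * \tr (low (Dm a b) *m (low f)^T).
  rewrite mxE -tr_raise2 (mulrC c) -mulrA; congr (_ * _); rewrite mulr_sumr.
  apply: eq_bigr => i _; rewrite mulr_sumr; apply: eq_bigr => j _.
  by rewrite vE [Dm a b i j]mxE; ring.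
have E2 k l : star (low f) k l = 2^-1 * \tr (Dm k l *m (low f)^T).
  rewrite mxE; congr (_ * _); rewrite /mxtrace; apply: eq_bigr => i _.
  by rewrite mulmx_ijE; apply: eq_bigr => j _; rewrite mulrC [Dm k l i j]mxE [in RHS]mxE.
apply/matrixP => k l; rewrite lowE [RHS]mxE E2.
rewrite (eq_fr2 _ _ _ E1).
rewrite (fr2_linear (T := fun X => c / 2 * \tr (low X *m (low f)^T)) Dm); last first.
  by move=> a X Y; rewrite lowD lowZ mulmxDl -scalemxAl mxtraceD mxtraceZ; ring.
have -> : low (fr2 B Dm k l) = \det B *: Dm k l.
  apply/matrixP => i j; rewrite [RHS]mxE [Dm k l i j]mxE mulrC -det4_frame.
  rewrite -(fr2_linear (T := fun X => low X i j) Dm); last first.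
    by move=> a X Y; rewrite lowD lowZ !mxE.
  apply: eq_fr2 => a b; rewrite lowE; apply: eq_fr2 => u v.
  by rewrite mxE.
by rewrite -scalemxAl mxtraceZ; ring.
Qed.

Variables (g : V -> M4) (x : V).
Hypothesis gx : g x = G.
Let F k l := curv_endo g x k l.
Let hF := hat2 G B F.

Lemma riem_compE i j k l : riem_comp g x i j k l = (F i j *m G) k l.
Proof.
rewrite /riem_comp /riem gx.
exact (sum_delta_form (fun a b => curv_endo g x a b *m G) i j k l).
Qed.

Lemma low_curvature i j : low (fr2 B F i j *m G) = hF i j.
Proof. by rewrite /hF /hat2 hat_form. Qed.

Lemma low_curv_op f i j : low (curv_op g x f) i j = 2^-1 * \tr (hF i j *m (low f)^T).
Proof.
have E a b : curv_op g x f a b = 2^-1 * \tr (low (F a b *m G) *m (low f)^T).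
  rewrite mxE -tr_raise2 gx; congr (_ * _); apply: eq_bigr => k _; apply: eq_bigr => l _.
  by rewrite riem_compE.
rewrite lowE (eq_fr2 _ _ _ E).
rewrite (fr2_linear (T := fun X => 2^-1 * \tr (low (X *m G) *m (low f)^T)) F); last first.
  move=> a X Y; rewrite mulmxDl -scalemxAl lowD lowZ mulmxDl -scalemxAl mxtraceD mxtraceZ.
  by ring.
by rewrite low_curvature.
Qed.

Lemma low_ricci j l : low (ricci g x) j l = \sum_i hF i j i l.
Proof.
have E a b : ricci g x a b = \sum_s \sum_i B s i * (B *m (F i a *m G)) s b.
  rewrite mxE gx iG exchange_big/=; under eq_bigr => k _.
    under eq_bigr => i _ do rewrite riem_compE (mulmx_ijE B^T B) mulr_suml.
    rewrite exchange_big/=; over.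
  rewrite /= exchange_big/=; apply: eq_bigr => s _.
  rewrite exchange_big/=; apply: eq_bigr => i _.
  rewrite (mulmx_ijE B) mulr_sumr; apply: eq_bigr => k _.
  by rewrite [B^T _ _]mxE mulrA.
rewrite lowE (eq_fr2 _ _ _ E).
transitivity (\sum_s fr2 B (fun i a => low (F i a *m G) s l : R^o) s j).
  exact: frame_contraction.
apply: eq_bigr => s _; rewrite (fr2_linear (T := fun X => low (X *m G) s l) F) ?low_curvature//.
by move=> a X Y; rewrite mulmxDl -scalemxAl lowD lowZ !mxE.
Qed.

End LowerFrame.

(** * Curvature of the four-manifold at a point *)

Section Orientation.
Variable R : realType.
Local Notation V := 'rV[R]_4.
Local Notation M4 := 'M[R]_4.
Local Notation J0 := (J0 R).

Lemma row_mulJ0E (a : V) : ((a *m J0) 0 i0 = - a 0 i1) * ((a *m J0) 0 i1 = a 0 i0) *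
  ((a *m J0) 0 i2 = - a 0 i3) * ((a *m J0) 0 i3 = a 0 i2).
Proof. by do ![split]; rewrite mxE sum4E !J0E !wedgeE /=; ring. Qed.

(** The square of the modulus of a complex 2 x 2 determinant *)
Lemma det4_complex_ge0 (a b : V) : 0 <= det4 a (a *m J0) b (b *m J0).
Proof.
rewrite det4_formula /= !row_mulJ0E.
move: (a 0 i0) (a 0 i1) (a 0 i2) (a 0 i3) (b 0 i0) (b 0 i1) (b 0 i2) (b 0 i3).
move=> a0 a1 a2 a3 b0 b1 b2 b3.
have E r : (a0 * b2 - a1 * b3 - a2 * b0 + a3 * b1) ^+ 2
  + (a0 * b3 + a1 * b2 - a2 * b1 - a3 * b0) ^+ 2 = r -> 0 <= r.
  by move=> <-; rewrite addr_ge0 ?sqr_ge0.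
by apply: E; ring.
Qed.

Variables G J B : M4.
Hypothesis BG : B *m G *m B^T = 1%:M.

(** In complex coordinates with respect to B the frames (X, JX, Y, JY) have
    nonnegative determinant. *)
Lemma orient_det : B *m J = J0 *m B -> orient J = if 0 < \det B then 1 else -1.
Proof.
move=> BJ; have BGB : G *m B^T *m B = 1%:M by apply: mulmx1C; rewrite mulmxA.
rewrite /orient; congr (if _ then _ else _); apply/asboolP/idP; last first.
  move=> dB; exists (row i0 B), (row i2 B); rewrite -/(det4 _ _ _ _).
  have [r0 r1 r2 r3] := row_J0 B.
  rewrite -!row_mul BJ r0 r2 det4E (_ : frame4 _ _ _ _ = B)//.
  by apply/row_matrixP => i; rewrite rowK; elim/ord4P: i.
move=> [X [Y]]; rewrite -/(det4 _ _ _ _).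
have E (Z : V) : Z = Z *m (G *m B^T) *m B by rewrite -mulmxA BGB mulmx1.
have EJ (Z : V) : Z *m J = Z *m (G *m B^T) *m J0 *m B by rewrite {1}(E Z) -!mulmxA -BJ.
rewrite (EJ X) (EJ Y) {1}(E X) {1}(E Y) det4_mul.
have := det4_complex_ge0 (X *m (G *m B^T)) (Y *m (G *m B^T)).
move: (det4 _ _ _ _) (\det B) => d e; rewrite le0r => /orP[/eqP ->|d0].
  by rewrite mul0r ltxx.
by rewrite pmulr_rgt0.
Qed.

Lemma det_frame_neq0 : \det B != 0.
Proof.
apply/eqP => dB; have /eqP := congr1 determinant BG.
by rewrite !det_mulmx dB !mul0r det1 eq_sym oner_eq0.
Qed.

Lemma sqrt_det_frame : Num.sqrt (\det G) = `|\det B|^-1.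
Proof.
have : \det B ^+ 2 * \det G = 1.
  by rewrite expr2 -mulrA (mulrC (\det B) (\det G)) mulrA -[X in _ * X]det_tr
    -!det_mulmx BG det1.
move=> /(canRL (mulKf _)); rewrite expf_neq0 ?det_frame_neq0// mulr1 => -> //.
by rewrite -exprVn sqrtr_sqr normfV.
Qed.

(** The orientation sign normalizes the volume form to 1 on adapted frames. *)
Lemma orient_frame : B *m J = J0 *m B -> orient J * Num.sqrt (\det G) * \det B = 1.
Proof.
move=> BJ; rewrite orient_det// sqrt_det_frame; have := det_frame_neq0.
case: ltrgt0P => // dB _; rewrite ?mul1r ?mulN1r.
  by rewrite mulVf// gt_eqF.
by rewrite invrN opprK mulVf// lt_eqF.
Qed.

End Orientation.

Section ReversedOrientation.
Variable R : realType.
Local Notation M4 := 'M[R]_4.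
Local Notation J0 := (J0 R).

(** The standard complex structure with the opposite orientation *)
Definition Jb0 : M4 := wedge R i2 i3 - wedge R i0 i1.

(** Reversing one frame vector exchanges J0 with Jb0. *)
Definition flip : M4 := 1%:M - 2 *: delta_mx i0 i0.

Lemma Jb0E k l : Jb0 k l = wedge R i2 i3 k l - wedge R i0 i1 k l.
Proof. by rewrite [LHS]mxE [X in _ + X]mxE. Qed.

Lemma flipE i j : flip i j = (i == j)%:R * (if i == i0 then -1 else 1).
Proof.
by rewrite !mxE; elim/ord4P: i; elim/ord4P: j; rewrite /=; ring.
Qed.

Lemma flip_mulE (A : M4) i j : (flip *m A) i j = (if i == i0 then -1 else 1) * A i j.
Proof.
rewrite mxE (bigD1 i)//= flipE eqxx mul1r big1 ?addr0// => k /negPf ki.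
by rewrite flipE eq_sym ki !mul0r.
Qed.

Lemma flip_Jb0 : flip *m Jb0 = J0 *m flip.
Proof.
by apply: matrix4P; do ![split]; rewrite flip_mulE J0mulE !flipE Jb0E !wedgeE /=; ring.
Qed.

Lemma det_flip : \det flip = -1.
Proof.
have -> : flip = diag_mx (\row_j (if j == i0 then -1 else 1)).
  apply/matrixP => i j; rewrite flipE !mxE.
  by have [->|] := eqVneq i j; rewrite ?mul0r ?mulr0n// mul1r mulr1n.
rewrite det_diag (eq_bigr (fun j : 'I_4 => if j == i0 then -1 else 1 : R)).
  by rewrite -big_mkcond/= big_pred1_eq.
by move=> j _; rewrite mxE.
Qed.

Lemma orient_reversed (G J Jb B : M4) : B *m G *m B^T = 1%:M ->
  B *m J = J0 *m B -> B *m Jb = Jb0 *m B -> orient Jb = - orient J.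
Proof.
move=> BG BJ BJb.
have FF : flip *m flip^T = 1%:M.
  apply: matrix4P; do ![split]; rewrite flip_mulE !mxE /=; ring.
have BG' : (flip *m B) *m G *m (flip *m B)^T = 1%:M.
  by rewrite trmx_mul !mulmxA -(mulmxA flip B) -(mulmxA flip) BG mulmx1 FF.
rewrite (orient_det BG BJ) (orient_det BG'); last first.
  by rewrite -!mulmxA BJb !mulmxA flip_Jb0.
rewrite det_mulmx det_flip mulN1r oppr_gt0.
by have := det_frame_neq0 BG; case: ltrgt0P; rewrite ?opprK.
Qed.

End ReversedOrientation.

Section PointwiseCurvature.
Variable R : realType.
Local Notation V := 'rV[R]_4.
Local Notation M4 := 'M[R]_4.
Local Notation J0 := (J0 R).
Local Notation Jb0 := (Jb0 R).
Local Notation wedge := (wedge R).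
Local Notation Pi0 := (Pi0 R).
Variables (G J Jb B : M4) (g : V -> M4) (x : V).
Hypotheses (uG : G \in unitmx) (GT : G^T = G) (BG : B *m G *m B^T = 1%:M).
Hypotheses (BJ : B *m J = J0 *m B) (BJb : B *m Jb = Jb0 *m B) (gx : g x = G).
Let hF := hat2 G B (curv_endo g x).
Variable mu : R.
(* The curvature minus the tensor of constant curvature mu. *)
Let F' i j := hF i j - mu *: wedge i j.
Hypotheses (FN : forall i j, F' i j = - F' j i).
Hypotheses (Fskew : forall i j, F' i j + (F' i j)^T = 0).
Hypothesis Fbianchi : forall i j k l, F' i j k l + F' j k i l + F' k i j l = 0.
Hypothesis Fcomm : forall i j, F' i j *m J0 - J0 *m F' i j = 0.
Let f k l := F' k l i0 i1 + F' k l i2 i3.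
Hypothesis fE : [/\ f i0 i2 = 0, f i0 i3 = 0, f i1 i2 = 0, f i1 i3 = 0 & f i2 i3 = 0].
Hypothesis F01 : F' i0 i1 *m Jb0 = Jb0 *m F' i0 i1.
Let la := f i0 i1.

Lemma hFE i j k l : hF i j k l = F' i j k l + mu * wedge i j k l.
Proof.
have e (X W : M4) : X k l = (X - mu *: W) k l + mu * W k l by rewrite !mxE subrK.
exact: e.
Qed.

(** A skew matrix that commutes with J0 and with Jb0 preserves both coordinate
    planes. *)
Lemma F_block : [/\ F' i0 i1 i0 i2 = 0, F' i0 i1 i0 i3 = 0, F' i2 i3 i0 i2 = 0 & F' i2 i3 i0 i3 = 0].
Proof.
have [h13 h12] := Fcomm_entries Fcomm i0 i1.
have E (A : M4) : A *m Jb0 = Jb0 *m A -> A i0 i3 = A i1 i2 /\ A i0 i2 = - A i1 i3.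
  move=> H; have := congr1 (fun X : M4 => (X i0 i2, X i0 i3)) H; rewrite /= => -[].
  rewrite !mulmx4E !Jb0E !wedgeE /= => h1 h2; split; lra.
have [e1 e2] := E _ F01.
have [f02 f03 _ _ _] := fE.
have P := Fpair FN Fskew Fbianchi.
have a02 : F' i0 i1 i0 i2 = 0 by lra.
have a03 : F' i0 i1 i0 i3 = 0 by lra.
split=> //; rewrite P.
  by rewrite -f02 /f (P i0 i2 i0 i1) a02 add0r.
by rewrite -f03 /f (P i0 i3 i0 i1) a03 add0r.
Qed.

Lemma low_ricciE : low B (ricci g x) = (3 * mu)%:M + la *: Pi0.
Proof.
apply/matrixP => j l; rewrite (low_ricci uG BG gx).
under eq_bigr => i _ do rewrite -/hF hFE.
rewrite big_split/= -mulr_sumr (ricci_frame FN Fskew Fbianchi Fcomm fE) addrC.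
have e (X Y : M4) (c : R) : (X + c *: Y) j l = X j l + c * Y j l by rewrite !mxE.
rewrite e; congr (_ + _); rewrite sum4E !wedgeE [RHS]mxE.
by elim/ord4P: j {e}; elim/ord4P: l; rewrite /= ?mulr1n ?mulr0n; ring.
Qed.

Lemma scalE : scal g x = 12 * mu + 2 * la.
Proof.
rewrite /scal gx (invmx_frame uG BG) -mulmxA mxtrace_mulC -/(low B _) low_ricciE.
rewrite mxtraceD mxtraceZ mxtrace_scalar.
by rewrite mxtrace4E !mxE /= ; ring.
Qed.

Definition Ric0_frame : M4 := la *: (Pi0 - (2^-1)%:M).

Lemma low_ricci0E : low B (ricci0 g x) = Ric0_frame.
Proof.
rewrite /ricci0 lowD lowN lowZ gx (low_metric BG) low_ricciE scalE /Ric0_frame.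
rewrite scalerBr scale_scalar_mx scale_scalar_mx mulr1 addrAC -raddfB/= addrC.
by congr (_ + _); rewrite -raddfN; congr _%:M; field.
Qed.

Lemma low_comp (h k : M4) : low B (h *m invmx G *m k) = low B h *m low B k.
Proof. by rewrite (invmx_frame uG BG) /low !mulmxA. Qed.

Lemma low_ricci0_op h : low B (ricci0_op g x h)
  = 2^-1 *: (Ric0_frame *m low B h + low B h *m Ric0_frame).
Proof. by rewrite /ricci0_op lowZ lowD gx !low_comp low_ricci0E. Qed.

(** [weyl_op] on frame components. *)
Definition weyl_frame (X : M4) : M4 :=
  \matrix_(i, j) (2^-1 * \tr (hF i j *m X^T)) - (scal g x / 12) *: X
  - 2^-1 *: (Ric0_frame *m X + X *m Ric0_frame).

Lemma low_weyl_op h : low B (weyl_op g x h) = weyl_frame (low B h).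
Proof.
rewrite /weyl_op !lowD !lowN lowZ low_ricci0_op /weyl_frame.
congr (_ - _ - _); apply/matrixP => i j.
by rewrite (low_curv_op uG BG gx) [RHS]mxE.
Qed.

Lemma half_trace (Y X : M4) : Y + Y^T = 0 -> X + X^T = 0 ->
  2^-1 * \tr (Y *m X^T) = Y i0 i1 * X i0 i1 + Y i0 i2 * X i0 i2 + Y i0 i3 * X i0 i3
    + Y i1 i2 * X i1 i2 + Y i1 i3 * X i1 i3 + Y i2 i3 * X i2 i3.
Proof.
move=> Ys Xs; have S i j : X i j = - X j i by exact: skew_entry.
have S' i j : Y i j = - Y j i by exact: skew_entry.
have D i : X i i = 0 by exact: skew_diag.
rewrite mxtrace4E !mulmx4E; do 16! rewrite [(X^T) _ _]mxE.
rewrite !D (S i1 i0) (S i2 i0) (S i3 i0) (S i2 i1) (S i3 i1) (S i3 i2).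
rewrite (S' i1 i0) (S' i2 i0) (S' i3 i0) (S' i2 i1) (S' i3 i1) (S' i3 i2).
by field.
Qed.

Let d (i : 'I_4) : R := la * (if (i < 2)%N then 2^-1 else - 2^-1).

Lemma Ric0_frame_mulE (X : M4) i j :
  (Ric0_frame *m X + X *m Ric0_frame) i j = (d i + d j) * X i j.
Proof.
have E a b : Ric0_frame a b = (a == b)%:R * d a.
  have e (Y Z : M4) (c : R) : (c *: (Y - Z)) a b = c * (Y a b - Z a b) by rewrite !mxE.
  rewrite e !mxE /d; elim/ord4P: a {e}; elim/ord4P: b; rewrite /= ?mulr1n ?mulr0n; by field.
have e (Y Z : M4) : (Y + Z) i j = Y i j + Z i j by rewrite mxE.
apply: etrans (e _ _) _; rewrite mulrDl !mulmx4E !E.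
by elim/ord4P: i {e}; elim/ord4P: j; rewrite /=; ring.
Qed.

Lemma hF_skew_pt i j : hF i j + (hF i j)^T = 0.
Proof.
have e (X W : M4) : X - mu *: W + (X - mu *: W)^T = 0 -> W + W^T = 0 -> X + X^T = 0.
  move=> h1 h2; transitivity (X - mu *: W + (X - mu *: W)^T + mu *: (W + W^T)).
    by apply/matrixP => a b; rewrite !mxE; ring.
  by rewrite h1 h2 scaler0 addr0.
by apply: e (Fskew i j) (wedge_skew R i j).
Qed.

Lemma weyl_frameE (X : M4) i j : X + X^T = 0 -> weyl_frame X i j =
  hF i j i0 i1 * X i0 i1 + hF i j i0 i2 * X i0 i2 + hF i j i0 i3 * X i0 i3
    + hF i j i1 i2 * X i1 i2 + hF i j i1 i3 * X i1 i3 + hF i j i2 i3 * X i2 i3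
  - (scal g x / 12 + (d i + d j) / 2) * X i j.
Proof.
move=> Xs; rewrite -(half_trace (hF_skew_pt i j) Xs).
have e (Y Z W : M4) (b c : R) : (Y - b *: Z - c *: W) i j = Y i j - b * Z i j - c * W i j.
  by rewrite !mxE.
apply: etrans (e _ _ _ _ _) _; rewrite Ric0_frame_mulE [X in X - _ - _]mxE.
by move: (2^-1 * \tr _) => t; field.
Qed.

Lemma weyl_frame_skew (X : M4) : X + X^T = 0 -> weyl_frame X + (weyl_frame X)^T = 0.
Proof.
move=> Xs; apply/matrixP => i j.
have e (Y : M4) : (Y + Y^T) i j = Y i j + Y j i by rewrite !mxE.
apply: etrans (e _) _; rewrite [RHS]mxE !weyl_frameE//.
have hN a b : hF j i a b = - hF i j a b.
  by rewrite !hFE (F_antisym FN j i) !(wedgeE _ j i) wedgeE; ring.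
by rewrite !hN (skew_entry j i Xs); ring.
Qed.

Lemma low_self_dual h :
  low B (self_dual_part G (orient J) h) = 2^-1 *: (low B h + star (low B h)).
Proof.
by rewrite /self_dual_part lowZ lowD (low_hodge uG BG) (orient_frame BG BJ) scale1r.
Qed.

Lemma low_anti_self_dual h :
  low B (anti_self_dual_part G (orient J) h) = 2^-1 *: (low B h - star (low B h)).
Proof.
rewrite /anti_self_dual_part lowZ lowD lowN (low_hodge uG BG) (orient_frame BG BJ).
by rewrite scale1r.
Qed.

Lemma J0_skew : J0 + J0^T = 0.
Proof.
have := wedge_skew R i0 i1; have := wedge_skew R i2 i3; rewrite /J0.
move: (wedge i0 i1) (wedge i2 i3) => X Y h1 h2.
transitivity (X + X^T + (Y + Y^T)); last by rewrite h1 h2 addr0.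
by apply/matrixP => a b; rewrite !mxE; ring.
Qed.

Lemma half_trace_J0 (X : M4) : X + X^T = 0 -> 2^-1 * \tr (X *m J0^T) = X i0 i1 + X i2 i3.
Proof. by move=> Xs; rewrite (half_trace Xs J0_skew) !J0E !wedgeE /=; ring. Qed.

Lemma conformal_scalE (w : V -> M4) : w x = J *m G ->
  conformal_scal g (fun=> J) w x = 2 * la.
Proof.
move=> wx; have lw : low B (w x) = J0.
  by rewrite wx /low mulmxA BJ -mulmxA -mulmxA (mulmxA B) BG mulmx1.
rewrite /conformal_scal gx (inner2_low uG BG) lw.
rewrite /weyl_plus gx low_self_dual low_weyl_op low_self_dual lw.
have sJ : 2^-1 *: (J0 + star J0) = J0.
  rewrite (self_dual_frame J0_skew) !J0E !wedgeE /=.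
  by move: (J0) (phi0 R) (psi0 R) => X Y Z; apply/matrixP => a b; rewrite !mxE; field.
rewrite sJ; set X := weyl_frame J0.
have Xs : X + X^T = 0 by exact: weyl_frame_skew J0_skew.
have [s1 s2 _ _] := starE Xs.
have XsX : 2^-1 *: (X + star X) + (2^-1 *: (X + star X))^T = 0.
  have := star_skew Xs; move: (star X) => Y Ys.
  transitivity (2^-1 *: (X + X^T + (Y + Y^T))); last by rewrite Xs Ys addr0 scaler0.
  by apply/matrixP => a b; rewrite !mxE; ring.
have half (A C : M4) : C i0 i1 = A i2 i3 -> C i2 i3 = A i0 i1 ->
    (2^-1 *: (A + C)) i0 i1 + (2^-1 *: (A + C)) i2 i3 = A i0 i1 + A i2 i3.
  by rewrite !mxE => -> ->; field.
rewrite (half_trace_J0 XsX) (half _ _ s1 s2).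
have [f02 f03 f12 f13 f23] := fE.
rewrite /X !(weyl_frameE _ _ J0_skew) !J0E !hFE !wedgeE /= /d /= scalE.
have h23 : F' i2 i3 i0 i1 = - F' i2 i3 i2 i3 by apply/eqP; rewrite -addr_eq0; apply/eqP.
by rewrite h23 /la /f; field.
Qed.

(** In the frame the metric restricts to the matrices Pi0 and 1 - Pi0. *)
Lemma ricci0_projector (Pi : M4) (w : V -> M4) : w x = J *m G -> hat G B Pi = Pi0 ->
  ricci0 g x = (conformal_scal g (fun=> J) w x / 4)
    *: (- ((1%:M - Pi) *m G *m (1%:M - Pi)^T) + Pi *m G *m Pi^T).
Proof.
move=> wx hPi; apply: (low_inj uG BG); rewrite low_ricci0E conformal_scalE//.
have lowhat (A : M4) : low B (A *m G *m A^T) = hat G B A *m (hat G B A)^T.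
  have GT' : (G *m B^T)^T = B *m G by rewrite trmx_mul trmxK GT.
  rewrite /hat !trmx_mul GT trmxK /low.
  have BGB : G *m B^T *m B = 1%:M by apply: mulmx1C; rewrite mulmxA.
  move: (A^T) (B^T) BGB => A' T BGB.
  transitivity (B *m A *m (G *m T *m B) *m G *m A' *m T); last by mxring.
  by rewrite BGB mulmx1; mxring.
rewrite lowZ lowD lowN !lowhat hatD hatN (hat_scalar BG) hPi /Ric0_frame.
have PT : Pi0^T = Pi0 by rewrite /Pi0 raddfD/= !trmx_delta.
have PP : Pi0 *m Pi0 = Pi0.
  apply/matrixP => i j; elim/ord4P: i; rewrite Pi0_mul// !mxE /=;
  by rewrite ?addr0.
have QQ : (1%:M - Pi0) *m (1%:M - Pi0)^T = 1%:M - Pi0.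
  move: PP PT; move: (Pi0) => X XX XT.
  by rewrite raddfB/= trmx1 XT mulmxBl mul1mx mulmxBr mulmx1 XX subrr subr0.
rewrite PT PP QQ; move: (Pi0) => X.
by apply/matrixP => a b; rewrite !mxE; case: (a == b); by field.
Qed.

Lemma mulJb0E (A : M4) i : ((A *m Jb0) i i0 = A i i1) * ((A *m Jb0) i i1 = - A i i0) *
  ((A *m Jb0) i i2 = - A i i3) * ((A *m Jb0) i i3 = A i i2).
Proof. by do ![split]; rewrite mulmx4E !Jb0E !wedgeE /=; ring. Qed.

Lemma Jb0_tr : Jb0^T = - Jb0.
Proof.
have W i j : (wedge i j)^T = - wedge i j.
  by apply/eqP; rewrite -addr_eq0 addrC wedge_skew.
have e (X Y : M4) : X^T = - X -> Y^T = - Y -> (X - Y)^T = - (X - Y).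
  by move=> h1 h2; rewrite raddfB/= h1 h2 opprB opprK addrC.
by apply: e.
Qed.

Lemma Jb0_sqr : Jb0 *m Jb0 = - 1%:M.
Proof.
apply/matrixP => i j.
elim/ord4P: j; rewrite !mulJb0E !Jb0E !wedgeE !mxE; elim/ord4P: i; rewrite /=; ring.
Qed.

Lemma low_conj (A : M4) : low B (Jb *m A *m Jb^T) = - (Jb0 *m low B A *m Jb0).
Proof.
have -> : low B (Jb *m A *m Jb^T) = B *m Jb *m A *m (B *m Jb)^T.
  by rewrite /low trmx_mul !mulmxA.
by rewrite BJb trmx_mul Jb0_tr !mulmxN /low !mulmxA.
Qed.

Lemma Pi0_Jb0 : Pi0 *m Jb0 = Jb0 *m Pi0.
Proof.
apply/matrixP => i j; rewrite [RHS]mulmx4E.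
elim/ord4P: j; rewrite !mulJb0E !Jb0E !wedgeE !mxE; elim/ord4P: i; rewrite /=; ring.
Qed.

Lemma ricci_reversed : Jb *m ricci g x *m Jb^T = ricci g x.
Proof.
apply: (low_inj uG BG); rewrite low_conj low_ricciE.
move: Jb0_sqr Pi0_Jb0; move: (Jb0) (Pi0) => K X KK XK.
rewrite mulmxDr mul_mx_scalar -scalemxAr -XK mulmxDl -!scalemxAl KK.
by rewrite -mulmxA KK mulmxN mulmx1 !scalerN opprD !opprK scalemx1.
Qed.

Lemma low_reversed_form : low B (Jb *m G) = Jb0.
Proof. by rewrite /low mulmxA BJb -mulmxA -mulmxA (mulmxA B) BG mulmx1. Qed.

Lemma Jb0_skew : Jb0 + Jb0^T = 0. Proof. by rewrite Jb0_tr subrr. Qed.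

Lemma star_skewB (X : M4) : X + X^T = 0 ->
  2^-1 *: (X - star X) + (2^-1 *: (X - star X))^T = 0.
Proof.
move=> Xs; have := star_skew Xs; move: (star X) => Y Ys.
transitivity (2^-1 *: (X + X^T - (Y + Y^T))); last by rewrite Xs Ys subr0 scaler0.
by apply/matrixP => a b; rewrite !mxE; ring.
Qed.

Lemma anti_self_dual_entries (X : M4) : X + X^T = 0 -> let W := 2^-1 *: (X - star X) in
  [/\ W i0 i1 = 2^-1 * (X i0 i1 - X i2 i3), W i2 i3 = - W i0 i1,
     W i0 i2 = W i1 i3 & W i1 i2 = - W i0 i3].
Proof.
move=> Xs W; have [s1 s2 s3 [s4 s5 s6]] := starE Xs.
have e (A C : M4) i j : (2^-1 *: (A - C)) i j = 2^-1 * (A i j - C i j) by rewrite !mxE.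
by rewrite !e s1 s2 s3 s4 s5 s6; split; ring.
Qed.

Lemma F_mixed k l : (k, l) \in [:: (i0, i1); (i2, i3)] ->
  [/\ F' k l i0 i2 = 0, F' k l i0 i3 = 0, F' k l i1 i2 = 0 & F' k l i1 i3 = 0].
Proof.
have [b1 b2 b3 b4] := F_block.
have H a b : F' a b i0 i2 = 0 -> F' a b i0 i3 = 0 ->
  [/\ F' a b i0 i2 = 0, F' a b i0 i3 = 0, F' a b i1 i2 = 0 & F' a b i1 i3 = 0].
  have [h13 h12] := Fcomm_entries Fcomm a b.
  by rewrite h13 h12 => -> ->; rewrite oppr0.
by rewrite !inE => /orP[] /eqP[-> ->]; exact: H.
Qed.

(** The components of the curvature that would mix the two summands are those
    that vanish by [F_mixed]. *)
Lemma weyl_frame_antiinvariant (W : M4) : W + W^T = 0 -> W i0 i1 = 0 -> W i2 i3 = 0 ->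
  weyl_frame W i0 i1 = 0 /\ weyl_frame W i2 i3 = 0.
Proof.
move=> Ws w01 w23.
have [|a1 a2 a3 a4] := @F_mixed i0 i1; first by rewrite !inE eqxx.
have [|b1 b2 b3 b4] := @F_mixed i2 i3; first by rewrite !inE eqxx orbT.
rewrite !(weyl_frameE _ _ Ws) w01 w23 !hFE !wedgeE /= a1 a2 a3 a4 b1 b2 b3 b4.
by split; ring.
Qed.

Lemma weyl_frame_reversed c : let Z := weyl_frame (c *: Jb0) in
  [/\ Z i0 i2 = 0, Z i0 i3 = 0, Z i1 i2 = 0 & Z i1 i3 = 0].
Proof.
move=> Z; have Ws : c *: Jb0 + (c *: Jb0)^T = 0.
  by move: Jb0_skew; move: Jb0 => X h; rewrite linearZ/= -scalerDr h scaler0.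
have [e01 e02 e03] : [/\ (c *: Jb0) i0 i1 = - c, (c *: Jb0) i0 i2 = 0 & (c *: Jb0) i0 i3 = 0].
  have e i j : (c *: Jb0) i j = c * Jb0 i j by rewrite mxE.
  by rewrite !e !Jb0E !wedgeE /=; split; ring.
have [e12 e13 e23] : [/\ (c *: Jb0) i1 i2 = 0, (c *: Jb0) i1 i3 = 0 & (c *: Jb0) i2 i3 = c].
  have e i j : (c *: Jb0) i j = c * Jb0 i j by rewrite mxE.
  by rewrite !e !Jb0E !wedgeE /=; split; ring.
have [|a1 a2 a3 a4] := @F_mixed i0 i1; first by rewrite !inE eqxx.
have [|b1 b2 b3 b4] := @F_mixed i2 i3; first by rewrite !inE eqxx orbT.
have E i j : F' i0 i1 i j = 0 -> F' i2 i3 i j = 0 -> (c *: Jb0) i j = 0 ->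
    wedge i j i0 i1 = 0 -> wedge i j i2 i3 = 0 -> Z i j = 0.
  move=> h1 h2 h3 w1 w2; rewrite /Z (weyl_frameE _ _ Ws) e01 e02 e03 e12 e13 e23 h3 !hFE w1 w2.
  rewrite (Fpair FN Fskew Fbianchi i j i0 i1) (Fpair FN Fskew Fbianchi i j i2 i3) h1 h2.
  by ring.
by split; apply: E => //; rewrite wedgeE /= subrr.
Qed.

Lemma antiinvariant_frame_skew (Y : M4) : Y + Y^T = 0 ->
  let X := 2^-1 *: (Y + Jb0 *m Y *m Jb0) in
  [/\ X + X^T = 0, X i0 i1 = 0 & X i2 i3 = 0].
Proof.
move=> Ys X; have S i j : Y i j = - Y j i by exact: skew_entry.
have e (A C : M4) i j : (2^-1 *: (A + C)) i j = 2^-1 * (A i j + C i j) by rewrite !mxE.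
split.
- have T : (Jb0 *m Y *m Jb0)^T = - (Jb0 *m Y *m Jb0).
    rewrite !trmx_mul Jb0_tr; have -> : Y^T = - Y.
      by apply/eqP; rewrite -addr_eq0 addrC Ys.
    by move: Jb0 => K; mxring.
  have sk (A C : M4) (c : R) : A + A^T = 0 -> C^T = - C ->
      c *: (A + C) + (c *: (A + C))^T = 0.
    move=> h1 h2; transitivity (c *: (A + A^T + (C + C^T))); last first.
      by rewrite h1 h2 subrr addr0 scaler0.
    by apply/matrixP => a b; rewrite !mxE; ring.
  exact: sk.
- rewrite e mulJb0E mulmx4E !Jb0E !wedgeE /= (S i1 i0); ring.
rewrite e mulJb0E mulmx4E !Jb0E !wedgeE /= (S i3 i2); ring.
Qed.

Lemma half_trace_Jb0 (X : M4) : X + X^T = 0 -> 2^-1 * \tr (X *m Jb0^T) = X i2 i3 - X i0 i1.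
Proof. by move=> Xs; rewrite (half_trace Xs Jb0_skew) !Jb0E !wedgeE /=; ring. Qed.

Lemma weyl_minus_antiinvariant (Y : M4) : Y + Y^T = 0 ->
  let X := 2^-1 *: (Y + Jb0 *m Y *m Jb0) in
  let Z := weyl_frame (2^-1 *: (X - star X)) in
  2^-1 * \tr (2^-1 *: (Z - star Z) *m Jb0^T) = 0.
Proof.
move=> Ys X Z; have [Xs x01 x23] := antiinvariant_frame_skew Ys.
have [w01 w23 _ _] := anti_self_dual_entries Xs.
have Ws := star_skewB Xs.
rewrite x01 x23 subrr mulr0 in w01; rewrite w01 oppr0 in w23.
have [z01 z23] := weyl_frame_antiinvariant Ws w01 w23.
have Zs : Z + Z^T = 0 by exact: weyl_frame_skew.
rewrite (half_trace_Jb0 (star_skewB Zs)).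
have [v01 v23 _ _] := anti_self_dual_entries Zs.
by rewrite v23 v01 z01 z23 subrr mulr0 !oppr0 addr0.
Qed.

Lemma weyl_minus_reversed (c : R) :
  let Z := weyl_frame (2^-1 *: (c *: Jb0 - star (c *: Jb0))) in
  let A := 2^-1 *: (Z - star Z) in 2^-1 *: (A + Jb0 *m A *m Jb0) = 0.
Proof.
have Ws : c *: Jb0 + (c *: Jb0)^T = 0.
  by move: Jb0_skew; move: Jb0 => X h; rewrite linearZ/= -scalerDr h scaler0.
have -> : 2^-1 *: (c *: Jb0 - star (c *: Jb0)) = c *: Jb0.
  rewrite (anti_self_dual_frame Ws).
  have e i j : (c *: Jb0) i j = c * Jb0 i j by rewrite mxE.
  rewrite !e !Jb0E !wedgeE /=.
  rewrite /Jb0; move: (wedge _ _) (wedge i2 i3) (wedge i0 i2) (wedge i0 i3) (wedge i1 i2) (wedge i1 i3) => w1 w2 w3 w4 w5 w6.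
  by apply/matrixP => a b; rewrite !mxE; field.
move=> Z A; have [z02 z03 z12 z13] := weyl_frame_reversed c.
have Zs : Z + Z^T = 0 by exact: weyl_frame_skew.
have -> : A = (2^-1 * (Z i2 i3 - Z i0 i1)) *: Jb0.
  rewrite /A (anti_self_dual_frame Zs) z02 z03 z12 z13.
  rewrite /Jb0; move: (Z i0 i1) (Z i2 i3) (wedge i0 i1) (wedge i2 i3) => a b w w'.
  by apply/matrixP => u v; rewrite !mxE; field.
move: (_ * _) => r; move: Jb0_sqr; move: Jb0 => K KK.
by rewrite -scalemxAr -scalemxAl KK -scalerDr mulNmx mul1mx subrr !scaler0.
Qed.

Lemma weyl_minus2_eq0 (w : V -> M4) (h : M4) : w x = Jb *m G -> h^T = - h ->
  weyl_minus2 g (fun=> J) (fun=> Jb) w x h = 0.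
Proof.
move=> wx hs; have lw : low B (w x) = Jb0 by rewrite wx low_reversed_form.
have lW k : low B (weyl_minus g (fun=> J) x k)
    = 2^-1 *: (weyl_frame (2^-1 *: (low B k - star (low B k)))
       - star (weyl_frame (2^-1 *: (low B k - star (low B k))))).
  by rewrite /weyl_minus gx low_anti_self_dual low_weyl_op low_anti_self_dual.
have lA k : low B (antiinvariant_part Jb k)
    = 2^-1 *: (low B k + Jb0 *m low B k *m Jb0).
  by rewrite /antiinvariant_part lowZ lowD lowN low_conj opprK.
have Ys : low B h + (low B h)^T = 0 by apply: low_skew; rewrite hs subrr.
apply: (low_inj uG BG); rewrite [low B 0]/low mulmx0 mul0mx.
rewrite /weyl_minus2 lowD gx /line_part.
rewrite lowZ [in X in X + _](inner2_low uG BG) lW lA lw.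
rewrite weyl_minus_antiinvariant// mul0r scale0r add0r.
by rewrite lA lW lowZ lw weyl_minus_reversed.
Qed.

End PointwiseCurvature.

(** * The nullity distribution *)

Section Projector.
Variable R : realType.
Local Notation V := 'rV[R]_4.
Local Notation M4 := 'M[R]_4.
Variables (G Pi D : M4).
Hypotheses (uG : G \in unitmx) (GT : G^T = G).
Hypotheses (PiPi : Pi *m Pi = Pi) (PiG : (Pi *m G)^T = Pi *m G).
Hypothesis DP : forall X : V, (X <= D)%MS = (X *m Pi == 0).
Let D' : M4 := kermx (G *m D^T).

Lemma nullity_eqmx : (D == 1%:M - Pi)%MS.
Proof.
have e X : X *m (1%:M - Pi) *m Pi = 0 :> V.
  by rewrite -mulmxA mulmxBl mul1mx PiPi subrr mulmx0.
apply/andP; split; apply/rV_subP => X.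
  rewrite DP => /eqP X0; have -> : X = X *m (1%:M - Pi).
    by rewrite mulmxBr mulmx1 X0 subr0.
  exact: submxMl.
by move=> /submxP[Y ->]; rewrite DP e.
Qed.

Lemma perpP (X : V) : (X <= D')%MS = (X *m Pi == X).
Proof.
have GPi : G *m Pi^T = Pi *m G.
  by rewrite -[RHS]PiG trmx_mul GT.
rewrite /D' sub_kermx; apply/eqP/eqP => [h|XPi].
  have : X *m G *m (1%:M - Pi)^T = 0.
    have /submxP[Y ->] : (1%:M - Pi <= D)%MS by case/andP: nullity_eqmx.
    by rewrite trmx_mul mulmxA -(mulmxA X) h mul0mx.
  rewrite raddfB/= trmx1 mulmxBr mulmx1 -mulmxA GPi mulmxA => /subr0_eq.
  by move=> /(can_inj (mulmxK uG)).
have /submxP[Y ->] : (D <= 1%:M - Pi)%MS by case/andP: nullity_eqmx.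
rewrite trmx_mul -XPi -!mulmxA (mulmxA Pi) -GPi.
rewrite !mulmxA -(mulmxA _ Pi^T) -trmx_mul.
by rewrite mulmxBl mul1mx PiPi subrr trmx0 mulmx0 mul0mx.
Qed.

Lemma proj_nullity : (D :&: D')%MS = 0 ->
  proj_mx D D' = 1%:M - Pi /\ proj_mx D' D = Pi.
Proof.
move=> dx; have dx' : (D' :&: D)%MS = 0 by rewrite capmxC.
have s1 : (1%:M - Pi <= D)%MS by case/andP: nullity_eqmx.
have s2 : (Pi <= D')%MS.
  by apply/rV_subP => X /submxP[Y ->]; rewrite perpP -mulmxA PiPi.
have E : 1%:M = (1%:M - Pi) + Pi by rewrite subrK.
split.
  rewrite -[LHS]mul1mx {1}E mulmxDl (proj_mx_id dx s1) (proj_mx_0 dx s2).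
  by rewrite addr0.
by rewrite -[LHS]mul1mx {1}E mulmxDl (proj_mx_0 dx' s1) (proj_mx_id dx' s2) add0r.
Qed.

End Projector.

Lemma wedge_Jb0 (R : realType) : wedge R i0 i1 *m Jb0 R = Jb0 R *m wedge R i0 i1.
Proof.
apply/matrixP => i j; rewrite [RHS]mulmx4E.
elim/ord4P: j; rewrite !mulJb0E !Jb0E !wedgeE; elim/ord4P: i; rewrite /=; ring.
Qed.

Section ChartSummary.
Variable R : realType.
Local Notation V := 'rV[R]_4.
Local Notation M4 := 'M[R]_4.
Local Notation J0 := (J0 R).
Local Notation phi0 := (phi0 R).
Local Notation psi0 := (psi0 R).

Variables (U : set V) (g J : V -> M4).
Let Gam := christoffel g.
Hypotheses (oU : open U) (sg : smooth_on_mx U g).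
Hypothesis gT : forall x, U x -> (g x)^T = g x.
Hypothesis gpos : forall x, U x -> forall X : V, X != 0 -> 0 < bil (g x) X X.
Hypothesis sJ : smooth_on_mx U J.
Hypothesis JJ : forall x, U x -> J x *m J x = - 1%:M.
Hypothesis JG : forall x, U x -> J x *m g x *m (J x)^T = g x.
Hypothesis closed : forall x, U x -> forall i j k,
  partial i (fun y => (J y *m g y) j k) x + partial j (fun y => (J y *m g y) k i) x
    + partial k (fun y => (J y *m g y) i j) x = 0.
Hypothesis G2 : forall x, U x -> forall X Y Z W,
  riemann Gam g x X Y Z W - riemann Gam g x (X *m J x) (Y *m J x) Z W
  = riemann Gam g x (X *m J x) Y (Z *m J x) W + riemann Gam g x (X *m J x) Y Z (W *m J x).
Let N := norm_dJ g Gam J.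
Hypothesis N0 : forall x, U x -> N x != 0.
Let Pi := nproj g Gam J.
Let Jb := Jbar g Gam J.

Let gu x (Ux : U x) : g x \in unitmx := positive_unitmx (gpos Ux).
Let smooth_Gam k : smooth_on_mx U (Gam ^~ k) := smooth_christoffel oU sg gu k.
Let Gam_metric x k (Ux : U x) := christoffel_metric oU gT gu k Ux.
Let GamC x i k l (Ux : U x) := christoffelC oU gT i k l Ux.

Variable x : V.
Hypothesis Ux : U x.

Lemma frame_hat (B A : M4) : B *m g x *m B^T = 1%:M -> B *m A = hat (g x) B A *m B.
Proof.
move=> BG; have BGB : g x *m B^T *m B = 1%:M by apply: mulmx1C; rewrite mulmxA.
by rewrite /hat -mulmxA BGB mulmx1.
Qed.

Lemma normal_frame : exists (B : M4) (p : R),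
  [/\ B *m g x *m B^T = 1%:M, B *m J x = J0 *m B, p != 0 &
    [/\ hat1 (g x) B (fun k => covd Gam k J x) i0 = p *: phi0,
       hat1 (g x) B (fun k => covd Gam k J x) i1 = p *: psi0,
       hat1 (g x) B (fun k => covd Gam k J x) i2 = 0 &
       hat1 (g x) B (fun k => covd Gam k J x) i3 = 0]] /\
  [/\ hat (g x) B (Pi x) = Pi0 R, B *m Jb x = Jb0 R *m B &
    (forall i j k, hat1 (g x) B (fun k => covd Gam k Jb x) i j k
       + hat1 (g x) B (fun k => covd Gam k Jb x) j k i
       + hat1 (g x) B (fun k => covd Gam k Jb x) k i j = 0)].
Proof.
have [B [p [BG BJ p0 [h0 h1 h2 h3]]]] :=
  aligned_frame_exists oU sg gT gpos Gam_metric GamC sJ JJ JG closed Ux (N0 Ux).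
have hPi := hat_nproj gpos Ux BG p0 h0 h1 h2 h3.
exists B, p; split; first by split.
split=> //.
  rewrite (frame_hat _ BG) /Jb /Jbar hatD hatN hatZ (hatM BG) hPi (hat_J BG BJ).
  congr (_ *m B); have e (X Y : M4) i j : (X - 2 *: Y) i j = X i j - 2 * Y i j.
    by rewrite !mxE.
  apply: matrix4P; do ![split]; apply: etrans (e _ _ _ _) _;
    rewrite Pi0_mul Jb0E !J0E !wedgeE /=; ring.
exact (hat_dJbar_closed oU sg gT gpos smooth_Gam Gam_metric GamC sJ JJ JG closed G2 N0
  Ux BG BJ p0 h0 h1 h2 h3).
Qed.

Lemma nproj_idem : Pi x *m Pi x = Pi x.
Proof.
have [B [p [[BG _ _ _] [hPi _ _]]]] := normal_frame.
apply/eqP; rewrite -subr_eq0; apply/eqP; apply: (hat_inj BG).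
rewrite hatD hatN (hatM BG) hPi; apply/eqP; rewrite subr_eq0; apply/eqP.
by apply/matrixP => i j; elim/ord4P: i; rewrite Pi0_mul// !mxE /= ?addr0.
Qed.

Lemma nproj_sym : (Pi x *m g x)^T = Pi x *m g x.
Proof.
have [B [p [[BG _ _ _] [hPi _ _]]]] := normal_frame.
apply: (low_inj (gu Ux) BG); rewrite low_tr.
have -> : low B (Pi x *m g x) = Pi0 R by rewrite -hPi hat_form.
by rewrite /Pi0 raddfD/= !trmx_delta.
Qed.

(** In the frame the derivative along X is p (X0 phi0 + X1 psi0). *)
Lemma nproj_nullity (X : V) :
  \sum_k X 0 k *: covd Gam k J x = 0 <-> X *m Pi x = 0.
Proof.
have [B [p [[BG _ p0 [h0 h1 h2 h3]] [hPi _ _]]]] := normal_frame.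
have BGB : g x *m B^T *m B = 1%:M by apply: mulmx1C; rewrite mulmxA.
have [a XE] : exists a : V, X = a *m B.
  by exists (X *m (g x *m B^T)); rewrite -mulmxA BGB mulmx1.
have XS : hat (g x) B (\sum_k X 0 k *: covd Gam k J x)
    = (a 0 i0 * p) *: phi0 + (a 0 i1 * p) *: psi0.
  transitivity (\sum_i a 0 i *: hat1 (g x) B (fun k => covd Gam k J x) i).
    have hsum (c : 'I_4 -> R) (Y : 'I_4 -> M4) :
        hat (g x) B (\sum_i c i *: Y i) = \sum_i c i *: hat (g x) B (Y i).
      rewrite /hat mulmx_sumr mulmx_suml; apply: eq_bigr => i _.
      by rewrite -scalemxAr -scalemxAl.
    rewrite /hat1 -hsum; congr hat; rewrite /fr.
    under [RHS]eq_bigr do rewrite scaler_sumr.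
    rewrite exchange_big/=; apply: eq_bigr => k _; rewrite {1}XE mxE scaler_suml.
    by apply: eq_bigr => i _; rewrite scalerA.
  by rewrite sum4E h0 h1 h2 h3 !scaler0 !addr0 !scalerA.
have XP : X *m Pi x = a *m Pi0 R *m B.
  by rewrite -hPi {1}XE -mulmxA (frame_hat (Pi x) BG) mulmxA.
have aP j : (a *m Pi0 R) 0 j = a 0 i0 * (j == i0)%:R + a 0 i1 * (j == i1)%:R.
  rewrite mxE sum4E !mxE; elim/ord4P: j => /=; ring.
split=> h.
- rewrite h hat0 in XS.
  have e (r s : R) i j : (r *: phi0 + s *: psi0) i j = r * phi0 i j + s * psi0 i j.
    by rewrite !mxE.
  have a0 : a 0 i0 = 0.
    have := congr1 (fun A : M4 => A i0 i2) XS.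
    rewrite /= e phi0E psi0E !wedgeE /= mxE => H.
    have /eqP : a 0 i0 * p = 0 by lra.
    by rewrite mulf_eq0 (negbTE p0) orbF => /eqP.
  have a1 : a 0 i1 = 0.
    have := congr1 (fun A : M4 => A i0 i3) XS.
    rewrite /= e phi0E psi0E !wedgeE /= mxE => H.
    have /eqP : a 0 i1 * p = 0 by lra.
    by rewrite mulf_eq0 (negbTE p0) orbF => /eqP.
  rewrite XP (_ : a *m _ = 0) ?mul0mx//; apply/rowP => j.
  by rewrite aP a0 a1 !mul0r addr0 mxE.
have h' : a *m Pi0 R = 0.
  have : a *m Pi0 R *m (B *m g x *m B^T) = 0 by rewrite !mulmxA -XP h !mul0mx.
  by rewrite BG mulmx1.
apply: (hat_inj BG); rewrite XS.
have a0 : a 0 i0 = 0 by have := congr1 (fun A : V => A 0 i0) h'; rewrite /= aP mxE /= mulr1 mulr0 addr0.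
have a1 : a 0 i1 = 0 by have := congr1 (fun A : V => A 0 i1) h'; rewrite /= aP mxE /= mulr1 mulr0 add0r.
by rewrite a0 a1 !mul0r !scale0r addr0.
Qed.

Lemma Jbar_parallel (X : V) : X *m Pi x = X -> \sum_k X 0 k *: covd Gam k Jb x = 0.
Proof.
move=> XPi.
have E k : \sum_a Pi x k a *: covd Gam a Jb x = 0.
  exact (nproj_Jbar oU sg gT gpos smooth_Gam Gam_metric GamC sJ JJ JG closed G2 N0 k Ux).
have XE a : X 0 a = \sum_k X 0 k * Pi x k a by rewrite -{1}XPi mxE.
under eq_bigr => a _ do rewrite XE scaler_suml.
rewrite exchange_big/= big1// => k _.
transitivity (X 0 k *: \sum_a Pi x k a *: covd Gam a Jb x).
  by rewrite scaler_sumr; apply: eq_bigr => a _; rewrite scalerA.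
by rewrite E scaler0.
Qed.

Lemma Jbar_sqr : Jb x *m Jb x = - 1%:M.
Proof.
have [B [p [[BG _ _ _] [_ BJb _]]]] := normal_frame.
have BGB : g x *m B^T *m B = 1%:M by apply: mulmx1C; rewrite mulmxA.
rewrite -[LHS]mul1mx -BGB -mulmxA (mulmxA B) BJb -(mulmxA _ B) BJb (mulmxA (Jb0 R)).
by rewrite Jb0_sqr mulNmx mul1mx mulmxN BGB.
Qed.

Lemma Jbar_orthogonal : Jb x *m g x *m (Jb x)^T = g x.
Proof.
have [B [p [[BG _ _ _] [_ BJb _]]]] := normal_frame.
apply: (low_inj (gu Ux) BG); rewrite (low_conj BJb) (low_metric BG) mulmx1.
by rewrite Jb0_sqr opprK.
Qed.

Lemma Jbar_skew : Jb x *m g x + (Jb x *m g x)^T = 0.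
Proof.
have [B [p [[BG _ _ _] [_ BJb _]]]] := normal_frame.
apply: (low_inj (gu Ux) BG); rewrite lowD low_tr (low_reversed_form BG BJb) Jb0_skew.
by rewrite /low mulmx0 mul0mx.
Qed.

Lemma Jbar_closed i j k :
  partial i (fun y => (Jb y *m g y) j k) x + partial j (fun y => (Jb y *m g y) k i) x
    + partial k (fun y => (Jb y *m g y) i j) x = 0.
Proof.
have sJb : smooth_on_mx U Jb.
  exact (smooth_Jbar oU sg gpos smooth_Gam sJ N0).
rewrite (closed_covd sg Gam_metric GamC i j k Ux sJb Jbar_skew).
have [B [p [[BG _ _ _] [_ _ cl]]]] := normal_frame.
pose T a b c : R^o := (covd Gam a Jb x *m g x) b c.
pose T' a b c : R^o := T a b c + T b c a + T c a b.
have T0 u v w : fr3 B T' u v w = 0.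
  rewrite /T' !fr3D -(fr3_rot B T u v w).
  rewrite -(fr3_rot B (fun a b c => T b c a) u v w) -(fr3_rot B T v w u).
  by have := cl u v w; rewrite !hat1_entry.
suff : T' i j k = 0 by [].
have T1 u a b : fr B (fun c => T' c a b) u = 0.
  apply: (fr2_inj BG (T := fun a b => fr B (fun c => T' c a b) u)) => v w.
  rewrite -[RHS](T0 u v w) /fr3 /fr2.
  rewrite [RHS]fr_swap; apply: eq_fr => c.
  by rewrite [RHS]fr_swap.
by rewrite -(fr_inverse BG (fun c => T' c j k) i) big1// => u _; rewrite T1 scaler0.
Qed.

Lemma curvature_summary (w : V -> M4) (wb : V -> M4) (h : M4) : h^T = - h ->
  w x = J x *m g x -> wb x = Jb x *m g x ->
  [/\ ricci0 g x = (conformal_scal g (fun=> J x) w x / 4)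
      *: (- ((1%:M - Pi x) *m g x *m (1%:M - Pi x)^T) + Pi x *m g x *m (Pi x)^T),
    orient (Jb x) = - orient (J x),
    Jb x *m ricci g x *m (Jb x)^T = ricci g x &
    weyl_minus2 g (fun=> J x) (fun=> Jb x) wb x h = 0].
Proof.
move=> hs wx wbx.
have [B [p [[BG BJ p0 [h0 h1 h2 h3]] [hPi BJb _]]]] := normal_frame.
have [r1 r2 r3 r4] := reduced_hF oU sg gT smooth_Gam Gam_metric GamC sJ JJ JG closed G2
  Ux BG BJ h0 h1 h2 h3.
have [_ f0] := reduced_hF_bianchi2 oU sg gT gpos smooth_Gam Gam_metric GamC sJ JJ JG
  closed G2 Ux BG BJ p0 h0 h1 h2 h3.
have F1 := curvature_commutes_Jbar oU sg gT gpos smooth_Gam Gam_metric GamC sJ JJ JG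
  closed G2 N0 Ux BG BJ p0 h0 h1 h2 h3.
pose hF := hat2 (g x) B (curv_endo g x).
have cE : hat2 (g x) B (fun k l => curvature Gam x k l) = hF by [].
rewrite cE in r1 r2 r3 r4 f0 F1.
have hJb : hat (g x) B (Jbar g Gam J x) = Jb0 R.
  by rewrite /hat BJb -mulmxA (mulmxA B) BG mulmx1.
have F01 : (hF i0 i1 - (- p ^+ 2 / 2) *: wedge R i0 i1) *m Jb0 R
    = Jb0 R *m (hF i0 i1 - (- p ^+ 2 / 2) *: wedge R i0 i1).
  rewrite hJb in F1; move: (- p ^+ 2 / 2) F1 (wedge_Jb0 R); move: (hF i0 i1) (Jb0 R).
  move=> X K c XK wK.
  by rewrite mulmxBl mulmxBr -scalemxAl -scalemxAr XK wK.
have ug := gu Ux.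
split.
- exact: (ricci0_projector ug (gT Ux) BG BJ (erefl (g x)) r1 r2 r3 r4 f0 wx hPi).
- exact: (orient_reversed BG BJ BJb).
- exact: (ricci_reversed ug BG BJb (erefl (g x)) r1 r2 r3 r4 f0).
exact: (weyl_minus2_eq0 ug BG BJ BJb (erefl (g x)) r1 r2 r3 r4 f0 F01 wbx hs).
Qed.

End ChartSummary.

(** * Change of coordinates *)

Section Transition.
Variable R : realType.
Local Notation V := 'rV[R]_4.
Local Notation M4 := 'M[R]_4.
Variables (W U : set V) (tau : V -> V) (g h J I : V -> M4).
Hypotheses (oW : open W) (oU : open U) (stau : smooth_on_mx W tau).
Hypothesis Wtau : forall y, W y -> U (tau y).
Hypotheses (sg : smooth_on_mx W g) (sh : smooth_on_mx U h).
Hypotheses (sJ : smooth_on_mx W J) (sI : smooth_on_mx U I).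
Hypothesis gT : forall y, W y -> (g y)^T = g y.
Hypothesis hT : forall y, U y -> (h y)^T = h y.
Hypothesis gu : forall y, W y -> g y \in unitmx.
Hypothesis hu : forall y, U y -> h y \in unitmx.

Definition jac_mx (y : V) : M4 := \matrix_(a, i) partial a (fun z => tau z 0 i) y.
Let K := jac_mx.

Hypothesis ghK : forall y, W y -> g y = K y *m h (tau y) *m (K y)^T.
Hypothesis JIK : forall y, W y -> J y *m K y = K y *m I (tau y).

Lemma smooth_jac_mx : smooth_on_mx W K.
Proof.
move=> a i; under eq_fun do rewrite mxE.
by apply: smooth_on_partial; exact: stau.
Qed.

Lemma jacobian_unit y : W y -> K y \in unitmx.
Proof.
move=> Wy; have := gu Wy; rewrite ghK// -mulmxA !unitmxE det_mulmx.
by rewrite unitrM => /andP[].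
Qed.

Lemma partial_jacobianC y k i m : W y -> partial_mx k K y i m = partial_mx i K y k m.
Proof.
move=> Wy; have E a b : partial_mx a K y b m = partial a (partial b (fun z => tau z 0 m)) y.
  by rewrite partial_mxE; apply: partial_ext => z; rewrite mxE.
by apply: etrans (E k i) (etrans _ (esym (E i k))); exact (partial_comm k i oW Wy (stau 0 m)).
Qed.

Lemma partial_mx_comp (A : V -> M4) k y : W y -> smooth_on_mx U A ->
  differentiable_mx (fun z => A (tau z)) y /\
  partial_mx k (fun z => A (tau z)) y = \sum_a K y k a *: partial_mx a A (tau y).
Proof.
move=> Wy sA; have dA := smooth_differentiable_mx sA (Wtau Wy).
have dt j : differentiable (fun z => tau z 0 j) y.
  exact: smooth_on_differentiable (stau 0 j) Wy.
split=> [i j|]; first by have [] := partial_comp k dt (dA i j).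
apply/matrixP => i j; rewrite partial_mxE summxE.
have [_ ->] := partial_comp k dt (dA i j).
apply: eq_bigr => a _; rewrite [RHS]mxE [K y k a]mxE; congr (_ * _).
by rewrite mxE.
Qed.

Variable y : V.
Hypothesis Wy : W y.
Let dK := smooth_differentiable_mx smooth_jac_mx Wy.
Let uK := jacobian_unit Wy.
Let ctr (X : 'I_4 -> M4) k : M4 := \sum_a K y k a *: X a.

Lemma ctr_mulr (X : 'I_4 -> M4) (A : M4) k : ctr X k *m A = ctr (fun a => X a *m A) k.
Proof. by rewrite /ctr mulmx_suml; apply: eq_bigr => a _; rewrite scalemxAl. Qed.

Lemma ctr_mull (X : 'I_4 -> M4) (A : M4) k : A *m ctr X k = ctr (fun a => A *m X a) k.
Proof. by rewrite /ctr mulmx_sumr; apply: eq_bigr => a _; rewrite scalemxAr. Qed.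

Lemma ctr_tr (X : 'I_4 -> M4) k : (ctr X k)^T = ctr (fun a => (X a)^T) k.
Proof. by rewrite /ctr raddf_sum; apply: eq_bigr => a _; rewrite /= linearZ. Qed.

Lemma ctrD (X Y : 'I_4 -> M4) k : ctr (fun a => X a + Y a) k = ctr X k + ctr Y k.
Proof. by rewrite /ctr -big_split; apply: eq_bigr => a _; rewrite scalerDr. Qed.

(** The right-hand side satisfies the two axioms of the Levi-Civita connection
    of g; its first term is symmetric by the symmetry of the second derivatives
    of tau. *)
Lemma christoffel_transition k : christoffel g y k =
  partial_mx k K y *m invmx (K y)
  + K y *m ctr (christoffel h (tau y)) k *m invmx (K y).
Proof.
apply: (christoffel_unique gT gu Wy (C := fun k => partial_mx k K y *m invmx (K y)
  + K y *m ctr (christoffel h (tau y)) k *m invmx (K y))) => [m|i m l].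
- have [dh ph] := partial_mx_comp m Wy sh.
  rewrite (eq_partial_mx m oW Wy ghK).
  have dKh := differentiable_mxM dK dh.
  rewrite (partial_mxM m dKh (differentiable_mx_tr dK)) (partial_mxM m dK dh).
  rewrite partial_mx_tr ph -/(ctr (fun a => partial_mx a h (tau y)) m) (ghK Wy).
  have -> : ctr (fun a => partial_mx a h (tau y)) m =
      ctr (christoffel h (tau y)) m *m h (tau y)
      + h (tau y) *m (ctr (christoffel h (tau y)) m)^T.
    rewrite ctr_tr ctr_mulr ctr_mull -ctrD; apply: eq_bigr => a _; congr (_ *: _).
    exact: (christoffel_metric oU hT hu a (Wtau Wy)).
  move: (ctr _ m) => C.
  have hT' := hT (Wtau Wy); move: (h (tau y)) hT' => H HT.
  rewrite !linearD/= !trmx_mul; move: (partial_mx m K y) => dKm.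
  have uKt : (K y)^T \in unitmx by rewrite unitmx_tr.
  rewrite trmx_inv; move: (K y) (K y)^T uK uKt => A A' uA uA'.
  transitivity (dKm *m (invmx A *m A) *m H *m A' + A *m C *m (invmx A *m A) *m H *m A'
    + A *m H *m (A' *m invmx A') *m dKm^T + A *m H *m (A' *m invmx A') *m (C^T *m A')).
    by rewrite !mulVmx// !mulmxV// !mulmx1; mxring.
  by move: (invmx A) (invmx A') (C^T) (dKm^T) => B B' C' D'; mxring.
have e (A B : M4) i' j' : (A + B) i' j' = A i' j' + B i' j' by rewrite mxE.
apply: etrans (e _ _ _ _) (etrans _ (esym (e _ _ _ _))); congr (_ + _).
  apply: etrans (mulmx_ijE _ _ _ _) (etrans _ (esym (mulmx_ijE _ _ _ _))).
  by apply: eq_bigr => j _; congr (_ * _); exact: partial_jacobianC.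
apply: etrans (mulmx_ijE _ _ _ _) (etrans _ (esym (mulmx_ijE _ _ _ _))).
apply: eq_bigr => j _; congr (_ * _).
have E a b : (K y *m ctr (christoffel h (tau y)) a) b j
    = \sum_c \sum_d K y b c * (K y a d * christoffel h (tau y) d c j).
  apply: etrans (mulmx_ijE _ _ _ _) _; apply: eq_bigr => c _; rewrite /ctr summxE mulr_sumr.
  by apply: eq_bigr => d _; rewrite [X in _ * X]mxE.
apply: etrans (E m i) (etrans _ (esym (E i m))); rewrite exchange_big/=.
apply: eq_bigr => c _; apply: eq_bigr => d _.
have cC := christoffelC oU hT d c j (Wtau Wy).
by move: cC; move: (christoffel h _ d c j) (christoffel h _ c d j) (K y i _) (K y m _) => r s t u ->; ring.
Qed.

(** The derivative of J *m K = K *m I, in which the inhomogeneous terms of the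
    symbols cancel the derivatives of K. *)
Lemma covd_transition k : covd (christoffel g) k J y *m K y =
  K y *m \sum_a K y k a *: covd (christoffel h) a I (tau y).
Proof.
have [dI pI] := partial_mx_comp k Wy sI.
have dJ := smooth_differentiable_mx sJ Wy.
have := eq_partial_mx k oW Wy JIK; rewrite (partial_mxM k dJ dK) (partial_mxM k dK dI) pI.
rewrite -/(ctr (fun a => partial_mx a I (tau y)) k).
rewrite -/(ctr (fun a => covd (christoffel h) a I (tau y)) k).
have -> : ctr (fun a => covd (christoffel h) a I (tau y)) k
   = ctr (fun a => partial_mx a I (tau y)) k + I (tau y) *m ctr (christoffel h (tau y)) k
     - ctr (christoffel h (tau y)) k *m I (tau y).
  rewrite ctr_mulr ctr_mull -ctrD /ctr -sumrN -big_split; apply: eq_bigr => a _ /=.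
  by rewrite /covd scalerBr.
rewrite /covd christoffel_transition.
have JK := JIK Wy; move: JK uK.
move: (ctr (fun a => partial_mx a I (tau y)) k) (ctr (christoffel h (tau y)) k) (partial_mx k J y) (partial_mx k K y).
move: (K y) (J y) (I (tau y)) => A X Z PI C PJ PK XA uA E.
have -> : PJ = PJ *m A *m invmx A by rewrite mulmxK.
have -> : PJ *m A = PK *m Z + A *m PI - X *m PK by rewrite -E addrK.
have X' : X = A *m Z *m invmx A by rewrite -XA mulmxK.
rewrite X'; move: (invmx A) (mulVmx uA) => B BA.
apply/eqP; rewrite -subr_eq0; apply/eqP.
transitivity ((PK *m Z + A *m PI - A *m Z *m B *m PK) *m (B *m A - 1%:M)
  + A *m Z *m B *m (PK + A *m C) *m (B *m A - 1%:M)
  + A *m Z *m (B *m A - 1%:M) *m C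
  - (PK + A *m C) *m (B *m A - 1%:M) *m Z
  - (PK + A *m C) *m B *m A *m Z *m (B *m A - 1%:M)); first by mxring.
by rewrite BA subrr !mulmx0 !mul0mx !addr0 !subr0.
Qed.

(** ** Invariance of the norm and of the reversed structure *)

Lemma trace_form_transition :
  trace_form (christoffel g) J y = K y *m trace_form (christoffel h) I (tau y) *m (K y)^T.
Proof.
have E k : covd (christoffel g) k J y
   = K y *m (\sum_a K y k a *: covd (christoffel h) a I (tau y)) *m invmx (K y).
  by rewrite -covd_transition mulmxK.
apply/matrixP => k l; rewrite mxE !E.
pose P a := covd (christoffel h) a I (tau y).
transitivity (\tr (ctr P k *m ctr P l)).
  rewrite -/(ctr P k) -/(ctr P l); move: (ctr P k) (ctr P l) uK; move: (K y) => A X Z uA.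
  rewrite -!mulmxA mxtrace_mulC -!mulmxA mulVmx// mulmx1.
  by rewrite (mulmxA (invmx A)) mulVmx// mul1mx.
have -> : \tr (ctr P k *m ctr P l)
    = \sum_a \sum_b K y k a * (K y l b * \tr (P a *m P b)).
  rewrite ctr_mulr /ctr raddf_sum; apply: eq_bigr => a _ /=.
  rewrite mxtraceZ mulmx_sumr raddf_sum mulr_sumr; apply: eq_bigr => b _ /=.
  by rewrite -scalemxAr mxtraceZ.
apply: esym; apply: etrans (mulmx_ijE _ _ _ _) _; rewrite exchange_big/=.
apply: eq_bigr => b _; rewrite mulmx_ijE mulr_suml; apply: eq_bigr => a _.
by rewrite [trace_form _ _ _ _ _]mxE [(_^T) _ _]mxE -mulrA (mulrC (\tr _)).
Qed.

Lemma trace_endo_transition :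
  trace_endo g (christoffel g) J y *m K y
    = K y *m trace_endo h (christoffel h) I (tau y).
Proof.
rewrite /trace_endo trace_form_transition ghK//.
have uh := hu (Wtau Wy); have uKt : (K y)^T \in unitmx by rewrite unitmx_tr.
have -> : invmx (K y *m h (tau y) *m (K y)^T)
    = invmx (K y)^T *m invmx (h (tau y)) *m invmx (K y).
  have uG : K y *m h (tau y) *m (K y)^T \in unitmx by rewrite -ghK//; exact: gu.
  apply: (can_inj (mulKmx uG)); rewrite mulmxV//.
  by rewrite -!mulmxA (mulmxA (K y)^T) mulmxV// mul1mx (mulmxA (h _)) mulmxV// mul1mx mulmxV.
by rewrite -!mulmxA (mulmxA (K y)^T) mulmxV// mul1mx mulVmx// mulmx1.
Qed.

Lemma norm_transition :
  norm_dJ g (christoffel g) J y = norm_dJ h (christoffel h) I (tau y).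
Proof.
rewrite /norm_dJ; congr (- _).
have -> : trace_endo g (christoffel g) J y
    = K y *m trace_endo h (christoffel h) I (tau y) *m invmx (K y).
  by rewrite -trace_endo_transition mulmxK.
by rewrite mxtrace_mulC mulmxA mulVmx// mul1mx.
Qed.

Lemma Jbar_transition :
  Jbar g (christoffel g) J y *m K y = K y *m Jbar h (christoffel h) I (tau y).
Proof.
have Pi : nproj g (christoffel g) J y *m K y
    = K y *m nproj h (christoffel h) I (tau y).
  by rewrite /nproj -scalemxAl trace_endo_transition norm_transition scalemxAr.
rewrite /Jbar mulmxBl mulmxBr -scalemxAl -scalemxAr JIK// -mulmxA JIK//.
by rewrite mulmxA Pi mulmxA.
Qed.

End Transition.

(** * Tensor fields on the manifold *)

Section Integrability.
Variable R : realType.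
Local Notation V := 'rV[R]_4.

Lemma eq_bil (C C' : 'M[R]_4) : (forall X Y, bil C X Y = bil C' X Y) -> C = C'.
Proof.
move=> CC; apply/matrixP => i j; have := CC (delta_mx 0 i) (delta_mx 0 j).
by rewrite /bil !trmx_delta -!rowE -!colE ![col _ _ _ _]mxE ![row _ _ _ _]mxE.
Qed.

(** The partial derivatives in the Nijenhuis tensor can be replaced by those of
    any torsion-free connection. *)
Lemma parallel_integrable (Gam : V -> 'I_4 -> 'M[R]_4) (J : V -> 'M[R]_4) x i j k :
  (forall i k l, Gam x k i l = Gam x i k l) -> J x *m J x = - 1%:M ->
  (forall l, covd Gam l J x = 0) -> nijenhuis J x i j k = 0.
Proof.
move=> GamC JJ J0; have E l a b : partial l (fun y => J y a b) x
    = (Gam x l *m J x) a b - (J x *m Gam x l) a b.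
  have e (A B C : 'M[R]_4) : A + B - C = 0 -> A a b = C a b - B a b.
    by move=> /(congr1 (fun M : 'M[R]_4 => M a b)); rewrite !mxE; lra.
  by rewrite -partial_mxE; exact: e (J0 l).
have GJ l a b : (Gam x l *m J x) a b = (Gam x a *m J x) l b.
  rewrite !mulmx_ijE; apply: eq_bigr => m _; congr (_ * _); exact: GamC.
rewrite /nijenhuis.
pose S a b := \sum_l J x a l * (J x *m Gam x l) b k.
have SC : S i j = S j i.
  rewrite /S; under eq_bigr => l _ do rewrite mulmx_ijE mulr_sumr.
  under [RHS]eq_bigr => l _ do rewrite mulmx_ijE mulr_sumr.
  rewrite exchange_big/=; apply: eq_bigr => m _; apply: eq_bigr => l _.
  by rewrite (GamC l m k) mulrCA.
pose T a b := (J x *m (Gam x b *m J x)) a k.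
have t1 a b : \sum_l J x a l * (Gam x l *m J x) b k = T a b.
  by rewrite /T mulmx_ijE; apply: eq_bigr => l _; rewrite GJ.
have t2 a b : \sum_l J x l k * ((Gam x a *m J x) b l - (J x *m Gam x a) b l)
    = - Gam x a b k - T b a.
  transitivity (((Gam x a *m J x - J x *m Gam x a) *m J x) b k).
    have e (A B : 'M[R]_4) l : (A - B) b l = A b l - B b l by rewrite !mxE.
    by rewrite mulmx_ijE; apply: eq_bigr => l _; rewrite e mulrC.
  rewrite mulmxBl -!mulmxA JJ mulmxN mulmx1 /T.
  have e (A B : 'M[R]_4) l : (- A - B) b l = - A b l - B b l by rewrite !mxE.
  exact: e.
transitivity ((T i j - S i j) - (T j i - S j i)
  - (- Gam x i j k - T j i) + (- Gam x j i k - T i j)).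
  rewrite -(t2 i j) -(t2 j i) -(t1 i j) -(t1 j i) /S.
  have sum6 (a b c d e f : 'I_4 -> R) : \sum_l (a l - b l - (c l - d l) - e l + f l)
      = (\sum_l a l - \sum_l b l) - (\sum_l c l - \sum_l d l) - \sum_l e l + \sum_l f l.
    by rewrite big_split/= !sumrB.
  rewrite -sum6; apply: eq_bigr => l _.
  by rewrite !E; ring.
by rewrite SC (GamC j i k); ring.
Qed.

End Integrability.

Section Global.
Variables (R : realType) (M : topologicalType) (A : atlas4 R M) (g J Om : mxfield A).
Hypotheses (akJ : almost_kahler g J Om) (G2 : condition_G2 g J).
Local Notation V := 'rV[R]_4.
Implicit Types (c d : chart A) (p : M).

Lemma open_chart_img c : open (chart_img c). Proof. exact: chart_img_open. Qed.

Lemma chart_imgP c p : chart_dom c p -> chart_img c (chart_map c p).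
Proof. by move=> cp; exists p. Qed.

Lemma smooth_g c : smooth_on_mx (chart_img c) (g c).
Proof. by case: akJ => [[[sg _] _ _] _ _ _ _]. Qed.
Lemma g_tr c x : chart_img c x -> (g c x)^T = g c x.
Proof. by case: akJ => [[_ gT _] _ _ _ _]; exact: gT. Qed.
Lemma g_pos c x : chart_img c x -> forall X : V, X != 0 -> 0 < bil (g c x) X X.
Proof. by case: akJ => [[_ _ gp] _ _ _ _]; exact: gp. Qed.
Lemma g_unit c x : chart_img c x -> g c x \in unitmx.
Proof. by move=> cx; exact: positive_unitmx (g_pos cx). Qed.
Lemma smooth_J c : smooth_on_mx (chart_img c) (J c).
Proof. by case: akJ => [_ [[sJ _] _] _ _ _]. Qed.
Lemma J_sqr c x : chart_img c x -> J c x *m J c x = - 1%:M.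
Proof. by case: akJ => [_ [_ JJ] _ _ _]; exact: JJ. Qed.

Lemma J_orthogonal c x : chart_img c x -> J c x *m g c x *m (J c x)^T = g c x.
Proof.
move=> cx; apply: eq_bil => X Y; case: akJ => [_ _ _ /(_ c x cx X Y) <- _].
by rewrite /bil trmx_mul !mulmxA.
Qed.

Lemma OmE c x : chart_img c x -> Om c x = J c x *m g c x.
Proof.
move=> cx; apply: eq_bil => X Y; case: akJ => [_ _ _ _ ->]//.
by rewrite /bil !mulmxA.
Qed.

Lemma Jg_closed c x : chart_img c x -> forall i j k,
  partial i (fun y => (J c y *m g c y) j k) x + partial j (fun y => (J c y *m g c y) k i) x
    + partial k (fun y => (J c y *m g c y) i j) x = 0.
Proof.
move=> cx i j k; case: akJ => [_ _ [_ _ _ /(_ c x cx i j k) <-] _ _].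
have E a u v : partial a (fun y => (J c y *m g c y) u v) x
    = partial a (fun y => Om c y u v) x.
  by apply: (eq_partial _ (@open_chart_img c) cx) => y cy; rewrite OmE.
exact (congr2 +%R (congr2 +%R (E i j k) (E j k i)) (E k i j)).
Qed.

Lemma G2_chart c x : chart_img c x -> forall X Y Z W,
  let r := riemann (christoffel (g c)) (g c) x in
  r X Y Z W - r (X *m J c x) (Y *m J c x) Z W
  = r (X *m J c x) Y (Z *m J c x) W + r (X *m J c x) Y Z (W *m J c x).
Proof. by move=> cx X Y Z W; exact: (G2 cx X Y Z W). Qed.

Definition dJ_norm c : V -> R := norm_dJ (g c) (christoffel (g c)) (J c).

(** ** Overlaps of charts *)

Definition overlap c d : set V := chart_map c @` (chart_dom c `&` chart_dom d).

Lemma overlapE c d : overlap c d = chart_img c `&` chart_inv c @^-1` chart_dom d.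
Proof.
apply/seteqP; split => [_ [p [cp dp] <-]|_ [[p cp <-]]] /=.
  by split; [exact: chart_imgP|rewrite /= chart_mapK].
by rewrite chart_mapK// => dp; exists p.
Qed.

Lemma open_overlap c d : open (overlap c d).
Proof.
rewrite overlapE; have := @chart_inv_continuous _ _ A c.
rewrite continuous_open_subspace; last exact: chart_img_open.
by move/(continuous_inP _ (@open_chart_img c)); apply; exact: chart_dom_open.
Qed.

Lemma overlap_sub c d : overlap c d `<=` chart_img c.
Proof. by rewrite overlapE => x []. Qed.

Lemma transition_map c d p : chart_dom c p ->
  transition c d (chart_map c p) = chart_map d p.
Proof. by move=> cp; rewrite /transition /= chart_mapK. Qed.

Lemma transition_overlap c d y : overlap c d y -> chart_img d (transition c d y).
Proof. by move=> [p [cp dp] <-]; rewrite transition_map//; exact: chart_imgP. Qed.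

Lemma smooth_transition c d : smooth_on_mx (overlap c d) (transition c d).
Proof. exact: transition_smooth. Qed.

Lemma jacobian_transition c d y : overlap c d y ->
  'J (transition c d) y = jac_mx (transition c d) y.
Proof.
move=> Wy; apply/matrixP => a i; rewrite [RHS]mxE; apply: jacobianE => j.
exact: smooth_on_differentiable (@smooth_transition c d 0 j) Wy.
Qed.

Lemma g_transition c d y : overlap c d y ->
  g c y = jac_mx (transition c d) y *m g d (transition c d y) *m (jac_mx (transition c d) y)^T.
Proof.
move=> /[dup] Wy [p [cp dp] yE]; rewrite -jacobian_transition// -yE transition_map//.
by case: akJ => [[[_ gK] _ _] _ _ _ _]; exact: gK.
Qed.

Lemma J_transition c d y : overlap c d y ->
  J c y *m jac_mx (transition c d) y = jac_mx (transition c d) y *m J d (transition c d y).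
Proof.
move=> /[dup] Wy [p [cp dp] yE]; rewrite -jacobian_transition// -yE transition_map//.
by case: akJ => [_ [[_ JK] _] _ _ _]; exact: JK.
Qed.

Section Overlap.
Variables (c d : chart A) (y : V).
Hypothesis Wy : overlap c d y.
Let sJW := sub_smooth_on_mx (@overlap_sub c d) (@smooth_J c).
Let gTW z (Wz : overlap c d z) := g_tr (overlap_sub Wz).
Let guW z (Wz : overlap c d z) := g_unit (overlap_sub Wz).

Lemma dJ_norm_transition : dJ_norm c y = dJ_norm d (transition c d y).
Proof.
exact (norm_transition (@open_overlap c d) (@open_chart_img d) (@smooth_transition c d)
  (@transition_overlap c d) (@smooth_g d) sJW (@smooth_J d) gTW (@g_tr d) guW (@g_unit d)
  (@g_transition c d) (@J_transition c d) Wy).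
Qed.

Lemma covd_J_transition k :
  covd (christoffel (g c)) k (J c) y *m jac_mx (transition c d) y
  = jac_mx (transition c d) y *m \sum_a jac_mx (transition c d) y k a
      *: covd (christoffel (g d)) a (J d) (transition c d y).
Proof.
exact (covd_transition (@open_overlap c d) (@open_chart_img d) (@smooth_transition c d)
  (@transition_overlap c d) (@smooth_g d) sJW (@smooth_J d) gTW (@g_tr d) guW (@g_unit d)
  (@g_transition c d) (@J_transition c d) Wy k).
Qed.

Lemma reversed_transition :
  Jbar (g c) (christoffel (g c)) (J c) y *m jac_mx (transition c d) y
  = jac_mx (transition c d) y *m Jbar (g d) (christoffel (g d)) (J d) (transition c d y).
Proof.
exact (Jbar_transition (@open_overlap c d) (@open_chart_img d) (@smooth_transition c d)
  (@transition_overlap c d) (@smooth_g d) sJW (@smooth_J d) gTW (@g_tr d) guW (@g_unit d)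
  (@g_transition c d) (@J_transition c d) Wy).
Qed.

Lemma jac_unit : jac_mx (transition c d) y \in unitmx.
Proof. exact (jacobian_unit guW (@g_transition c d) Wy). Qed.

Lemma nabla_transition (X : V) :
  nabla_endo (g c) (J c) y X *m jac_mx (transition c d) y
  = jac_mx (transition c d) y
    *m nabla_endo (g d) (J d) (transition c d y) (X *m jac_mx (transition c d) y).
Proof.
have sums (K : 'M[R]_4) (P P' : 'I_4 -> 'M[R]_4) :
    (forall k, P k *m K = K *m \sum_a K k a *: P' a) ->
    (\sum_k X 0 k *: P k) *m K = K *m \sum_a (X *m K) 0 a *: P' a.
  move=> PK; rewrite mulmx_suml.
  transitivity (\sum_k K *m (X 0 k *: \sum_a K k a *: P' a)).
    by apply: eq_bigr => k _; rewrite -scalemxAl PK scalemxAr.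
  rewrite -mulmx_sumr; congr (_ *m _); under eq_bigr do rewrite scaler_sumr.
  rewrite exchange_big/=; apply: eq_bigr => a _; rewrite mxE scaler_suml.
  by apply: eq_bigr => k _; rewrite scalerA.
exact (sums _ (fun k => covd (christoffel (g c)) k (J c) y)
  (fun a => covd (christoffel (g d)) a (J d) (transition c d y)) covd_J_transition).
Qed.

Lemma nullity_transition :
  (kahler_nullity g J c y *m jac_mx (transition c d) y
   == kahler_nullity g J d (transition c d y))%MS.
Proof.
have uK := jac_unit; have NT := nabla_transition.
set K := jac_mx (transition c d) y in uK NT *.
have nT (X : V) : (X *m K <= kahler_nullity g J d (transition c d y))%MS
    <-> (X <= kahler_nullity g J c y)%MS.
  rewrite !kahler_nullityP; split=> h; have := NT X; rewrite h ?mulmx0 ?mul0mx.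
    by move=> /(congr1 (fun A => A *m invmx K)); rewrite mulmxK// mul0mx.
  by move=> /(congr1 (fun A => invmx K *m A)); rewrite mulKmx// mulmx0.
apply/andP; split; apply/rV_subP => X.
  move=> /submxP[Z ->]; rewrite mulmxA; apply/nT; exact: submxMl.
move=> XD; have XE : X = X *m invmx K *m K by rewrite mulmxKV.
by rewrite XE submxMr//; apply/nT; rewrite -XE.
Qed.

End Overlap.

Lemma dJ_norm_chart c d p : chart_dom c p -> chart_dom d p ->
  dJ_norm c (chart_map c p) = dJ_norm d (chart_map d p).
Proof.
move=> cp dp; rewrite -(transition_map d cp); apply: dJ_norm_transition.
by exists p.
Qed.

(** ** The derivative of J vanishes nowhere *)

Lemma smooth_Gam c k : smooth_on_mx (chart_img c) (christoffel (g c) ^~ k).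
Proof. exact (smooth_christoffel (@open_chart_img c) (@smooth_g c) (@g_unit c) k). Qed.

Lemma Gam_metric c x k : chart_img c x -> partial_mx k (g c) x
  = christoffel (g c) x k *m g c x + g c x *m (christoffel (g c) x k)^T.
Proof. exact (christoffel_metric (@open_chart_img c) (@g_tr c) (@g_unit c) k). Qed.

Lemma GamC c x i k l : chart_img c x ->
  christoffel (g c) x k i l = christoffel (g c) x i k l.
Proof. exact (christoffelC (@open_chart_img c) (@g_tr c) i k l). Qed.

Lemma dJ_norm_locally_constant c x : chart_img c x ->
  \forall y \near x, dJ_norm c y = dJ_norm c x.
Proof.
move=> cx; apply: (partial_eq0_locally_constant (@open_chart_img c) cx) => y.
  move=> cy; apply: smooth_on_differentiable cy.
  exact (smooth_norm_dJ (@open_chart_img c) (@smooth_g c) (@g_pos c) (@smooth_Gam c)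
    (@smooth_J c)).
move=> a cy.
exact (partial_norm_eq0 (@open_chart_img c) (@smooth_g c) (@g_tr c) (@g_pos c)
  (@smooth_Gam c) (@Gam_metric c) (@GamC c) (@smooth_J c) (@J_sqr c) (@J_orthogonal c)
  (@Jg_closed c) (@G2_chart c) a cy).
Qed.

Hypotheses (connM : connected [set: M]) (nonkahler : ~ kahler g J Om).

(** Otherwise J would be parallel, hence integrable. *)
Lemma dJ_norm_somewhere : exists c p, chart_dom c p /\ dJ_norm c (chart_map c p) != 0.
Proof.
apply: contrapT => N0; apply: nonkahler; split=> // c _ [p cp <-] i j k.
have cx := chart_imgP cp.
apply: (parallel_integrable (Gam := christoffel (g c))).
- by move=> a b e; exact: GamC.
- exact: J_sqr.
move=> l.
apply/(norm_eq0 (@open_chart_img c) (@smooth_g c) (@g_tr c) (@g_pos c) (@Gam_metric c)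
  (@GamC c) (@smooth_J c) (@J_sqr c) (@J_orthogonal c) (@Jg_closed c) l cx).
by apply/eqP/negPn/negP => Nx; apply: N0; exists c, p.
Qed.

(** The norm of the derivative of J is locally constant, so its zero set is
    open and closed. *)
Lemma dJ_norm_neq0 c x : chart_img c x -> dJ_norm c x != 0.
Proof.
have [ch chP] := choice (@chart_dom_cover _ _ A).
pose n p := dJ_norm (ch p) (chart_map (ch p) p).
have nE e p : chart_dom e p -> n p = dJ_norm e (chart_map e p).
  by move=> ep; exact: dJ_norm_chart.
have near_n p : \forall q \near p, n q = n p.
  have cp := chP p; have cx := chart_imgP cp.
  have cont := @chart_map_continuous _ _ A (ch p).
  rewrite continuous_open_subspace in cont; last exact: chart_dom_open.
  have pin : p \in chart_dom (ch p) by rewrite inE.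
  have nN : \forall q \near p, dJ_norm (ch p) (chart_map (ch p) q) = n p.
    exact: cont p pin _ (dJ_norm_locally_constant cx).
  have nD : \forall q \near p, chart_dom (ch p) q.
    by apply: open_nbhs_nbhs; split=> //; exact: chart_dom_open.
  by apply: filterS2 nN nD => q Nq Dq; rewrite (nE _ _ Dq).
have oZ (Q : R -> Prop) : open [set p | Q (n p)].
  rewrite openE => p Qp; rewrite /interior.
  by apply: filterS (near_n p) => q /= ->.
suff all : [set p | n p <> 0] = setT.
  move=> [p cp <-]; rewrite -(nE _ _ cp); apply/eqP.
  by have : [set: M] p by []; rewrite -all.
apply: connM.
- by have [c' [p [cp Np]]] := dJ_norm_somewhere; exists p; rewrite /= (nE _ _ cp); exact/eqP.
- by exists [set p | n p <> 0]; [exact: (oZ (fun r => r <> 0))|rewrite setTI].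
exists [set p | n p <> 0]; last by rewrite setTI.
rewrite -openC (_ : ~` _ = [set p | n p = 0]); first exact: (oZ (fun r => r = 0)).
by apply/seteqP; split => p /=; [move=> /contrapT|move=> ? ?].
Qed.

(** ** The nullity and the reversed structure *)

Section AtPoint.
Variables (c : chart A) (x : V).
Hypothesis cx : chart_img c x.
Let D := kahler_nullity g J c x.
Let D' := perp g (kahler_nullity g J) c x.
Let Pi := nproj (g c) (christoffel (g c)) (J c) x.
Let N0 z (cz : chart_img c z) := dJ_norm_neq0 cz.
Local Notation chart_facts L := (L R (chart_img c) (g c) (J c) (@open_chart_img c) (@smooth_g c) (@g_tr c) (@g_pos c)
  (@smooth_J c) (@J_sqr c) (@J_orthogonal c) (@Jg_closed c) (@G2_chart c) N0 x cx).

Lemma Pi_idem : Pi *m Pi = Pi.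
Proof. exact (chart_facts nproj_idem). Qed.

Lemma Pi_sym : (Pi *m g c x)^T = Pi *m g c x.
Proof. exact (chart_facts nproj_sym). Qed.

Lemma nullity_Pi (X : V) : (X <= D)%MS = (X *m Pi == 0).
Proof.
have NP := chart_facts nproj_nullity X.
by apply/idP/eqP; [move=> /kahler_nullityP/NP|move=> /NP/kahler_nullityP].
Qed.

Lemma perp_Pi (X : V) : (X <= D')%MS = (X *m Pi == X).
Proof. exact: (perpP (g_unit cx) (g_tr cx) Pi_idem Pi_sym nullity_Pi). Qed.

Lemma perp_coPi (X : V) : (X <= D')%MS = (X *m (1%:M - Pi) == 0).
Proof. by rewrite perp_Pi mulmxBr mulmx1 subr_eq0 eq_sym. Qed.

Lemma coPi_idem : (1%:M - Pi) *m (1%:M - Pi) = 1%:M - Pi.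
Proof. by rewrite mulmxBl mul1mx mulmxBr mulmx1 Pi_idem subrr subr0. Qed.

Lemma coPi_sym : ((1%:M - Pi) *m g c x)^T = (1%:M - Pi) *m g c x.
Proof. by rewrite mulmxBl mul1mx raddfB/= Pi_sym g_tr. Qed.

Lemma reversedE : reversed g J (kahler_nullity g J) c x
  = Jbar (g c) (christoffel (g c)) (J c) x.
Proof.
have [p1 p2] := proj_nullity (g_unit cx) (g_tr cx) Pi_idem Pi_sym nullity_Pi
  (perp_capmx (kahler_nullity g J) (g_pos cx)).
rewrite /reversed -/D -/D' p1 p2 /Jbar -/Pi.
by rewrite !mulmxBl mul1mx scalerDl scale1r opprD addrA.
Qed.

Lemma restrictionE : restriction g (kahler_nullity g J) c x
  = (1%:M - Pi) *m g c x *m (1%:M - Pi)^T.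
Proof.
have [p1 p2] := proj_nullity (g_unit cx) (g_tr cx) Pi_idem Pi_sym nullity_Pi
  (perp_capmx (kahler_nullity g J) (g_pos cx)).
by rewrite /restriction -/D -/D' p1.
Qed.

Lemma restriction_perpE : restriction g (perp g (kahler_nullity g J)) c x
  = Pi *m g c x *m Pi^T.
Proof.
have [p1 p2] := proj_nullity (g_unit cx) (g_tr cx) coPi_idem coPi_sym perp_coPi
  (perp_capmx (perp g (kahler_nullity g J)) (g_pos cx)).
by rewrite /restriction -/D' p1 opprB addrC subrK.
Qed.

Lemma nullity_rank : exists2 Z : 'M[R]_(2, 4), \rank D = 2%N
  & Z *m (1%:M - Pi) = Z /\ Z *m (g c x *m Z^T) = 1%:M.
Proof.
have [B [p [[BG _ _ _] [hPi _ _]]]] := chart_facts normal_frame.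
have BGB : g c x *m B^T *m B = 1%:M by apply: mulmx1C; rewrite mulmxA.
have BPi : B *m (1%:M - Pi) = (1%:M - Pi0 R) *m B.
  by rewrite mulmxBr mulmxBl mulmx1 mul1mx -hPi -(frame_hat Pi BG).
pose C : 'M[R]_(2, 4) := \matrix_(i, j) (j == (if i == 0 then i2 else i3))%:R.
have CC : C *m C^T = 1%:M.
  by apply/matrixP => i j; rewrite mxE sum4E !mxE;
    case: i => [[|[|//]] Hi]; case: j => [[|[|//]] Hj]; rewrite /=; ring.
have CTC : C^T *m C = 1%:M - Pi0 R.
  apply/matrixP => i j; rewrite mxE !big_ord_recl big_ord0 !mxE /=.
  by elim/ord4P: i; elim/ord4P: j; rewrite /=; ring.
have ZZ : C *m B *m (g c x *m (C *m B)^T) = 1%:M.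
  by rewrite trmx_mul !mulmxA -(mulmxA C) -(mulmxA C) BG mulmx1 CC.
have ZPi : C *m B *m (1%:M - Pi) = C *m B.
  by rewrite -mulmxA BPi -CTC !mulmxA CC mul1mx.
exists (C *m B); last by [].
have uB : B \in unitmx by have [] := mulmx1_unit (etrans (mulmxA _ _ _) BG).
have /eqmxP DE := nullity_eqmx Pi_idem nullity_Pi.
have ZE : (1%:M - Pi == C *m B)%MS.
  apply/andP; split; last by apply/submxP; exists (C *m B); rewrite ZPi.
  apply/submxP; exists (invmx B *m C^T); rewrite -mulmxA (mulmxA C^T) CTC -BPi.
  by rewrite mulKmx.
rewrite DE (eqmxP ZE); apply/eqP; apply/row_freeP; by exists (g c x *m (C *m B)^T).
Qed.

End AtPoint.

Lemma smooth_Pi c : smooth_on_mx (chart_img c) (nproj (g c) (christoffel (g c)) (J c)).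
Proof.
exact (smooth_nproj (@open_chart_img c) (@smooth_g c) (@g_pos c) (@smooth_Gam c)
  (@smooth_J c) (@dJ_norm_neq0 c)).
Qed.

(** Near a point the nullity is spanned by the projections of a basis of the
    nullity at this point. *)
Lemma nullity_distribution : smooth_distribution 2 (kahler_nullity g J).
Proof.
split=> [c x cx|c d p cp dp]; last first.
  have Wy : overlap c d (chart_map c p) by exists p.
  have := nullity_transition Wy.
  by rewrite jacobian_transition// transition_map.
have [Z _ [ZPi ZZ]] := nullity_rank cx.
pose Pi := nproj (g c) (christoffel (g c)) (J c).
pose B y := Z *m (1%:M - Pi y).
have sB : smooth_on_mx (chart_img c) B.
  apply: smooth_on_mxM; [exact: open_chart_img|by move=> i j; exact: smooth_on_cst|].
  apply: smooth_on_mxB; [exact: open_chart_img|exact: smooth_on_mx_cst|exact: smooth_Pi].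
pose f y := \det (B y *m (g c x *m Z^T)).
have sf : smooth_on (chart_img c) f.
  apply: smooth_on_det; first exact: open_chart_img.
  by apply: smooth_on_mxM => //; [exact: open_chart_img|move=> i j; exact: smooth_on_cst].
pose U := [set y | chart_img c y /\ f y != 0].
exists U, B; split.
- rewrite openE => y [cy fy].
  have cf : {for y, continuous f}.
    by apply: differentiable_continuous; exact: smooth_on_differentiable sf cy.
  have nc : nbhs y (chart_img c) by apply: open_nbhs_nbhs; split=> //; exact: open_chart_img.
  have nf : \forall z \near y, f z != 0 by exact: cvgr_neq0 cf fy.
  by apply: filterS2 nc nf => z cz fz; split.
- by split=> //; rewrite /f /B ZPi ZZ det1 oner_eq0.
- by move=> y [].
- by move=> i j; apply: sub_smooth_on (sB i j) => y [].
move=> y [cy fy]; have rB : row_free (B y).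
  apply/row_freeP; exists (g c x *m Z^T *m invmx (B y *m (g c x *m Z^T))).
  by rewrite (mulmxA (B y) (g c x *m Z^T)) mulmxV// unitmxE unitfE.
split=> //; have BD : (B y <= kahler_nullity g J c y)%MS.
  apply/rV_subP => X /submxP[Y ->]; rewrite nullity_Pi// -!mulmxA mulmxBl mul1mx.
  by rewrite Pi_idem// subrr !mulmx0.
have [_ r2 _] := nullity_rank cy.
have := mxrank_leqif_eq BD; move/eqP: rB => ->; rewrite r2 => -[_ /esym].
by rewrite eqxx => /eqmxP h; apply/eqmxP/eqmx_sym.
Qed.

(** ** The reversed almost Kaehler structure *)

Let D := kahler_nullity g J.
Let Jb := reversed g J D.
Let Omb := fundamental_form g Jb.
Let JbE c x (cx : chart_img c x) : Jb c x = Jbar (g c) (christoffel (g c)) (J c) x.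
Proof. exact: reversedE. Qed.

Let N0 c z (cz : chart_img c z) := dJ_norm_neq0 cz.
Local Notation chart_facts L c x cx := (L R (chart_img c) (g c) (J c) (@open_chart_img c)
  (@smooth_g c) (@g_tr c) (@g_pos c)
  (@smooth_J c) (@J_sqr c) (@J_orthogonal c) (@Jg_closed c) (@G2_chart c) (@N0 c) x cx).

Lemma smooth_reversed c : smooth_on_mx (chart_img c) (Jb c).
Proof.
apply: (eq_smooth_on_mx (@open_chart_img c)
  (F := Jbar (g c) (christoffel (g c)) (J c))) => [y cy|]; first by rewrite JbE.
exact (smooth_Jbar (@open_chart_img c) (@smooth_g c) (@g_pos c) (@smooth_Gam c)
  (@smooth_J c) (@dJ_norm_neq0 c)).
Qed.

Lemma reversed_sqr c x : chart_img c x -> Jb c x *m Jb c x = - 1%:M.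
Proof. by move=> cx; rewrite JbE//; exact (chart_facts (@Jbar_sqr) c x cx). Qed.

Lemma reversed_orthogonal c x : chart_img c x -> Jb c x *m g c x *m (Jb c x)^T = g c x.
Proof. by move=> cx; rewrite JbE//; exact (chart_facts (@Jbar_orthogonal) c x cx). Qed.

Lemma reversed_skew c x : chart_img c x -> (Omb c x)^T = - Omb c x.
Proof.
move=> cx; have := chart_facts (@Jbar_skew) c x cx; rewrite -JbE// -/(Omb c x) => h.
by apply/eqP; rewrite -addr_eq0 addrC; apply/eqP.
Qed.

Lemma reversed_endo : endo_field Jb.
Proof.
split=> [|c d p cp dp /=]; first exact: smooth_reversed.
have Wy : overlap c d (chart_map c p) by exists p.
have := reversed_transition Wy.
by rewrite -jacobian_transition// transition_map// -!JbE//; exact: chart_imgP.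
Qed.

Lemma reversed_almost_kahler : almost_kahler g Jb Omb.
Proof.
have [gm [_ _] _ _ _] := akJ; split=> //.
- by split; [exact: reversed_endo|move=> c x; exact: reversed_sqr].
- split.
  + split=> [c|c d p cp dp /=].
      apply: smooth_on_mxM; [exact: open_chart_img|exact: smooth_reversed|exact: smooth_g].
    have [_ JK] := reversed_endo; have [[_ gK] _ _] := gm.
    have e (a k h kt b : 'M[R]_4) : a *m k = k *m b ->
        a *m (k *m h *m kt) = k *m (b *m h) *m kt.
      by move=> akb; rewrite !mulmxA akb.
    by rewrite /Omb /fundamental_form (gK c d p cp dp); apply: e; exact: JK.
  + by move=> c x; exact: reversed_skew.
  + move=> c x cx; rewrite unitmx_mul g_unit// andbT.
    have /mulmx1_unit[] // : Jb c x *m - Jb c x = 1%:M.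
    by rewrite mulmxN reversed_sqr// opprK.
  + move=> c x cx i j k; rewrite -[RHS](chart_facts (@Jbar_closed) c x cx i j k).
    have E a u v : partial a (fun y => Omb c y u v) x = partial a
        (fun y => (Jbar (g c) (christoffel (g c)) (J c) y *m g c y) u v) x.
      apply: (eq_partial _ (@open_chart_img c) cx) => y cy.
      by rewrite /Omb /fundamental_form JbE.
    exact (congr2 +%R (congr2 +%R (E i j k) (E j k i)) (E k i j)).
- by move=> c x cx X Y; rewrite /bil trmx_mul -{2}(reversed_orthogonal cx) !mulmxA.
by move=> c x cx X Y; rewrite /bil /Omb /fundamental_form !mulmxA.
Qed.

Lemma reversed_parallel c x : chart_img c x -> forall X : V, (X <= perp g D c x)%MS ->
  nabla_endo (g c) (Jb c) x X = 0.
Proof.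
move=> cx X; rewrite perp_Pi// => /eqP XPi.
rewrite -[RHS](chart_facts (@Jbar_parallel) c x cx XPi).
apply: eq_bigr => k _; congr (_ *: _).
apply: (eq_covd (christoffel (g c)) (@open_chart_img c) k cx) => y cy.
exact: JbE.
Qed.

Lemma reversed_curvature c x : chart_img c x -> forall f : 'M[R]_4, f^T = - f ->
  [/\ ricci0 (g c) x = (conformal_scal (g c) (J c) (Om c) x / 4)
         *: (- restriction g D c x + restriction g (perp g D) c x),
    orient (Jb c x) = - orient (J c x),
    Jb c x *m ricci (g c) x *m (Jb c x)^T = ricci (g c) x &
    weyl_minus2 (g c) (J c) (Jb c) (Omb c) x f = 0].
Proof.
move=> cx f fT.
have wE : Omb c x = Jbar (g c) (christoffel (g c)) (J c) x *m g c x.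
  by rewrite /Omb /fundamental_form JbE.
have [h1 h2 h3 h4] := chart_facts (@curvature_summary) c x cx fT (OmE cx) wE.
split.
- by rewrite h1 restrictionE// restriction_perpE.
- by rewrite JbE.
- by rewrite JbE.
by rewrite -[RHS]h4 -JbE.
Qed.

End Global.

Theorem proposition2 (R : realType) (M : topologicalType)
    (hausM : hausdorff_space M) (countM : @second_countable M)
    (connM : connected [set: M])
    (A : atlas4 R M) (g J Om : mxfield A)
    (akJ : almost_kahler g J Om) (nonkahler : ~ kahler g J Om)
    (G2 : condition_G2 g J) :
  let D := kahler_nullity g J in
  let D' := perp g D in
  let Jb := reversed g J D in
  let Omb := fundamental_form g Jb in
  smooth_distribution 2 D /\
  (forall c x, chart_img c x ->
     ricci0 (g c) x =
       (conformal_scal (g c) (J c) (Om c) x / 4)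
         *: (- restriction g D c x + restriction g D' c x)) /\
  [/\ almost_kahler g Jb Omb,
      forall c x, chart_img c x -> orient (Jb c x) = - orient (J c x),
      forall c x, chart_img c x -> forall X Y,
        bil (ricci (g c) x) (X *m Jb c x) (Y *m Jb c x)
        = bil (ricci (g c) x) X Y,
      forall c x, chart_img c x -> forall f : 'M[R]_4, f^T = - f ->
        weyl_minus2 (g c) (J c) (Jb c) (Omb c) x f = 0 &
      forall c x, chart_img c x -> forall X : 'rV[R]_4, (X <= D' c x)%MS ->
        nabla_endo (g c) (Jb c) x X = 0].
Proof.
have T0 : (0 : 'M[R]_4)^T = - 0 by rewrite trmx0 oppr0.
have curv := reversed_curvature akJ G2 connM nonkahler.
split; first exact: (nullity_distribution akJ G2 connM nonkahler).
split=> [c x cx|]; first by have [h _ _ _] := curv c x cx 0 T0.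
split.
- exact: (reversed_almost_kahler akJ G2 connM nonkahler).
- by move=> c x cx; have [_ h _ _] := curv c x cx 0 T0.
- move=> c x cx X Y; have [_ _ h _] := curv c x cx 0 T0.
  by rewrite /bil trmx_mul -[in RHS]h !mulmxA.
- by move=> c x cx f fT; have [_ _ _ h] := curv c x cx f fT.
by move=> c x cx X; exact: (reversed_parallel akJ G2 connM nonkahler).
Qed.
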